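(* Let $G$ be a Lie group with Lie algebra $\mathfrak g$ and let $k\ge1$. The right trivialized $k$-th order jet bundle $J^kG=G\times\mathfrak g^k$ is an abelian Lie group extension of the right trivialized $(k-1)$-th order jet bundle $J^{k-1}G=G\times\mathfrak g^{k-1}$ by $\mathfrak g$, characterized by the group cocycle $$c_k\left((g,x_1,\dots,x_{k-1}),(h,y_1,\dots,y_{k-1})\right)=\sum_{\lambda\in\mathcal P_k\setminus\{12\dots k\}}\operatorname{ad}_{x_{i_{\ell-1}}}\cdots\operatorname{ad}_{x_{i_1}}\operatorname{Ad}_gy_{i_\ell} =\sum_{\ell=2}^k\ \sum_{i_1+\dots+i_\ell=k}N_{(i_1,\dots,i_\ell)}\operatorname{ad}_{x_{i_{\ell-1}}}\cdots\operatorname{ad}_{x_{i_1}}\operatorname{Ad}_gy_{i_\ell},$$ where in the first sum $\lambda=\lambda_1|\dots|\lambda_\ell$ is anti-lexicographically ordered with $i_r=|\lambda_r|$, and in the second sum the $i_r$ are positive integers. Its Lie algebra $J^k\mathfrak g$ is an abelian extension of $J^{k-1}\mathfrak g$ by $\mathfrak g$ with Lie algebra cocycle $$\sigma_k\left((\xi,x_1,\dots,x_{k-1}),(\eta,y_1,\dots,y_{k-1})\right)=\sum_{i=1}^{k-1}\binom ki[x_i,y_{k-i}].$$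
   Context: Jet group: $J^kG$ is the manifold of $k$-jets $j^kc$ at $0$ of smooth curves $c$ in $G$, a Lie group under $(j^kc)(j^kb):=j^k(cb)$ (pointwise product of curves); $J^0G=G$. The right trivialization is the bundle isomorphism $J^kG\to G\times\mathfrak g^k$, $$j^kc\mapsto\left(c(0),(\delta^rc)(0),(\delta^rc)'(0),\dots,(\delta^rc)^{(k-1)}(0)\right),\qquad\delta^rc=c'c^{-1}.$$ The projection $J^kG\to J^{k-1}G$ forgets the last component, $(g,x_1,\dots,x_k)\mapsto(g,x_1,\dots,x_{k-1})$, and $\mathfrak g$ (an additive group) is included as the last component $x\mapsto(e,0,\dots,0,x)$. The Lie algebra $J^k\mathfrak g$ of $J^kG$ is identified as a vector space with $\mathfrak g\times\mathfrak g^k$ by differentiating the right trivialization at the identity. Meaning of the terms: $J^{k-1}G$ acts on $\mathfrak g$ by $(g,x_1,\dots,x_{k-1})\cdot y=\operatorname{Ad}_gy$, and correspondingly $J^{k-1}\mathfrak g$ acts on $\mathfrak g$ by $(\xi,x_1,\dots,x_{k-1})\cdot y=[\xi,y]$. The extension is characterized by the group 2-cocycle $c_k$ if, writing elements of $J^kG$ as $(a,x)\in J^{k-1}G\times\mathfrak g$, the multiplication is $(a,x)(b,y)=(ab,\ x+a\cdot y+c_k(a,b))$. The Lie algebra extension has cocycle $\sigma_k$ if, writing elements of $J^k\mathfrak g$ as $(u,x)\in J^{k-1}\mathfrak g\times\mathfrak g$, the bracket is $[(u,x),(v,y)]=([u,v],\ u\cdot y-v\cdot x+\sigma_k(u,v))$.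 $\operatorname{Ad}$ is the adjoint action of $G$ and $\operatorname{ad}_xy=[x,y]$, with the usual bracket convention $\frac{d}{dt}\big|_{t=0}\operatorname{Ad}_{\exp(tx)}y=[x,y]$. Partitions: $\mathcal P_k$ is the set of all partitions $\lambda=\lambda_1|\dots|\lambda_\ell$ of $\{1,\dots,k\}$ into nonempty disjoint subsets, each ordered anti-lexicographically: the ordering is done from right to left, always choosing the subset that contains the highest available number (equivalently $\max\lambda_1<\dots<\max\lambda_\ell=k$). $12\dots k$ denotes the partition with a single block. For positive integers $i_1,\dots,i_\ell$, $$N_{(i_1,\dots,i_\ell)}=\binom{i_1+\dots+i_\ell-1}{i_\ell-1}\binom{i_1+\dots+i_{\ell-1}-1}{i_{\ell-1}-1}\cdots\binom{i_1+i_2-1}{i_2-1}.$$ Empty sums are $0$. *)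

(* Defs.v *)
From HB Require Import structures.
From mathcomp Require Import all_boot all_order all_algebra.
From mathcomp Require Import all_classical all_reals all_analysis.
Set Implicit Arguments.
Unset Strict Implicit.
Unset Printing Implicit Defensive.
Import Order.TTheory GRing.Theory Num.Theory.
Import numFieldNormedType.Exports.
Local Open Scope classical_set_scope.
Local Open Scope ring_scope.

(* All model spaces used below are finite dimensional ('rV[R]_n, 'M[R]_(m, n),
   R^o and products of these); there, the following is the usual notion of a
   function of class C^m, resp. C^oo, on an open set. *)

Fixpoint class_C (R : realType) (E F : normedModType R) (m : nat) (U : set E)
    (f : E -> F) : Prop :=
  match m with
  | 0 => {in U, continuous f}
  | m'.+1 => (forall x, U x -> differentiable f x) /\
             (forall v, class_C m' U (fun x => 'D_v f x))
  end.

Definition smooth_on (R : realType) (E F : normedModType R) (U : set E)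
    (f : E -> F) : Prop := forall m, class_C m U f.

Record chart (R : realType) (E : normedModType R) (M : topologicalType) :=
  Chart { chart_dom : set M; chart_map : M -> E; chart_inv : E -> M }.

Record mfd (R : realType) (E : normedModType R) :=
  Mfd { mfd_car :> topologicalType; chart_at : mfd_car -> chart E mfd_car }.

Arguments chart_at {R E} m _.

Section Manifolds.
Context (R : realType).

Definition chart_img (E : normedModType R) (M : topologicalType)
    (f : chart E M) : set E := chart_map f @` chart_dom f.

Definition is_chart (E : normedModType R) (M : topologicalType)
    (f : chart E M) : Prop :=
  [/\ open (chart_dom f), open (chart_img f),
      forall p, chart_dom f p -> chart_inv f (chart_map f p) = p,
      {in chart_dom f, continuous (chart_map f)} &
      {in chart_img f, continuous (chart_inv f)}].

Definition is_manifold (E : normedModType R) (M : mfd E) : Prop :=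
  [/\ hausdorff_space M, @second_countable M,
      forall p : M, is_chart (chart_at M p) /\ chart_dom (chart_at M p) p &
      forall p q : M,
        smooth_on
          (chart_map (chart_at M p) @`
             (chart_dom (chart_at M p) `&` chart_dom (chart_at M q)))
          (chart_map (chart_at M q) \o chart_inv (chart_at M p))].

(* Continuity at [p] forces [f] to map a neighbourhood of [p] into the domain
   of the chart around [f p]. *)
Definition smooth_at (E F : normedModType R) (M : mfd E) (N : mfd F)
    (f : M -> N) (p : M) : Prop :=
  {for p, continuous f} /\
  exists2 V : set E, open V /\ V (chart_map (chart_at M p) p) &
    smooth_on V
      (chart_map (chart_at N (f p)) \o f \o chart_inv (chart_at M p)).

Definition smooth_map (E F : normedModType R) (M : mfd E) (N : mfd F)
    (f : M -> N) : Prop := forall p, smooth_at f p.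

Definition vec_mfd (E : normedModType R) : mfd E :=
  @Mfd R E E (fun=> Chart setT id id).

Definition prod_chart (E F : normedModType R) (M N : topologicalType)
    (f : chart E M) (g : chart F N) : chart (E * F)%type (M * N)%type :=
  Chart (chart_dom f `*` chart_dom g)
    (fun p => (chart_map f p.1, chart_map g p.2))
    (fun x => (chart_inv f x.1, chart_inv g x.2)).

Definition prod_mfd (E F : normedModType R) (M : mfd E) (N : mfd F) :
    mfd (E * F)%type :=
  @Mfd R (E * F)%type (M * N)%type
    (fun p => prod_chart (chart_at M p.1) (chart_at N p.2)).

End Manifolds.

(* The raw data of a Lie group modelled on [E]; the axioms are in
   [is_lie_group], so that being a Lie group can also be asserted of data
   which are constructed without proofs, such as the jet groups below. *)
Record lie_data (R : realType) (E : normedModType R) := LieData {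
  lie_mfd :> mfd E;
  lg_mul : lie_mfd -> lie_mfd -> lie_mfd;
  lg_one : lie_mfd;
  lg_inv : lie_mfd -> lie_mfd }.

Arguments lg_mul {R E l} _ _.
Arguments lg_one {R E} l.
Arguments lg_inv {R E l} _.

Section LieGroups.
Context (R : realType).

Definition is_lie_group (E : normedModType R) (G : lie_data E) : Prop :=
  is_manifold G /\
  [/\ associative (@lg_mul R E G),
      left_id (lg_one G) lg_mul,
      right_id (lg_one G) lg_mul,
      left_inverse (lg_one G) lg_inv lg_mul &
      right_inverse (lg_one G) lg_inv lg_mul] /\
  smooth_map (M := prod_mfd G G) (N := G) (fun p => lg_mul p.1 p.2) /\
  smooth_map (M := G) (N := G) lg_inv.

Definition lie_morphism (E F : normedModType R) (G : lie_data E)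
    (H : lie_data F) (f : G -> H) : Prop :=
  smooth_map f /\ forall a b, f (lg_mul a b) = lg_mul (f a) (f b).

Definition vec_lie (E : normedModType R) : lie_data E :=
  @LieData R E (vec_mfd E) (fun x y => x + y) 0 (fun x => - x).

(* 1 -> A -> X -> Q -> 1 is an exact sequence of Lie groups with A abelian, and
   X -> Q has smooth local sections. *)
Definition abelian_lie_group_extension (EA EX EQ : normedModType R)
    (A : lie_data EA) (X : lie_data EX) (Q : lie_data EQ)
    (i : A -> X) (q : X -> Q) : Prop :=
  [/\ is_lie_group A, is_lie_group X & is_lie_group Q] /\
  commutative (@lg_mul R EA A) /\
  [/\ lie_morphism i, injective i, lie_morphism q & forall a, exists p, q p = a] /\
  (forall p, q p = lg_one Q <-> exists x, p = i x) /\
  (forall a, exists U : set Q, exists s : Q -> X,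
     [/\ open U, U a & forall b, U b -> smooth_at s b /\ q (s b) = b]).

(* The tangent space of [G] at the identity is identified with [E] through the
   chart around the identity. *)
Definition Ad (E : normedModType R) (G : lie_data E) (g : G) (y : E) : E :=
  let f := chart_at G (lg_one G) in
  'D_y (fun z => chart_map f (lg_mul (lg_mul g (chart_inv f z)) (lg_inv g)))
    (chart_map f (lg_one G)).

(* [x, y] = ad_x y, where ad is the derivative of Ad at the identity; it is the
   derivative of t |-> Ad_(c t) y at 0 for any curve c through the identity with
   velocity x, for instance for c t = exp (t x). *)
Definition lie_bracket (E : normedModType R) (G : lie_data E) (x y : E) : E :=
  let f := chart_at G (lg_one G) in
  'D_x (fun z => Ad (chart_inv f z) y) (chart_map f (lg_one G)).

Definition group_2cocycle (E : normedModType R) (G : lie_data E)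
    (V : lmodType R) (act : G -> V -> V) (d : G -> G -> V) : Prop :=
  [/\ forall y, act (lg_one G) y = y,
      forall a b y, act (lg_mul a b) y = act a (act b y),
      forall a, linear (act a) &
      forall a b c,
        act a (d b c) - d (lg_mul a b) c + d a (lg_mul b c) - d a b = 0].

Definition is_lie_algebra (V : lmodType R) (br : V -> V -> V) : Prop :=
  [/\ forall y, linear (br ^~ y),
      forall x, linear (br x),
      forall x, br x x = 0 &
      forall x y z, br x (br y z) + br y (br z x) + br z (br x y) = 0].

Definition lie_algebra_morphism (V W : lmodType R) (brV : V -> V -> V)
    (brW : W -> W -> W) (f : V -> W) : Prop :=
  linear f /\ forall x y, f (brV x y) = brW (f x) (f y).

Definition abelian_lie_algebra_extension (A X Q : lmodType R)
    (brA : A -> A -> A) (brX : X -> X -> X) (brQ : Q -> Q -> Q)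
    (i : A -> X) (q : X -> Q) : Prop :=
  [/\ is_lie_algebra brA, is_lie_algebra brX & is_lie_algebra brQ] /\
  (forall x y, brA x y = 0) /\
  [/\ lie_algebra_morphism brA brX i, injective i,
      lie_algebra_morphism brX brQ q & forall u, exists p, q p = u] /\
  (forall p, q p = 0 <-> exists x, p = i x).

Definition lie_algebra_2cocycle (L V : lmodType R) (br : L -> L -> L)
    (act : L -> V -> V) (s : L -> L -> V) : Prop :=
  [/\ forall y, linear (act ^~ y),
      forall u, linear (act u) &
      forall u v y, act (br u v) y = act u (act v y) - act v (act u y)] /\
  [/\ forall v, linear (s ^~ v),
      forall u, linear (s u),
      forall u, s u u = 0 &
      forall u v w,
        act u (s v w) + act v (s w u) + act w (s u v)
        - s (br u v) w - s (br v w) u - s (br w u) v = 0].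

End LieGroups.

Section Jets.
Context (R : realType) (n : nat) (G : lie_data 'rV[R]_n).

(* Jets at 0 only depend on the germ of a curve at 0: a curve is a function on
   the whole line which is smooth on some neighbourhood of 0. *)
Definition smooth_curve (c : R^o -> G) : Prop :=
  smooth_at (M := vec_mfd R^o) (N := G) c 0.

Definition same_jet (k : nat) (c b : R^o -> G) : Prop :=
  c 0 = b 0 /\
  forall i, (0 < i <= k)%N ->
    derive1n i (chart_map (chart_at G (c 0)) \o c) 0 =
    derive1n i (chart_map (chart_at G (c 0)) \o b) 0.

(* The jet j^k c, as an equivalence class of smooth curves. *)
Definition jet (k : nat) (c : R^o -> G) : set (R^o -> G) :=
  [set b | smooth_curve b /\ same_jet k c b].

Definition jets (k : nat) : set (set (R^o -> G)) := jet k @` smooth_curve.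

Definition jet_rep (j : set (R^o -> G)) : R^o -> G := xget (fun=> lg_one G) j.

Definition curve_mul (c b : R^o -> G) : R^o -> G := fun t => lg_mul (c t) (b t).

Definition jet_mul (k : nat) (j1 j2 : set (R^o -> G)) : set (R^o -> G) :=
  jet k (curve_mul (jet_rep j1) (jet_rep j2)).

Definition jet_one (k : nat) : set (R^o -> G) := jet k (fun=> lg_one G).

Definition jet_inv (k : nat) (j : set (R^o -> G)) : set (R^o -> G) :=
  jet k (fun t => lg_inv (jet_rep j t)).

(* The right logarithmic derivative c' c^-1, with values in the Lie algebra. *)
Definition rlogder (c : R^o -> G) : R -> 'rV[R]_n := fun t : R =>
  derive1 (fun s : R => chart_map (chart_at G (lg_one G))
                          (lg_mul (c s) (lg_inv (c t)))) t.

(* An element (x_1, ..., x_k) of the k-th power of the Lie algebra is a matrix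
   with k rows, and x_i is its row of (0-based) index i - 1. *)
Definition rtriv_curve (k : nat) (c : R^o -> G) : G * 'M[R]_(k, n) :=
  (c 0, \matrix_(i < k) derive1n i (rlogder c) 0).

Definition rtriv (k : nat) (j : set (R^o -> G)) : G * 'M[R]_(k, n) :=
  rtriv_curve k (jet_rep j).

Definition rtriv_inv (k : nat) (p : G * 'M[R]_(k, n)) : set (R^o -> G) :=
  xget (jet_one k) [set j | jets k j /\ rtriv k j = p].

(* The operations on jets and the right trivialization, which are defined above
   through representatives, are the intended ones. *)
Definition is_right_trivialization (k : nat) : Prop :=
  [/\ forall c b, smooth_curve c -> smooth_curve b ->
        smooth_curve (curve_mul c b) /\
        jet_mul k (jet k c) (jet k b) = jet k (curve_mul c b),
      forall c, smooth_curve c -> rtriv k (jet k c) = rtriv_curve k c &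
      set_bij (jets k) setT (rtriv k)].

(* The right trivialized jet group: the manifold G x g^k with the group
   structure of the jets transported along the right trivialization. *)
Definition jet_lie (k : nat) : lie_data ('rV[R]_n * 'M[R]_(k, n))%type :=
  @LieData R ('rV[R]_n * 'M[R]_(k, n))%type
    (prod_mfd G (vec_mfd 'M[R]_(k, n)))
    (fun p q => rtriv k (jet_mul k (rtriv_inv p) (rtriv_inv q)))
    (rtriv k (jet_one k))
    (fun p => rtriv k (jet_inv k (rtriv_inv p))).

(* The component x_i, for 1 <= i <= m. *)
Definition jcomp (m : nat) (x : 'M[R]_(m, n)) (i : nat) : 'rV[R]_n :=
  if insub i.-1 is Some j then row j x else 0.

(* The next two are used with T = G for jet groups and with T = 'rV[R]_n for
   their Lie algebras. *)
Definition jpair (T : Type) (k : nat) (a : T * 'M[R]_(k.-1, n))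
    (x : 'rV[R]_n) : T * 'M[R]_(k, n) :=
  (a.1, \matrix_(i < k) if (i < k.-1)%N then jcomp a.2 i.+1 else x).

Definition jproj (T : Type) (k : nat) (p : T * 'M[R]_(k, n)) :
    T * 'M[R]_(k.-1, n) :=
  (p.1, \matrix_(i < k.-1) jcomp p.2 i.+1).

Definition jincl (k : nat) (x : 'rV[R]_n) : G * 'M[R]_(k, n) :=
  jpair (lg_one G, 0) x.

Definition jincl_alg (k : nat) (x : 'rV[R]_n) : 'rV[R]_n * 'M[R]_(k, n) :=
  jpair (0, 0) x.

Definition jact (m : nat) (a : G * 'M[R]_(m, n)) (y : 'rV[R]_n) : 'rV[R]_n :=
  Ad a.1 y.

Definition jact_alg (m : nat) (u : 'rV[R]_n * 'M[R]_(m, n)) (y : 'rV[R]_n) :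
    'rV[R]_n :=
  lie_bracket G u.1 y.

(* For s = (i_1, ..., i_l): ad_(x_(i_(l-1))) ... ad_(x_(i_1)) Ad_g y_(i_l). *)
Definition ad_term (g : G) (x y : nat -> 'rV[R]_n) (s : seq nat) : 'rV[R]_n :=
  foldl (fun z i => lie_bracket G (x i) z) (Ad g (y (last 0%N s)))
    (take (size s).-1 s).

End Jets.

(* The block sizes (|lambda_1|, ..., |lambda_l|) of a partition, with the
   blocks sorted by their maxima. *)
Definition block_sizes (k : nat) (P : {set {set 'I_k}}) : seq nat :=
  [seq #|B| | B : {set 'I_k} <-
     sort (fun A B : {set 'I_k} =>
             (\max_(i in A) (i : nat) <= \max_(i in B) (i : nat))%N)
       (enum P)].

Definition coefN (s : seq nat) : nat :=
  (\prod_(1 <= r < size s)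
     'C((sumn (take r.+1 s)).-1, (nth 0 s r).-1))%N.

Definition is_composition (k : nat) (s : seq nat) : bool :=
  all (fun i => 0 < i)%N s && (sumn s == k).

Section Cocycles.
Context (R : realType) (n : nat) (G : lie_data 'rV[R]_n) (k : nat).

Definition cocycle_part (a b : G * 'M[R]_(k.-1, n)) : 'rV[R]_n :=
  \sum_(P : {set {set 'I_k}} |
          finset.partition P [set: 'I_k]%SET && (P != [set [set: 'I_k]]%SET))
    ad_term a.1 (jcomp a.2) (jcomp b.2) (block_sizes P).

Definition cocycle_comp (a b : G * 'M[R]_(k.-1, n)) : 'rV[R]_n :=
  \sum_(2 <= l < k.+1)
    \sum_(t : l.-tuple 'I_k.+1 | is_composition k [seq val i | i <- t])
      ad_term a.1 (jcomp a.2) (jcomp b.2) [seq val i | i <- t]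
        *+ coefN [seq val i | i <- t].

Definition cocycle_alg (u v : 'rV[R]_n * 'M[R]_(k.-1, n)) : 'rV[R]_n :=
  \sum_(1 <= i < k)
    lie_bracket G (jcomp u.2 i) (jcomp v.2 (k - i)) *+ 'C(k, i).

End Cocycles.

(* Main.v *)
(* Along a curve c with right logarithmic derivative x, Ad_c satisfies
   (Ad_c)' = ad_x Ad_c. Since the right logarithmic derivative of a product cb is
   x + Ad_c y, the Leibniz rule expresses its derivatives by words in ad applied to
   Ad_c y. Each further derivative of such a word either differentiates a letter or
   adds one, which is counted by set partitions, and equivalently by compositions
   with the weights N. A jet is determined by these derivatives, and all values
   occur because the equation c' = x c can be solved for polynomial jets.

   In these coordinates the product of jets is smooth, and its last component has
   the form x + a.y + c_k(a, b); the cocycle identity is associativity. The bracket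
   is the antisymmetrized mixed second derivative of the product in the chart at
   the identity. There only the words with at most one ad survive, and Pascal's
   rule gives the binomial coefficients; the Lie algebra cocycle identities are the
   Jacobi identity. *)

(* The operations on jets are defined through chosen representatives, so as much as possible is
   inherited from curves: the right trivialization of a product of curves depends only on those of
   the factors, and the group axioms follow from the pointwise ones. Inversion is not given by a
   closed formula; its smoothness comes from solving p p^-1 = 1 row by row.

   Jets are compared in the chart around c(0), whereas the logarithmic derivative x uses the chart
   around the identity. Two smooth relations link x to the curve u in the chart, x = f(u, u') and u'
   = g(u, x). They carry agreement of derivatives both ways without any formula for higher
   derivatives.

   Set partitions, weighted compositions and iterated Leibniz rules meet in one recursive
   functional, [comp_sum], which splits off the last part of a composition. This corresponds to the
   block of the maximum, to the last binomial factor of N, and to one step of the Leibniz rule.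

   One description of the bracket by the product in a chart serves both G and the jet group, and
   both cocycle identities are read off on elements whose last component is zero. *)
Require Import Defs.
From HB Require Import structures.
From mathcomp Require Import all_boot all_order all_algebra.
From mathcomp Require Import all_classical all_reals all_analysis.
Import Order.TTheory GRing.Theory Num.Theory.
Import numFieldNormedType.Exports.
Set Implicit Arguments.
Unset Strict Implicit.
Unset Printing Implicit Defensive.
Local Open Scope classical_set_scope.
Local Open Scope ring_scope.

(** * Finite-dimensional calculus *)

(* A class, so that it is inferred for products and matrices; linear maps out of
   a general normed module need not be continuous. *)
Definition fin_dim (R : realType) (E : normedModType R) : Prop :=
  exists (I : finType) (e : I -> E) (l : I -> E -> R^o),
    (forall i, linear (l i) /\ continuous (l i)) /\
    forall x, x = \sum_i l i x *: e i.
Existing Class fin_dim.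

(** Smoothness of the germ at [x]. It composes without carrying open sets along, and it persists at
    all nearby points ([smooth_near_near]). *)
Definition smooth_near (R : realType) (E F : normedModType R) (f : E -> F)
    (x : E) : Prop :=
  exists2 V : set E, open V /\ V x & smooth_on V f.

Section FinDim.
Context {R : realType}.
Implicit Types E F : normedModType R.

Lemma linear_zero E F (f : E -> F) : linear f -> f 0 = 0.
Proof. by move=> lf; have := lf (-1) 0 0; rewrite !scaleN1r !addNr. Qed.

Lemma linear_add E F (f : E -> F) x y : linear f -> f (x + y) = f x + f y.
Proof. by move=> lf; have := lf 1 x y; rewrite !scale1r. Qed.

Lemma linear_scale E F (f : E -> F) a x : linear f -> f (a *: x) = a *: f x.
Proof. by move=> lf; have := lf a x 0; rewrite (linear_zero lf) addr0 addr0. Qed.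

Lemma linear_opp E F (f : E -> F) x : linear f -> f (- x) = - f x.
Proof. by move=> lf; rewrite -scaleN1r linear_scale // scaleN1r. Qed.

Lemma linear_sumE E F (f : E -> F) (I : Type) (r : seq I) (P : pred I) (g : I -> E) :
  linear f -> f (\sum_(i <- r | P i) g i) = \sum_(i <- r | P i) f (g i).
Proof.
move=> lf; elim/big_rec2: _ => [|i y1 y2 _ <-]; first exact: linear_zero.
exact: linear_add.
Qed.

Lemma continuous_sumE E F (I : Type) (r : seq I) (P : pred I) (g : I -> E -> F) x :
  (forall i, {for x, continuous (g i)}) ->
  {for x, continuous (fun y => \sum_(i <- r | P i) g i y)}.
Proof.
move=> gc; elim: r => [|i r IH].
  rewrite (_ : (fun y => _) = fun=> 0); first exact: cvg_cst.
  by apply/funext => y; rewrite big_nil.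
rewrite (_ : (fun y => _) = if P i then (fun y => g i y + \sum_(j <- r | P j) g j y)
    else (fun y => \sum_(j <- r | P j) g j y)); last first.
  by apply/funext => y; rewrite big_cons; case: ifP.
by case: (P i) => //; apply: cvgD; [exact: gc|exact: IH].
Qed.

Lemma fin_dim_linear_continuous E F {hE : fin_dim E} (f : E -> F) :
  linear f -> continuous f.
Proof.
move=> lf x; case: hE => I [e [l [hl he]]].
have -> : f = fun x => \sum_i l i x *: f (e i).
  apply/funext => y; rewrite {1}(he y) linear_sumE //.
  by apply: eq_bigr => i _; rewrite linear_scale.
by apply: continuous_sumE => i; apply: cvgZr_tmp; exact: (hl i).2.
Qed.

Lemma linear_differentiableP E F {hE : fin_dim E} (f : E -> F) x :
  linear f -> differentiable f x /\ forall v, 'D_v f x = f v.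
Proof.
move=> lf; have fc : continuous f by exact: fin_dim_linear_continuous.
pose fM := GRing.isLinear.Build _ _ _ _ _ lf.
pose fL : {linear E -> F} := HB.pack f fM.
have df : differentiable f x by exact: (@linear_differentiable _ _ _ fL).
by split=> // v; rewrite deriveE // (@diff_lin _ _ _ fL).
Qed.

Lemma differentiable_linear E F {hE : fin_dim E} (f : E -> F) x :
  linear f -> differentiable f x.
Proof. by move=> lf; case: (linear_differentiableP x lf). Qed.

Lemma derive_linear E F {hE : fin_dim E} (f : E -> F) x v :
  linear f -> 'D_v f x = f v.
Proof. by move=> lf; case: (linear_differentiableP x lf). Qed.

Lemma derive_is_linear E F (f : E -> F) x :
  differentiable f x -> linear (fun v => 'D_v f x).
Proof. by move=> df a u v; rewrite !deriveE // linearP. Qed.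

Lemma fin_dim_regular : fin_dim (R^o : normedModType R).
Proof.
exists 'I_1, (fun=> 1), (fun=> id); split=> [i|x]; last by rewrite big_ord1 [RHS]mulr1.
by split=> [a x y|x] //.
Qed.

Lemma fin_dim_prod E F : fin_dim E -> fin_dim F -> fin_dim (E * F)%type.
Proof.
move=> [I [e [l [hl he]]]] [J [f [k [hk hf]]]].
exists (I + J)%type, (fun s => match s with inl i => (e i, 0) | inr j => (0, f j) end),
  (fun s p => match s with inl i => l i p.1 | inr j => k j p.2 end); split.
  case=> [i|j]; split.
  - by move=> a x y /=; rewrite (hl i).1.
  - move=> x; apply: (@continuous_comp _ _ _ fst (l i)); first exact: cvg_fst.
    exact: (hl i).2.
  - by move=> a x y /=; rewrite (hk j).1.
  - move=> x; apply: (@continuous_comp _ _ _ snd (k j)); first exact: cvg_snd.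
    exact: (hk j).2.
move=> [x y]; rewrite big_sumType /=.
rewrite [X in X + _](_ : _ = (x, 0)); last first.
  rewrite [in RHS](he x); elim/big_rec2: _ => // i y1 y2 _ ->.
  by rewrite /GRing.add /= /GRing.scale /= /add_pair /scale_pair /= scaler0 addr0.
rewrite [X in _ + X](_ : _ = (0, y)); last first.
  rewrite [in RHS](hf y); elim/big_rec2: _ => // i y1 y2 _ ->.
  by rewrite /GRing.add /= /GRing.scale /= /add_pair /scale_pair /= scaler0 addr0.
by rewrite /GRing.add /= /add_pair /= addr0 add0r.
Qed.

Lemma fin_dim_matrix m n : fin_dim 'M[R]_(m, n).
Proof.
exists ('I_m * 'I_n)%type, (fun p => delta_mx p.1 p.2),
  (fun p (M : 'M[R]_(m, n)) => M p.1 p.2); split.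
  move=> [i j]; split=> /=; first by move=> a x y; rewrite !mxE.
  by move=> M; exact: coord_continuous.
move=> M; rewrite {1}(matrix_sum_delta M).
by rewrite pair_big.
Qed.

End FinDim.

#[global] Existing Instance fin_dim_regular.
#[global] Existing Instance fin_dim_prod.
#[global] Existing Instance fin_dim_matrix.

(** * Closure properties of the classes C^m *)

Section ClassC.
Context {R : realType}.
Implicit Types E F : normedModType R.

(** Differentiability is a little-o condition at [x] and only sees the germ: [g] has the expansion
    with the differential of [f], and [diff_unique] identifies that differential as the one of
    [g]. *)
Lemma near_eq_differentiable E F (f g : E -> F) x :
  (\near x, f x = g x) -> differentiable f x -> differentiable g x.
Proof.
move=> fg /diff_locallyP [dfc dfx]; have fgx := nbhs_singleton fg.
have dgx : g \o shift x = cst (g x) + 'd f x +o_ 0 id.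
  apply/eqaddoP => e e0; move/eqaddoP: dfx => /(_ e e0) h.
  have fg' : \forall y \near (0 : E), f (y + x) = g (y + x).
    by move: fg; rewrite (near_shift 0) /= subr0.
  near=> y; rewrite /= /GRing.add /= /GRing.opp /= /GRing.add /=.
  rewrite -fgx -(near fg' y) //.
  exact: (near h y).
by apply/diff_locallyP; rewrite (diff_unique dfc dgx).
Unshelve. all: by end_near. Qed.

Lemma class_C_ext E F m (U : set E) (f g : E -> F) : open U ->
  (forall x, U x -> f x = g x) -> class_C m U f -> class_C m U g.
Proof.
move=> oU; elim: m f g => [|m IH] f g fg /=.
  move=> fc x /[dup] xU /fc h; move/set_mem: xU => xU.
  have nfg : \forall y \near x, f y = g y.
    by apply: filterS (open_nbhs_nbhs (conj oU xU)) => y; exact: fg.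
  rewrite /prop_for /continuous_at -(fg _ xU).
  by apply: cvg_trans h; apply: near_eq_cvg; apply: filterS nfg => y ->.
move=> [df Cf]; split=> [x xU|v].
  apply: near_eq_differentiable (df x xU).
  by apply: filterS (open_nbhs_nbhs (conj oU xU)) => y; exact: fg.
apply: (IH ('D_v f)) (Cf v) => x xU; apply: near_eq_derive.
by apply: filterS (open_nbhs_nbhs (conj oU xU)) => y; exact: fg.
Qed.

Lemma class_C_sub E F m (U V : set E) (f : E -> F) : V `<=` U ->
  class_C m U f -> class_C m V f.
Proof.
move=> VU; elim: m f => [|m IH] f /=.
  by move=> fc x /set_mem /VU /mem_set; exact: fc.
by move=> [df Cf]; split=> [x /VU|v]; [exact: df|exact: IH].
Qed.

Lemma class_C_le E F m (U : set E) (f : E -> F) :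
  class_C m.+1 U f -> class_C m U f.
Proof.
elim: m f => [|m IH] f /=.
  by move=> [df _] x /set_mem /df; exact: differentiable_continuous.
by move=> [df Cf]; split=> // v; apply: IH; exact: Cf.
Qed.

Lemma class_C_cst E F m (U : set E) (a : F) : class_C m U (fun=> a).
Proof.
elim: m a => [|m IH] a /=; first by move=> x _; exact: cvg_cst.
split=> [x _|v]; first exact: differentiable_cst.
rewrite (_ : 'D_v (fun=> a) = fun=> 0) //.
by apply/funext => x; exact: derive_cst.
Qed.

Lemma class_C_linear E F m (U : set E) (f : E -> F) {hE : fin_dim E} :
  linear f -> class_C m U f.
Proof.
move=> lf; case: m => [|m] /=.
  by move=> x _; exact: fin_dim_linear_continuous.
split=> [x _|v]; first exact: differentiable_linear.
rewrite (_ : 'D_v f = fun=> f v); first exact: class_C_cst.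
by apply/funext => x; rewrite derive_linear.
Qed.

Lemma class_C_add E F m (U : set E) (f g : E -> F) : open U ->
  class_C m U f -> class_C m U g -> class_C m U (fun x => f x + g x).
Proof.
move=> oU; elim: m f g => [|m IH] f g /=.
  by move=> fc gc x xU; apply: cvgD; [exact: fc|exact: gc].
move=> [df Cf] [dg Cg]; split=> [x xU|v].
  by apply: differentiableD; [exact: df|exact: dg].
apply: (class_C_ext oU _ (IH _ _ (Cf v) (Cg v))) => x xU.
by rewrite -deriveD //; apply: diff_derivable; [exact: df|exact: dg].
Qed.

Lemma class_C_sum E F m (U : set E) (I : Type) (r : seq I) (P : pred I) (f : I -> E -> F) :
  open U -> (forall i, class_C m U (f i)) ->
  class_C m U (fun x => \sum_(i <- r | P i) f i x).
Proof.
move=> oU Cf; elim: r => [|i r IH].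
  rewrite (_ : (fun x => _) = fun=> 0); first exact: class_C_cst.
  by apply/funext => x; rewrite big_nil.
rewrite (_ : (fun x => _) = fun x => (if P i then f i x else 0) + \sum_(i <- r | P i) f i x).
  apply: class_C_add => //; case: (P i) => //; exact: class_C_cst.
by apply/funext => x; rewrite big_cons; case: ifP => //; rewrite add0r.
Qed.

Lemma derive_scale E F (a : E -> R^o) (f : E -> F) x v :
  differentiable a x -> differentiable f x ->
  differentiable (fun y => a y *: f y) x /\
  'D_v (fun y => a y *: f y) x = 'D_v a x *: f x + a x *: 'D_v f x.
Proof.
move=> da df.
have bl : bilinear_for *:%R *:%R ( *:%R : R^o -> F -> F).
  by split=> [u|u] c p q; [rewrite /= scalerDl; congr (_ + _);
      exact/esym/scalerA|rewrite /= scalerDr !scalerA mulrC].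
pose bM := bilinear_isBilinear.Build R R^o F F *:%R *:%R ( *:%R) bl.
pose b : {bilinear R^o -> F -> F} := HB.pack ( *:%R : R^o -> F -> F) bM.
have bc : continuous (fun p : R^o * F => b p.1 p.2).
  by move=> p; exact: scale_continuous.
have dp : differentiable (fun y => (a y, f y)) x by exact: differentiable_pair.
have db : differentiable (fun p : R^o * F => b p.1 p.2) (a x, f x).
  exact: differentiable_bilin.
have H : differentiable (fun y => a y *: f y) x.
  exact: (differentiable_comp dp db).
split=> //.
rewrite deriveE // (_ : (fun y => a y *: f y) = (fun p : R^o * F => b p.1 p.2) \o (fun y =>
    (a y, f y))) //.
rewrite diff_comp //=.
have -> := diff_bilin (f := b) (a x, f x) bc.
by rewrite /= diff_pair // !deriveE //= addrC.
Qed.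

Lemma class_C_scale E F m (U : set E) (a : E -> R^o) (f : E -> F) : open U ->
  class_C m U a -> class_C m U f -> class_C m U (fun x => a x *: f x).
Proof.
move=> oU; elim: m a f => [|m IH] a f.
  by move=> ac fc x xU; apply: cvgZ; [exact: ac|exact: fc].
move=> Ca Cf; have [da Da] := Ca; have [df Df] := Cf; split=> [x xU|v].
  by have [] := derive_scale 0 (da x xU) (df x xU).
apply: (class_C_ext oU) (class_C_add oU (IH _ _ (Da v) (class_C_le Cf))
    (IH _ _ (class_C_le Ca) (Df v))) => x xU.
by have [_ ->] := derive_scale v (da x xU) (df x xU).
Qed.

Lemma derive_comp (E1 E F : normedModType R) (g : E1 -> E) (f : E -> F) x v :
  differentiable g x -> differentiable f (g x) ->
  'D_v (f \o g) x = 'D_('D_v g x) f (g x).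
Proof.
move=> dg df; rewrite !deriveE //; last exact: differentiable_comp.
by rewrite diff_comp.
Qed.

Lemma derive_linear_comp E F (G : normedModType R) {hF : fin_dim F} (l : F -> G)
    (f : E -> F) x v : linear l -> differentiable f x ->
  'D_v (fun y => l (f y)) x = l ('D_v f x).
Proof.
move=> ll df; rewrite -[RHS](derive_linear (f x)) // -derive_comp //.
exact: differentiable_linear.
Qed.

Lemma class_C_linear_comp E F (G : normedModType R) {hF : fin_dim F} (l : F -> G) m
    (U : set E) (f : E -> F) : linear l -> open U ->
  class_C m U f -> class_C m U (fun x => l (f x)).
Proof.
move=> ll oU; elim: m f => [|m IH] f.
  move=> fc x xU; apply: (@continuous_comp _ _ _ f l); first exact: fc.
  exact: fin_dim_linear_continuous.
move=> [df Cf]; split=> [x xU|v].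
  apply: (@differentiable_comp _ _ _ _ f l); first exact: df.
  exact: differentiable_linear.
apply: (class_C_ext oU _ (IH _ (Cf v))) => x xU.
by rewrite derive_linear_comp //; exact: df.
Qed.

(** The derivative of [f \o g] differentiates [f] in the direction ['D_v g x], which moves with [x],
    so the induction hypothesis does not apply directly. Expanding this direction in coordinates
    leaves scalar functions times derivatives of [f] in the fixed directions [e i], composed with
    [g]. *)
Lemma class_C_comp (E1 E F : normedModType R) {hE : fin_dim E} m (U : set E1) (V : set E)
    (g : E1 -> E) (f : E -> F) : open U -> (forall x, U x -> V (g x)) ->
  class_C m U g -> class_C m V f -> class_C m U (f \o g).
Proof.
move=> oU gUV; elim: m f g gUV => [|m IH] f g gUV.
  move=> gc fc x xU; apply: continuous_comp; first exact: gc.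
  by apply: fc; apply/mem_set/gUV/set_mem.
move=> Cg Cf; have [dg Dg] := Cg; have [df Df] := Cf; split=> [x xU|v].
  by apply: differentiable_comp; [exact: dg|exact/df/gUV].
case: (hE) => I [e [l [hl he]]].
have H : class_C m U (fun x => \sum_i l i ('D_v g x) *: 'D_(e i) f (g x)).
  apply: class_C_sum => // i; apply: class_C_scale => //.
    by apply: class_C_linear_comp => //; [exact: (hl i).1|exact: Dg].
  apply: (IH ('D_(e i) f) g gUV) (Df (e i)); exact: class_C_le.
apply: (class_C_ext oU _ H) => x xU; rewrite derive_comp; [|exact: dg|exact/df/gUV].
rewrite [in RHS](he ('D_v g x)) (linear_sumE _ _ _ (derive_is_linear _)); last exact/df/gUV.
by apply: eq_bigr => i _; rewrite (linear_scale _ _ (derive_is_linear _)) //; exact/df/gUV.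
Qed.

Lemma derive_pair (E F G : normedModType R) (f : E -> F) (g : E -> G) x v :
  differentiable f x -> differentiable g x ->
  'D_v (fun y => (f y, g y)) x = ('D_v f x, 'D_v g x).
Proof.
move=> df dg; rewrite !deriveE // ?diff_pair //; exact: differentiable_pair.
Qed.

Lemma class_C_pair (E F G : normedModType R) m (U : set E) (f : E -> F) (g : E -> G) :
  open U -> class_C m U f -> class_C m U g -> class_C m U (fun x => (f x, g x)).
Proof.
move=> oU; elim: m f g => [|m IH] f g.
  by move=> fc gc x xU; apply: cvg_pair; [exact: fc|exact: gc].
move=> [df Cf] [dg Cg]; split=> [x xU|v].
  by apply: differentiable_pair; [exact: df|exact: dg].
apply: (class_C_ext oU _ (IH _ _ (Cf v) (Cg v))) => x xU.
by rewrite derive_pair //; [exact: df|exact: dg].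
Qed.

End ClassC.

(** * Germs of smooth maps at a point *)

Lemma near_continuous (T U : topologicalType) (g : T -> U) (x : T) (P : U -> Prop) :
  {for x, continuous g} -> (\forall z \near g x, P z) -> \forall y \near x, P (g y).
Proof. by move=> gc; exact: gc. Qed.

Section SmoothNear.
Context {R : realType}.
Implicit Types E F G : normedModType R.

Lemma smooth_near_near E F (f : E -> F) x :
  smooth_near f x -> \forall y \near x, smooth_near f y.
Proof.
move=> [V [oV Vx] Vf]; apply: filterS (open_nbhs_nbhs (conj oV Vx)) => y Vy.
by exists V.
Qed.

Lemma smooth_near_ext E F (f g : E -> F) x :
  (\forall y \near x, f y = g y) -> smooth_near f x -> smooth_near g x.
Proof.
move=> fg [V [oV Vx] Vf]; exists (V `&` [set y | f y = g y]^°).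
  by split; [apply: openI => //; exact: open_interior|split => //].
move=> m; apply: (@class_C_ext _ _ _ _ _ f); first by apply: openI => //; exact: open_interior.
  by move=> y [_ /interior_subset].
by apply: class_C_sub (Vf m) => y [].
Qed.

Lemma smooth_near_differentiable E F (f : E -> F) x :
  smooth_near f x -> differentiable f x.
Proof. by move=> [V [oV Vx] /(_ 1) [df _]]; exact: df. Qed.

Lemma smooth_near_continuous E F (f : E -> F) x :
  smooth_near f x -> {for x, continuous f}.
Proof. by move=> /smooth_near_differentiable/differentiable_continuous. Qed.

Lemma smooth_near_cst E F (a : F) x : smooth_near (fun _ : E => a) x.
Proof. by exists setT; [split=> //; exact: openT|move=> m; exact: class_C_cst]. Qed.

Lemma smooth_near_linear E F {hE : fin_dim E} (f : E -> F) x :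
  linear f -> smooth_near f x.
Proof. by move=> lf; exists setT; [split=> //; exact: openT|move=> m;
    exact: class_C_linear]. Qed.

Lemma smooth_near_id E {hE : fin_dim E} x : smooth_near (fun y : E => y) x.
Proof. by apply: smooth_near_linear. Qed.

Lemma smooth_near2 E F G (f : E -> F) (g : E -> G) x :
  smooth_near f x -> smooth_near g x ->
  exists2 V : set E, open V /\ V x & smooth_on V f /\ smooth_on V g.
Proof.
move=> [V [oV Vx] Vf] [W [oW Wx] Wg]; exists (V `&` W); first by split=> //; exact: openI.
by split=> m; [apply: class_C_sub (Vf m)|apply: class_C_sub (Wg m)] => y [].
Qed.

Lemma smooth_near_add E F (f g : E -> F) x :
  smooth_near f x -> smooth_near g x -> smooth_near (fun y => f y + g y) x.
Proof.
move=> sf sg; have [V [oV Vx] [Vf Vg]] := smooth_near2 sf sg.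
by exists V => // m; exact: class_C_add.
Qed.

Lemma smooth_near_scale E F (a : E -> R^o) (f : E -> F) x :
  smooth_near a x -> smooth_near f x -> smooth_near (fun y => a y *: f y) x.
Proof.
move=> sf sg; have [V [oV Vx] [Vf Vg]] := smooth_near2 sf sg.
by exists V => // m; exact: class_C_scale.
Qed.

Lemma smooth_near_pair E F G (f : E -> F) (g : E -> G) x :
  smooth_near f x -> smooth_near g x -> smooth_near (fun y => (f y, g y)) x.
Proof.
move=> sf sg; have [V [oV Vx] [Vf Vg]] := smooth_near2 sf sg.
by exists V => // m; exact: class_C_pair.
Qed.

Lemma smooth_near_sum E F (I : Type) (r : seq I) (P : pred I) (f : I -> E -> F) x :
  (forall i, P i -> smooth_near (f i) x) ->
  smooth_near (fun y => \sum_(i <- r | P i) f i y) x.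
Proof.
move=> sf; elim: r => [|i r IH].
  by apply: smooth_near_ext (smooth_near_cst 0 x); apply: nearW => y; rewrite big_nil.
have [Pi|/negbTE Pi] := boolP (P i).
  by apply: smooth_near_ext (smooth_near_add (sf _ Pi) IH); apply: nearW => y;
      rewrite big_cons Pi.
by apply: smooth_near_ext IH; apply: nearW => y; rewrite big_cons Pi.
Qed.

Lemma smooth_near_comp E F G {hF : fin_dim F} (g : E -> F) (f : F -> G) x :
  smooth_near g x -> smooth_near f (g x) -> smooth_near (fun y => f (g y)) x.
Proof.
move=> sg [V [oV Vx] Vf]; have gc := smooth_near_continuous sg.
case: sg => U [oU Ux] Ug; exists (U `&` g @^-1` V)^°.
  split; first exact: open_interior.
  apply: filterI; first exact: open_nbhs_nbhs.
  by apply: gc; exact: open_nbhs_nbhs.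
move=> m; apply: (@class_C_comp _ _ _ _ _ _ _ V) => //; first exact: open_interior.
  by move=> y /interior_subset [].
by apply: class_C_sub (Ug m) => y /interior_subset [].
Qed.

Lemma smooth_near_lin E F G {hF : fin_dim F} (g : E -> F) (f : F -> G) x :
  linear f -> smooth_near g x -> smooth_near (fun y => f (g y)) x.
Proof. by move=> lf sg; apply: smooth_near_comp => //; exact: smooth_near_linear. Qed.

Lemma smooth_near_opp E F {hF : fin_dim F} (f : E -> F) x :
  smooth_near f x -> smooth_near (fun y => - f y) x.
Proof. by apply: (@smooth_near_lin _ _ _ _ _ (fun y => - y)) => a u v;
    rewrite opprD scalerN. Qed.

Lemma linear_fst E F : linear (fst : E * F -> E).
Proof. by []. Qed.

Lemma linear_snd E F : linear (snd : E * F -> F).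
Proof. by []. Qed.

Lemma smooth_near_fst E F G {hF : fin_dim F} {hG : fin_dim G} (f : E -> F * G) x :
  smooth_near f x -> smooth_near (fun y => (f y).1) x.
Proof. by apply: smooth_near_lin; exact: linear_fst. Qed.

Lemma smooth_near_snd E F G {hF : fin_dim F} {hG : fin_dim G} (f : E -> F * G) x :
  smooth_near f x -> smooth_near (fun y => (f y).2) x.
Proof. by apply: smooth_near_lin; exact: linear_snd. Qed.

Lemma smooth_near_derive E F (f : E -> F) x v :
  smooth_near f x -> smooth_near ('D_v f) x.
Proof. by move=> [V oV Vf]; exists V => // m; exact: (Vf m.+1).2. Qed.

Definition bilinear_map E F G (b : E -> F -> G) :=
  (forall y, linear (b ^~ y)) /\ (forall x, linear (b x)).

(** Coordinates in the first argument turn [b] into a finite sum of scalar functions times linear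
    maps of the second argument. *)
Lemma smooth_near_bilinear E1 E F G {hE : fin_dim E} {hF : fin_dim F} (b : E -> F -> G)
    (f : E1 -> E) (g : E1 -> F) x : bilinear_map b ->
  smooth_near f x -> smooth_near g x -> smooth_near (fun y => b (f y) (g y)) x.
Proof.
move=> [b1 b2] sf sg; case: (hE) => I [e [l [hl he]]].
apply: (@smooth_near_ext _ _ (fun y => \sum_i l i (f y) *: b (e i) (g y))).
  apply: nearW => y; rewrite [in RHS](he (f y)) (linear_sumE _ _ _ (b1 _)).
  by apply: eq_bigr => i _; rewrite (linear_scale _ _ (b1 _)).
apply: smooth_near_sum => i _; apply: smooth_near_scale.
  exact: smooth_near_lin (hl i).1 sf.
exact: smooth_near_lin (b2 _) sg.
Qed.

Lemma derive_sumE E F (I : Type) (r : seq I) (f : I -> E -> F) x v :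
  (forall i, differentiable (f i) x) ->
  differentiable (fun y => \sum_(i <- r) f i y) x /\
  'D_v (fun y => \sum_(i <- r) f i y) x = \sum_(i <- r) 'D_v (f i) x.
Proof.
move=> df; elim: r => [|i r [IH1 IH2]].
  rewrite (_ : (fun y => _) = fun=> 0); last by apply/funext => y; rewrite big_nil.
  by rewrite big_nil; split; [exact: differentiable_cst|exact: derive_cst].
rewrite (_ : (fun y => _) = f i + (fun y => \sum_(j <- r) f j y)); last first.
  by apply/funext => y; rewrite big_cons.
rewrite big_cons; split; first exact: differentiableD.
by rewrite deriveD ?IH2 //; exact: diff_derivable.
Qed.

Lemma derive_bilinear E1 E F G {hE : fin_dim E} {hF : fin_dim F} (b : E -> F -> G)
    (f : E1 -> E) (g : E1 -> F) x v : bilinear_map b ->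
  differentiable f x -> differentiable g x ->
  'D_v (fun y => b (f y) (g y)) x = b ('D_v f x) (g x) + b (f x) ('D_v g x).
Proof.
move=> [b1 b2] sf sg; case: (hE) => I [e [l [hl he]]].
rewrite (_ : (fun y => _) = fun y => \sum_i l i (f y) *: b (e i) (g y)); last first.
  apply/funext => y; rewrite [in LHS](he (f y)) (linear_sumE _ _ _ (b1 _)).
  by apply: eq_bigr => i _; rewrite (linear_scale _ _ (b1 _)).
have dl i : differentiable (fun y => l i (f y)) x.
  by apply: (@differentiable_comp _ _ _ _ f (l i)) => //;
      apply: differentiable_linear (hl i).1.
have db i : differentiable (fun y => b (e i) (g y)) x.
  by apply: (@differentiable_comp _ _ _ _ g (b (e i))) => //; exact: differentiable_linear.
have dd i := derive_scale v (dl i) (db i).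
have [_ ->] := derive_sumE (index_enum I) v (fun i => (dd i).1).
rewrite [in X in b X (g x)](he ('D_v f x)) [in b (f x) _](he (f x)).
rewrite !(linear_sumE _ _ _ (b1 _)) -big_split; apply: eq_bigr => i _ /=.
rewrite (dd i).2 !(linear_scale _ _ (b1 _)) (derive_linear_comp _ (hl i).1) //.
by rewrite (derive_linear_comp _ (b2 _)).
Qed.

(** By linearity in the direction this is a sum of coordinates of [v y] times derivatives in fixed
    directions. Linearity requires [f] to be differentiable at [p y], whence the restriction to [y]
    near [x]. Smoothness of Ad and of the conversions between velocities and logarithmic derivatives
    rests on this. *)
Lemma smooth_near_dir E1 E F {hE : fin_dim E} (f : E -> F) (p v : E1 -> E) x :
  smooth_near f (p x) -> smooth_near p x -> smooth_near v x ->
  smooth_near (fun y => 'D_(v y) f (p y)) x.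
Proof.
move=> sf sp sv; case: (hE) => I [e [l [hl he]]].
apply: (@smooth_near_ext _ _ (fun y => \sum_i l i (v y) *: 'D_(e i) f (p y))).
  have : \forall y \near x, smooth_near f (p y).
    by apply: (smooth_near_continuous sp); exact: smooth_near_near.
  apply: filterS => y /smooth_near_differentiable df.
  rewrite [in RHS](he (v y)) (linear_sumE _ _ _ (derive_is_linear df)).
  by apply: eq_bigr => i _; rewrite (linear_scale _ _ (derive_is_linear df)).
apply: smooth_near_sum => i _; apply: smooth_near_scale.
  exact: smooth_near_lin (hl i).1 sv.
exact: smooth_near_comp sp (smooth_near_derive _ sf).
Qed.

Lemma derive_slice2 E F G (f : E * F -> G) a b v :
  'D_v (fun z => f (a, z)) b = 'D_(0, v) f (a, b).
Proof.
rewrite /derive; congr (lim (_ @ 0^')); apply/funext => h /=.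
by congr (_ *: (f _ - _)); rewrite [RHS]surjective_pairing /= scaler0 add0r.
Qed.

Lemma derive_slice1 E F G (f : E * F -> G) a b v :
  'D_v (fun z => f (z, b)) a = 'D_(v, 0) f (a, b).
Proof.
rewrite /derive; congr (lim (_ @ 0^')); apply/funext => h /=.
by congr (_ *: (f _ - _)); rewrite [RHS]surjective_pairing /= scaler0 add0r.
Qed.

Lemma smooth_near_matrix E m n (f : 'I_m -> 'I_n -> E -> R^o) x :
  (forall i j, smooth_near (f i j) x) ->
  smooth_near (fun y => \matrix_(i, j) f i j y) x.
Proof.
move=> sf.
apply: (@smooth_near_ext _ _ (fun y => \sum_i \sum_j f i j y *: delta_mx i j)).
  apply: nearW => y; rewrite [RHS]matrix_sum_delta.
  by apply: eq_bigr => i _; apply: eq_bigr => j _; rewrite mxE.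
by apply: smooth_near_sum => i _; apply: smooth_near_sum => j _;
    apply: smooth_near_scale => //; exact: smooth_near_cst.
Qed.

Lemma smooth_near_rows E m n (f : 'I_m -> E -> 'rV[R]_n) x :
  (forall i, smooth_near (f i) x) ->
  smooth_near (fun y => \matrix_(i < m) f i y) x.
Proof.
move=> sf; apply: smooth_near_matrix => i j.
apply: (@smooth_near_lin _ _ _ _ (f i) (fun v : 'rV[R]_n => v 0 j : R^o)) (sf i).
by move=> a u v; rewrite !mxE.
Qed.

End SmoothNear.

(** * Symmetry of second derivatives *)

Section Schwarz.
Context {R : realType}.
Implicit Types E F : normedModType R.

Lemma is_derive_line E F (f : E -> F) (x v : E) (s : R) :
  differentiable f (x + s *: v) ->
  is_derive s 1 (fun t : R => f (x + t *: v)) ('D_v f (x + s *: v)).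
Proof.
move=> df.
have dl : differentiable (fun t : R^o => x + t *: v) s by exact: differentiableD.
split.
  apply: diff_derivable; exact: (@differentiable_comp _ _ _ _ (fun t : R^o => x + t *: v) f).
rewrite (@derive_comp _ _ _ _ (fun t : R^o => x + t *: v) f) //; congr ('D_ _ f _).
rewrite deriveD; [|exact: derivable_cst|exact: diff_derivable].
by rewrite derive_cst add0r deriveE // diff_val scale1r.
Qed.

Lemma MVT_ge0 (g dg : R -> R) (h : R) : 0 < h ->
  (forall s : R, 0 <= s <= h -> is_derive s 1 g (dg s)) ->
  exists2 s, 0 <= s <= h & g h - g 0 = dg s * h.
Proof.
move=> h0 dgP.
have [s hs Es] : exists2 s, s \in `]0, h[%R & g h - g 0 = dg s * (h - 0).
  apply: MVT => //.
    by move=> s; rewrite in_itv /= => /andP[s0 sh]; apply: dgP; rewrite !ltW.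
  apply: derivable_within_continuous => s; rewrite in_itv /= => hs.
  by case: (dgP s hs).
exists s; last by rewrite Es subr0.
by move: hs; rewrite in_itv /= => /andP[? ?]; rewrite !ltW.
Qed.

Definition second_difference E (f : E -> R) (x u v : E) (h : R) : R :=
  f (x + h *: u + h *: v) - f (x + h *: u) - (f (x + h *: v) - f x).

Lemma second_differenceC E (f : E -> R) (x u v : E) (h : R) :
  second_difference f x u v h = second_difference f x v u h.
Proof.
have swap (a b c d : R) : a - b - (c - d) = a - c - (b - d).
  by rewrite !opprB -!addrA; congr (_ + _); rewrite addrCA (addrC (- b)) addrCA.
rewrite /second_difference swap.
by have -> : f (x + h *: u + h *: v) = f (x + h *: v + h *: u) by congr f; exact: addrAC.
Qed.

(** The mean value theorem is applied twice: to [s |-> f (x + h v + s u) - f (x + s u)], whose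
    increment is the second difference, and then to the derivative ['D_u f] along [v]. *)
Lemma second_difference_MVT E (f : E -> R^o) (x u v : E) (h : R) : 0 < h ->
  (forall s t, 0 <= s <= h -> 0 <= t <= h -> smooth_near f (x + s *: u + t *: v)) ->
  exists s t : R, [/\ 0 <= s <= h, 0 <= t <= h &
    second_difference f x u v h =
    ('D_v ('D_u f) (x + s *: u + t *: v) : R) * h * h].
Proof.
move=> h0 sf.
have hh : 0 <= h <= h by rewrite ltW //=.
have oo : (0 : R) <= 0 <= h by rewrite lexx ltW.
pose g (s : R) : R := f (x + h *: v + s *: u) - f (x + s *: u).
pose dg (s : R) : R := 'D_u f (x + h *: v + s *: u) - 'D_u f (x + s *: u).
have dgP s : 0 <= s <= h -> is_derive s 1 g (dg s).
  move=> hs; have := sf _ _ hs hh; have := sf _ _ hs oo.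
  rewrite scale0r addr0 (addrAC x)
      => /smooth_near_differentiable d1 /smooth_near_differentiable d2.
  by apply: is_deriveB; exact: is_derive_line.
have [s hs Es] := MVT_ge0 h0 dgP.
pose k (t : R) : R := 'D_u f (x + s *: u + t *: v).
pose dk (t : R) : R := 'D_v ('D_u f) (x + s *: u + t *: v).
have dkP t : 0 <= t <= h -> is_derive t 1 k (dk t).
  move=> ht; apply: is_derive_line; apply: smooth_near_differentiable.
  by apply: smooth_near_derive; exact: sf.
have [t ht Et] := MVT_ge0 h0 dkP.
exists s, t; split=> //; rewrite -/(dk t) -Et /k scale0r addr0 (addrAC x (s *: u)).
by rewrite -/(dg s) -Es /g !scale0r !addr0 /second_difference (addrAC x (h *: v)).
Qed.

(** The second difference is symmetric in [u] and [v]. Hence one mixed derivative at some point of a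
    small parallelogram equals the other one at another point, and continuity of both at [x] bounds
    their difference at [x] by every positive [e]. *)
Lemma schwarz_scalar E (f : E -> R^o) (x u v : E) :
  smooth_near f x -> 'D_u ('D_v f) x = 'D_v ('D_u f) x.
Proof.
have dist_le (a b c e : R) : `|a - c| < e / 2 -> `|b - c| < e / 2 -> `|a - b| <= e.
  move=> ac bc; rewrite (splitr e) -(subrKA c) ltW //.
  by apply: le_lt_trans (ler_normD _ _) _; rewrite ltrD // distrC.
move=> sf; apply/eqP; rewrite -subr_eq0 -normr_le0; apply/ler_addgt0Pl => e e0; rewrite addr0.
have sl : {for ((0 : R^o), (0 : R^o)), continuous (fun p : R^o * R^o =>
    x + p.1 *: u + p.2 *: v)}.
  apply: cvgD; first apply: cvgD; first exact: cvg_cst.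
    by apply: cvgZr_tmp; exact: cvg_fst.
  by apply: cvgZr_tmp; exact: cvg_snd.
have x0 : x + (0 : R) *: u + (0 : R) *: v = x by rewrite !scale0r !addr0.
have H : \forall y \near x, smooth_near f y /\
   (`|'D_u ('D_v f) x - 'D_u ('D_v f) y| < e / 2 /\
    `|'D_v ('D_u f) x - 'D_v ('D_u f) y| < e / 2).
  have c1 := smooth_near_continuous (smooth_near_derive u (smooth_near_derive v sf)).
  have c2 := smooth_near_continuous (smooth_near_derive v (smooth_near_derive u sf)).
  apply: filterI; first exact: smooth_near_near.
  have e2 : 0 < e / 2 by rewrite divr_gt0.
  by apply: filterI; [move/cvgrPdist_lt : c1; apply|move/cvgrPdist_lt : c2; apply].
have {}H : \forall p \near ((0 : R^o), (0 : R^o)), smooth_near f (x + p.1 *: u + p.2 *: v) /\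
   (`|'D_u ('D_v f) x - 'D_u ('D_v f) (x + p.1 *: u + p.2 *: v)| < e / 2 /\
    `|'D_v ('D_u f) x - 'D_v ('D_u f) (x + p.1 *: u + p.2 *: v)| < e / 2).
  exact: (sl _ (eq_ind_r (fun z => nbhs z _) H x0)).
move/nbhs_ballP: H => [r /= r0 Hr].
(* Half the radius keeps the closed square of parameters inside the open ball where the estimates
   hold. *)
pose h := r / 2.
have h0 : 0 < h by rewrite divr_gt0.
have hb s t : 0 <= s <= h -> 0 <= t <= h -> ball ((0 : R^o), (0 : R^o)) r (s, t).
  have hr : h < r by rewrite ltr_pdivrMr // ltr_pMr // ltr1n.
  by move=> /andP[s0 sh] /andP[t0 th]; split; rewrite /ball /= sub0r normrN ger0_norm //;
      exact: le_lt_trans hr.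
have [s [t [hs ht E1]]] := @second_difference_MVT E f x u v h h0 (fun s t hs ht =>
    (Hr _ (hb s t hs ht)).1).
have [t' [s' [ht' hs' E2]]] := @second_difference_MVT E f x v u h h0
  (fun s t hs ht => ltac:(rewrite (addrAC x); exact: (Hr _ (hb t s ht hs)).1)).
have hn : h != 0 by rewrite gt_eqF.
have E3 : 'D_v ('D_u f) (x + s *: u + t *: v) = 'D_u ('D_v f) (x + s' *: u + t' *: v).
  apply: (mulIf hn); apply: (mulIf hn).
  rewrite (addrAC x (s' *: u)).
  exact: etrans (esym E1) (etrans (second_differenceC _ _ _ _ _) E2).
have [_ [_ B1]] := Hr _ (hb s t hs ht).
have [_ [B2 _]] := Hr _ (hb s' t' hs' ht').
rewrite /= -E3 in B2; rewrite /= in B1.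
exact: dist_le B2 B1.
Qed.

Lemma schwarz E F {hF : fin_dim F} (f : E -> F) (x u v : E) :
  smooth_near f x -> 'D_u ('D_v f) x = 'D_v ('D_u f) x.
Proof.
move=> sf; case: (hF) => I [e [l [hl he]]].
have ext y z : (forall i, l i y = l i z) -> y = z.
  by move=> yz; rewrite (he y) (he z); apply: eq_bigr => i _; rewrite yz.
apply: ext => i.
have H w1 w2 : l i ('D_w1 ('D_w2 f) x) = 'D_w1 ('D_w2 (fun y => l i (f y))) x.
  rewrite -(derive_linear_comp w1 (hl i).1); last first.
    exact/smooth_near_differentiable/smooth_near_derive.
  apply: near_eq_derive; have := smooth_near_near sf.
  apply: filterS => y /smooth_near_differentiable df.
  by rewrite (derive_linear_comp _ (hl i).1).
by rewrite !H schwarz_scalar //; exact: smooth_near_lin (hl i).1 sf.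
Qed.

End Schwarz.

(** * Smooth curves *)

Section Curves.
Context {R : realType}.
Implicit Types E F G : normedModType R.

Lemma derive1_derive E (p : R^o -> E) : derive1 p = 'D_1 p.
Proof. by apply/funext => t; rewrite derive1E. Qed.

Lemma smooth_near_derive1 E (p : R^o -> E) t :
  smooth_near p t -> smooth_near (derive1 p : R^o -> E) t.
Proof. by rewrite derive1_derive; exact: smooth_near_derive. Qed.

Lemma derive1_near_eq E (p q : R^o -> E) t :
  (\forall s \near t, p s = q s) -> derive1 p t = derive1 q t.
Proof. by rewrite !derive1_derive; exact: near_eq_derive. Qed.

Lemma near_derive1 E (p q : R^o -> E) (t : R^o) :
  (\forall s \near t, p s = q s) -> \forall s \near t, derive1 p s = derive1 q s.
Proof.
move=> /nbhs_interior; apply: filterS => s pq.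
by apply: derive1_near_eq.
Qed.

Lemma derive1n_near_eq E i (p q : R^o -> E) (t : R^o) :
  (\forall s \near t, p s = q s) -> derive1n i p t = derive1n i q t.
Proof.
elim: i p q => [|i IH] p q pq; first exact: nbhs_singleton pq.
by rewrite !derive1Sn; apply: IH; exact: near_derive1.
Qed.

Lemma derive1_comp_dir E F (f : E -> F) (p : R^o -> E) t :
  differentiable p t -> differentiable f (p t) ->
  derive1 (fun s => f (p s)) t = 'D_(derive1 p t) f (p t).
Proof. by move=> dp df; rewrite !derive1_derive -derive_comp. Qed.

Lemma derive1_line E F (f : E -> F) (x v : E) :
  differentiable f x -> derive1 (fun s : R^o => f (x + s *: v)) 0 = 'D_v f x.
Proof.
move=> df; rewrite derive1_derive.
have := @is_derive_line R _ _ f x v 0; rewrite scale0r addr0.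
by move=> /(_ df) [].
Qed.

Lemma derive1_bilinear E F G {hE : fin_dim E} {hF : fin_dim F} (b : E -> F -> G)
    (p : R^o -> E) (q : R^o -> F) t : bilinear_map b ->
  differentiable p t -> differentiable q t ->
  derive1 (fun s => b (p s) (q s)) t = b (derive1 p t) (q t) + b (p t) (derive1 q t).
Proof. by move=> bb dp dq; rewrite !derive1_derive derive_bilinear. Qed.

Lemma derive1_add E (p q : R^o -> E) t :
  differentiable p t -> differentiable q t ->
  derive1 (fun s => p s + q s) t = derive1 p t + derive1 q t.
Proof. by move=> dp dq; rewrite !derive1_derive -deriveD //; exact: diff_derivable. Qed.

Lemma derive1_lin E F {hE : fin_dim E} (l : E -> F) (p : R^o -> E) t :
  linear l -> differentiable p t ->
  derive1 (fun s => l (p s)) t = l (derive1 p t).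
Proof. by move=> ll dp; rewrite !derive1_derive; exact: derive_linear_comp. Qed.

Lemma derive1_pair E F (p : R^o -> E) (q : R^o -> F) t :
  differentiable p t -> differentiable q t ->
  derive1 (fun s => (p s, q s)) t = (derive1 p t, derive1 q t).
Proof. by move=> dp dq; rewrite !derive1_derive derive_pair. Qed.

Lemma derive1n_add E i (p q : R^o -> E) t : smooth_near p t -> smooth_near q t ->
  derive1n i (fun s => p s + q s) t = derive1n i p t + derive1n i q t.
Proof.
elim: i p q => [//|i IH] p q sp sq.
rewrite !derive1Sn -IH; [|exact: smooth_near_derive1..].
apply: derive1n_near_eq; move: (smooth_near_near sp) (smooth_near_near sq).
apply: filterS2 => s /smooth_near_differentiable ? /smooth_near_differentiable ?.
exact: derive1_add.
Qed.

Lemma derive1n_lin E F {hE : fin_dim E} i (l : E -> F) (p : R^o -> E) t :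
  linear l -> smooth_near p t ->
  derive1n i (fun s => l (p s)) t = l (derive1n i p t).
Proof.
move=> ll; elim: i p => [//|i IH] p sp.
rewrite !derive1Sn -IH; last exact: smooth_near_derive1.
apply: derive1n_near_eq; move: (smooth_near_near sp).
by apply: filterS => s /smooth_near_differentiable ?; exact: derive1_lin.
Qed.

Lemma derive1n_pair E F i (p : R^o -> E) (q : R^o -> F) t :
  smooth_near p t -> smooth_near q t ->
  derive1n i (fun s => (p s, q s)) t = (derive1n i p t, derive1n i q t).
Proof.
elim: i p q => [//|i IH] p q sp sq.
rewrite !derive1Sn -IH; [|exact: smooth_near_derive1..].
apply: derive1n_near_eq; move: (smooth_near_near sp) (smooth_near_near sq).
apply: filterS2 => s /smooth_near_differentiable ? /smooth_near_differentiable ?.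
exact: derive1_pair.
Qed.

Lemma derive1n_cst E i (a : E) (t : R^o) : derive1n i.+1 (fun _ : R^o => a) t = 0.
Proof.
elim: i a => [|i IH] a; first by rewrite derive1n1 derive1_derive derive_cst.
rewrite derive1Sn (_ : derive1 _ = fun=> 0) //.
by apply/funext => s; rewrite derive1_derive derive_cst.
Qed.

Lemma derive1n_sum E (I : Type) (r : seq I) (P : pred I) (p : I -> R^o -> E) i t :
  (forall j, P j -> smooth_near (p j) t) ->
  derive1n i (fun s => \sum_(j <- r | P j) p j s) t = \sum_(j <- r | P j) derive1n i (p j) t.
Proof.
move=> sp; elim: r => [|j r IH].
  rewrite big_nil (_ : (fun s => _) = fun=> 0); last by apply/funext => s; rewrite big_nil.
  by case: i => [//|i]; rewrite derive1n_cst.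
rewrite (_ : (fun s => _) = fun s => (if P j then p j s else 0) + \sum_(j <- r | P j)
    p j s); last first.
  by apply/funext => s; rewrite big_cons; case: ifP => //; rewrite add0r.
rewrite big_cons derive1n_add; last exact: smooth_near_sum.
  rewrite IH; case: ifP => //.
  by case: i {IH} => [|i]; rewrite ?derive1n_cst add0r.
by case: (P j) (sp j) => [/(_ isT)//|_]; exact: smooth_near_cst.
Qed.

Lemma derive1n_bilinear E F G {hE : fin_dim E} {hF : fin_dim F} (b : E -> F -> G)
    m (p : R^o -> E) (q : R^o -> F) t : bilinear_map b ->
  smooth_near p t -> smooth_near q t ->
  derive1n m (fun s => b (p s) (q s)) t =
  \sum_(j < m.+1) b (derive1n j p t) (derive1n (m - j) q t) *+ 'C(m, j).
Proof.
move=> bb; elim: m p q => [|m IH] p q sp sq.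
  by rewrite big_ord1 bin0 mulr1n.
rewrite derive1Sn (@derive1n_near_eq _ _ _
  (fun s => b (derive1 p s) (q s) + b (p s) (derive1 q s))); last first.
  move: (smooth_near_near sp) (smooth_near_near sq).
  apply: filterS2 => s /smooth_near_differentiable ? /smooth_near_differentiable ?.
  exact: derive1_bilinear.
have sp' := smooth_near_derive1 sp; have sq' := smooth_near_derive1 sq.
rewrite derive1n_add; [|exact: smooth_near_bilinear..].
rewrite !IH // [RHS]big_ord_recl bin0 subn0 mulr1n.
pose f j := b (derive1n j p t) (derive1n (m.+1 - j) q t) *+ 'C(m, j).
(* The added term of index [m.+1] has coefficient 'C(m, m + 1) = 0. After the split of the term of
   index 0, the two sums match index by index and combine by Pascal's rule. *)
rewrite [X in _ + X = _](_ : _ = \sum_(j < m.+2) f j); last first.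
  rewrite [RHS]big_ord_recr /= [f m.+1]/f bin_small // mulr0n addr0.
  by apply: eq_bigr => j _; rewrite /f -derive1Sn -subSn // -ltnS.
rewrite [X in _ + X = _]big_ord_recl {1}/f bin0 mulr1n subn0 addrCA; congr (_ + _).
rewrite -big_split; apply: eq_bigr => j _ /=.
by rewrite /f /bump /= !add1n binS mulrnDr addrC -!derive1nS -!derive1Sn subSS.
Qed.

(** The bound is strict, so [m] counts the derivatives from order 0 on: equality of k-jets is
    [jet_agree k.+1], and one differentiation lowers [m] by one. *)
Definition jet_agree E (m : nat) (p q : R^o -> E) : Prop :=
  forall i, (i < m)%N -> derive1n i p 0 = derive1n i q 0.

(** This replaces the formula for higher derivatives of a composite. The derivative of [f (p t)] is
    the map [z |-> 'D_(z.2) f z.1] along the curve (p, p') in E * E, so the induction generalizes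
    over the space and the map and loses one order at each step. *)
Lemma jet_agree_comp E F {hE : fin_dim E} (f : E -> F) m (p q : R^o -> E) :
  smooth_near p 0 -> smooth_near q 0 -> smooth_near f (p 0) -> jet_agree m p q ->
  jet_agree m (fun t => f (p t)) (fun t => f (q t)).
Proof.
elim: m E F hE f p q => [|m IH] E F hE f p q sp sq sf pq //.
have pq0 : p 0 = q 0 by exact: (pq 0%N).
have step (r : R^o -> E) : smooth_near r 0 -> r 0 = p 0 ->
    \forall t \near (0 : R^o), derive1 (fun s => f (r s)) t = 'D_((r t, derive1 r t).2)
        f (r t, derive1 r t).1.
  move=> sr r0.
  have : \forall t \near (0 : R^o), smooth_near f (r t).
    by apply: (smooth_near_continuous sr); apply: smooth_near_near; rewrite r0.
  move: (smooth_near_near sr); apply: filterS2 =>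
      t /smooth_near_differentiable dr /smooth_near_differentiable df.
  exact: derive1_comp_dir.
case=> [_|i im]; first by rewrite /= pq0.
rewrite !derive1Sn (derive1n_near_eq _ (step p sp _)) // (derive1n_near_eq _ (step q sq _)) //.
apply: (IH (E * E)%type F _ (fun z => 'D_(z.2) f z.1) (fun t => (p t, derive1 p t))
    (fun t => (q t, derive1 q t))) => //.
- by apply: smooth_near_pair => //; exact: smooth_near_derive1.
- by apply: smooth_near_pair => //; exact: smooth_near_derive1.
- by apply: (@smooth_near_dir _ (E * E)%type E F _ f fst snd) => //; apply: smooth_near_linear.
move=> j jm; rewrite !derive1n_pair //; try exact: smooth_near_derive1.
by rewrite -!derive1Sn !pq // ltnS ltnW.
Qed.

(** The factorial makes [v] the derivative of order [m] at 0, all others being zero there. *)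
Definition monomial_curve E (m : nat) (v : E) (t : R^o) : E := (t ^+ m / m`!%:R) *: v.

Lemma smooth_near_monomial_curve E m (v : E) t : smooth_near (monomial_curve m v) t.
Proof.
apply: smooth_near_scale; last exact: smooth_near_cst.
rewrite (_ : (fun t => _) = (fun t : R^o => (m`!%:R^-1 : R) *: (t ^+ m : R^o))); last first.
  by apply/funext => s; exact: mulrC.
apply: smooth_near_scale; first exact: smooth_near_cst.
elim: m => [|m IH]; first exact: smooth_near_cst.
rewrite (_ : (fun t => _) = (fun t : R^o => t *: (t ^+ m : R^o))); last first.
  by apply/funext => s; exact: exprS.
by apply: smooth_near_scale => //; exact: smooth_near_id.
Qed.

Lemma derive1_monomial_curve E m (v : E) :
  derive1 (monomial_curve m.+1 v) = monomial_curve m v.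
Proof.
apply/funext => t.
have sl : linear (fun a : R^o => a *: v) by move=> a x y; rewrite scalerDl -scalerA.
have dX : derivable (fun s : R^o => (m.+1`!%:R^-1 : R) *: (s ^+ m.+1 : R^o)) t 1.
  by apply: derivableZ; exact: exprn_derivable.
rewrite (_ : monomial_curve _ _ = fun s : R^o => ((m.+1`!%:R^-1 : R) *: (s ^+ m.+1 : R^o))
    *: v); last first.
  by apply/funext => s; rewrite /monomial_curve; congr (_ *: _); exact: mulrC.
rewrite (derive1_lin sl); last exact/derivable1_diffP.
congr (_ *: _); rewrite derive1E deriveZ; last exact: exprn_derivable.
rewrite exp_derive [LHS]mulrC factS natrM invfM /= /GRing.scale /= mulr1 -mulr_natr.
by rewrite !mul1r mulrACA divff ?mul1r // pnatr_eq0.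
Qed.

Lemma derive1n_monomial_curve E i m (v : E) :
  derive1n i (monomial_curve m v) 0 = if i == m then v else 0.
Proof.
elim: i m => [|i IH] [|m].
- by rewrite /= /monomial_curve expr0 fact0 divr1 scale1r.
- by rewrite /= /monomial_curve expr0n /= mul0r scale0r.
- rewrite (_ : monomial_curve 0 v = fun=> v) ?derive1n_cst //.
  by apply/funext => t; rewrite /monomial_curve expr0 fact0 divr1 scale1r.
by rewrite derive1Sn derive1_monomial_curve IH.
Qed.

(* Raising the order of a polynomial solution by one only changes the next
   Taylor coefficient, so no existence theorem for ODEs is needed. *)
Lemma jet_ode_solution E F {hE : fin_dim E} {hF : fin_dim F} (f : E * F -> E) (x0 : E)
    (y : R^o -> F) (k : nat) :
  smooth_near f (x0, y 0) -> smooth_near y 0 ->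
  exists u : R^o -> E, [/\ smooth_near u 0, u 0 = x0 &
    jet_agree k (derive1 u) (fun t => f (u t, y t))].
Proof.
move=> sf sy; elim: k => [|k [u [su u0 uk]]].
  by exists (fun=> x0); split=> //; exact: smooth_near_cst.
(* The defect of [u] in the first order not yet solved: the derivative of order [k.+1] required by
   the equation minus the one that [u] has. *)
pose w := derive1n k (fun t => f (u t, y t)) 0 - derive1n k.+1 u 0.
have sm := smooth_near_monomial_curve k.+1 w 0.
pose u1 := fun t => u t + monomial_curve k.+1 w t.
have su1 : smooth_near u1 0 by exact: smooth_near_add.
have agree : jet_agree k.+1 u1 u.
  move=> i ik; rewrite derive1n_add // derive1n_monomial_curve.
  by rewrite ltn_eqF // addr0.
have u10 : u1 0 = x0 by rewrite -u0; exact: (agree 0%N).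
exists u1; split=> // i; rewrite ltnS => ik.
have -> : derive1n i (fun t => f (u1 t, y t)) 0 = derive1n i (fun t => f (u t, y t)) 0.
  apply: (@jet_agree_comp _ _ _ f k.+1 (fun t => (u1 t, y t)) (fun t => (u t, y t))) => //.
  - exact: smooth_near_pair.
  - exact: smooth_near_pair.
  - by rewrite u10.
  by move=> j jk; rewrite !derive1n_pair // agree.
rewrite -derive1Sn derive1n_add // derive1n_monomial_curve eqSS.
move: ik; rewrite leq_eqVlt => /orP[/eqP ->|ik].
  by rewrite eqxx /w addrC subrK.
by rewrite ltn_eqF // addr0 derive1Sn uk.
Qed.

End Curves.

(** * Manifolds *)

Section Charts.
Context {R : realType}.
Implicit Types E F : normedModType R.

Lemma is_chart_self E (M : mfd E) (hM : is_manifold M) p : chart_dom (chart_at M p) p.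
Proof. by case: hM => _ _ /(_ p) []. Qed.

Lemma chart_dom_open E (M : mfd E) (hM : is_manifold M) a : open (chart_dom (chart_at M a)).
Proof. by case: hM => _ _ /(_ a) [[]]. Qed.

Lemma chart_img_open E (M : mfd E) (hM : is_manifold M) a : open (chart_img (chart_at M a)).
Proof. by case: hM => _ _ /(_ a) [[]]. Qed.

Lemma chart_mapK E (M : mfd E) (hM : is_manifold M) a p :
  chart_dom (chart_at M a) p -> chart_inv (chart_at M a) (chart_map (chart_at M a) p) = p.
Proof. by case: hM => _ _ /(_ a) [[_ _ + _ _] _] _; apply. Qed.

Lemma chart_map_continuous E (M : mfd E) (hM : is_manifold M) a p :
  chart_dom (chart_at M a) p -> {for p, continuous (chart_map (chart_at M a))}.
Proof. by case: hM => _ _ /(_ a) [[_ _ _ + _] _] _ ap; apply; exact/mem_set. Qed.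

Lemma chart_inv_continuous E (M : mfd E) (hM : is_manifold M) a z :
  chart_img (chart_at M a) z -> {for z, continuous (chart_inv (chart_at M a))}.
Proof. by case: hM => _ _ /(_ a) [[_ _ _ _ +] _] _ ap; apply; exact/mem_set. Qed.

Lemma chart_img_map E (M : mfd E) a p :
  chart_dom (chart_at M a) p -> chart_img (chart_at M a) (chart_map (chart_at M a) p).
Proof. by move=> ap; exists p. Qed.

Lemma chart_invK E (M : mfd E) (hM : is_manifold M) a z :
  chart_img (chart_at M a) z -> chart_map (chart_at M a) (chart_inv (chart_at M a) z) = z.
Proof. by move=> [p ap <-]; rewrite chart_mapK. Qed.

Lemma chart_dom_inv E (M : mfd E) (hM : is_manifold M) a z :
  chart_img (chart_at M a) z -> chart_dom (chart_at M a) (chart_inv (chart_at M a) z).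
Proof. by move=> [p ap <-]; rewrite chart_mapK. Qed.

Lemma near_chart_img E (M : mfd E) (hM : is_manifold M) a p :
  chart_dom (chart_at M a) p ->
  \forall z \near chart_map (chart_at M a) p, chart_img (chart_at M a) z.
Proof.
move=> ap; apply: open_nbhs_nbhs; split; first exact: chart_img_open.
exact: chart_img_map.
Qed.

Lemma near_chart_dom E (M : mfd E) (hM : is_manifold M) a p :
  chart_dom (chart_at M a) p -> \forall q \near p, chart_dom (chart_at M a) q.
Proof. by move=> ap; apply: open_nbhs_nbhs; split=> //; exact: chart_dom_open. Qed.

Lemma near_chart_inv_dom E (M : mfd E) (hM : is_manifold M) a b p :
  chart_dom (chart_at M a) p -> chart_dom (chart_at M b) p ->
  \forall z \near chart_map (chart_at M a) p,
    chart_img (chart_at M a) z /\ chart_dom (chart_at M b) (chart_inv (chart_at M a) z).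
Proof.
move=> ap bp; apply: filterI; first exact: near_chart_img.
have := chart_inv_continuous hM (chart_img_map ap); apply.
by rewrite chart_mapK //; exact: near_chart_dom.
Qed.

(** The image of the overlap is not given as an open set, so the transition map is restricted to its
    interior; continuity of the inverse chart puts the point there. *)
Lemma smooth_near_transition E (M : mfd E) (hM : is_manifold M) a b p :
  chart_dom (chart_at M a) p -> chart_dom (chart_at M b) p ->
  smooth_near (chart_map (chart_at M b) \o chart_inv (chart_at M a))
    (chart_map (chart_at M a) p).
Proof.
move=> ap bp; case: (hM) => _ _ _ /(_ a b) ab.
set V := (X in smooth_on X _) in ab.
exists V^°; last by move=> m; apply: class_C_sub (ab m); exact: interior_subset.
split; first exact: open_interior.
apply: filterS (near_chart_inv_dom hM ap bp) => z [az bz].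
by exists (chart_inv (chart_at M a) z); [split=> //; exact: chart_dom_inv|exact: chart_invK].
Qed.

(** Maps out of a vector space serve as test maps: their source has a trivial chart, and a map of
    manifolds is smooth as soon as it preserves them ([smooth_map_into]). *)
Definition smooth_into E F (M : mfd F) (f : E -> M) (x : E) : Prop :=
  smooth_at (M := vec_mfd E) (N := M) f x.

Lemma smooth_into_continuous E F (M : mfd F) (f : E -> M) x :
  smooth_into f x -> {for x, continuous f}.
Proof. by case. Qed.

Lemma smooth_into_self E F (M : mfd F) (f : E -> M) x :
  smooth_into f x -> smooth_near (fun y => chart_map (chart_at M (f x)) (f y)) x.
Proof. by case. Qed.

Lemma smooth_into_near_dom E F (M : mfd F) (hM : is_manifold M) b (f : E -> M) x :
  smooth_into f x -> chart_dom (chart_at M b) (f x) ->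
  \forall y \near x, chart_dom (chart_at M b) (f y).
Proof.
move=> /smooth_into_continuous fc bx; apply: fc.
exact: near_chart_dom.
Qed.

Lemma smooth_into_chart E F {hF : fin_dim F} (M : mfd F) (hM : is_manifold M)
    b (f : E -> M) x :
  smooth_into f x -> chart_dom (chart_at M b) (f x) ->
  smooth_near (fun y => chart_map (chart_at M b) (f y)) x.
Proof.
move=> sf bx; have ax := is_chart_self hM (f x).
apply: smooth_near_ext (smooth_near_comp (smooth_into_self sf)
    (smooth_near_transition hM ax bx)).
apply: filterS (smooth_into_near_dom hM sf ax) => y ay /=.
by rewrite chart_mapK.
Qed.

(** The definition reads [f] in the chart around [f x]; a transition map allows any chart that
    contains the nearby values. Continuity of [f] comes from writing it as the inverse chart after
    its coordinate expression. *)
Lemma smooth_intoI E F {hF : fin_dim F} (M : mfd F) (hM : is_manifold M) b (f : E -> M) x :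
  (\forall y \near x, chart_dom (chart_at M b) (f y)) ->
  smooth_near (fun y => chart_map (chart_at M b) (f y)) x -> smooth_into f x.
Proof.
move=> fb sf; have bx := nbhs_singleton fb; have ax := is_chart_self hM (f x).
have fE : \forall y \near x, chart_inv (chart_at M b) (chart_map (chart_at M b) (f y)) = f y.
  by apply: filterS fb => y; exact: chart_mapK.
split.
  have c : {for x, continuous (chart_inv (chart_at M b) \o (fun y =>
      chart_map (chart_at M b) (f y)))}.
    apply: continuous_comp; first exact: smooth_near_continuous.
    by apply: chart_inv_continuous => //; exact: chart_img_map.
  rewrite /prop_for /continuous_at -(nbhs_singleton fE).
  by apply: cvg_trans c; apply: near_eq_cvg; apply: filterS fE => y <-.
suff : smooth_near (fun y => chart_map (chart_at M (f x)) (f y)) x by [].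
apply: smooth_near_ext (smooth_near_comp sf (smooth_near_transition hM bx ax)).
by apply: filterS fE => y /= ->.
Qed.

Lemma smooth_into_near E F {hF : fin_dim F} (M : mfd F) (hM : is_manifold M) (f : E -> M) x :
  smooth_into f x -> \forall y \near x, smooth_into f y.
Proof.
move=> sf; have ax := is_chart_self hM (f x).
have s2 := smooth_near_near (smooth_into_self sf).
have s1 := nbhs_interior (smooth_into_near_dom hM sf ax).
by move: s1 s2; apply: filterS2 => y; exact: smooth_intoI.
Qed.

Lemma smooth_into_inv E {hE : fin_dim E} (M : mfd E) (hM : is_manifold M) a z :
  chart_img (chart_at M a) z -> smooth_into (chart_inv (chart_at M a)) z.
Proof.
move=> az; have az' : \forall y \near z, chart_img (chart_at M a) y.
  by apply: open_nbhs_nbhs; split=> //; exact: chart_img_open.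
apply: (@smooth_intoI _ _ _ _ hM a).
  by apply: filterS az' => y; exact: chart_dom_inv.
apply: smooth_near_ext (smooth_near_id z).
by apply: filterS az' => y ay; rewrite chart_invK.
Qed.

Lemma smooth_into_comp E E1 F {hE : fin_dim E} {hF : fin_dim F} (M : mfd F)
    (hM : is_manifold M)
    (g : E1 -> E) (f : E -> M) x :
  smooth_near g x -> smooth_into f (g x) -> smooth_into (fun y => f (g y)) x.
Proof.
move=> sg sf; have ax := is_chart_self hM (f (g x)).
apply: (@smooth_intoI _ _ _ _ hM (f (g x))).
  exact: near_continuous (smooth_near_continuous sg) (smooth_into_near_dom hM sf ax).
exact: (smooth_near_comp sg (smooth_into_self sf)).
Qed.

Lemma smooth_into_cst E F (M : mfd F) (a : M) (x : E) : smooth_into (fun=> a) x.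
Proof.
split; first exact: cvg_cst.
exact: (@smooth_near_cst _ E F (chart_map (chart_at M a) a)).
Qed.

Lemma smooth_at_smooth_into E1 E F {hE : fin_dim E} {hF : fin_dim F} (M : mfd E) (N : mfd F)
    (hM : is_manifold M) (hN : is_manifold N) (h : M -> N) (f : E1 -> M) x :
  smooth_at h (f x) -> smooth_into f x -> smooth_into (fun y => h (f y)) x.
Proof.
move=> [hc sh] sf.
have {}sh : smooth_near (chart_map (chart_at N (h (f x))) \o h \o chart_inv (chart_at M (f x)))
    (chart_map (chart_at M (f x)) (f x)) by exact: sh.
apply: (@smooth_intoI _ _ _ _ hN (h (f x))).
  have H := near_continuous hc (near_chart_dom hN (is_chart_self hN _)).
  exact: near_continuous (smooth_into_continuous sf) H.
apply: smooth_near_ext (smooth_near_comp (smooth_into_self sf) sh).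
apply: filterS (smooth_into_near_dom hM sf (is_chart_self hM _)) => y ay /=.
by rewrite chart_mapK.
Qed.

(** The inverse chart parametrizes a neighbourhood of [p], so it suffices to test [h] on it;
    continuity of [h] itself is recovered by composing back with the chart. *)
Lemma smooth_into_smooth_at E F {hF : fin_dim F} (M : mfd E) (N : mfd F)
    (hM : is_manifold M) (h : M -> N) p :
  smooth_into (fun z => h (chart_inv (chart_at M p) z)) (chart_map (chart_at M p) p) ->
  smooth_at h p.
Proof.
have ap := is_chart_self hM p.
move=> sh; split; last by have := smooth_into_self sh; rewrite chart_mapK.
have c : {for p, continuous ((fun z => h (chart_inv (chart_at M p) z))
    \o chart_map (chart_at M p))}.
  apply: continuous_comp; first exact: chart_map_continuous.
  exact: smooth_into_continuous.
rewrite /prop_for /continuous_at -[in X in _ --> X](chart_mapK hM ap).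
apply: cvg_trans c; apply: near_eq_cvg.
by apply: filterS (near_chart_dom hM ap) => y ay /=; rewrite chart_mapK.
Qed.

Lemma smooth_into_vec E F {hF : fin_dim F} (f : E -> F) x :
  smooth_into (M := vec_mfd F) f x <-> smooth_near f x.
Proof. by split=> [[]//|sf]; split=> //; exact: smooth_near_continuous. Qed.

Lemma smooth_into_pair E F1 F2 (M : mfd F1) (N : mfd F2) (f : E -> M) (g : E -> N) x :
  smooth_into f x -> smooth_into g x ->
  smooth_into (M := prod_mfd M N) (fun y => (f y, g y)) x.
Proof.
move=> [fc sf] [gc sg]; split; first by apply: cvg_pair; [exact: fc|exact: gc].
exact: (smooth_near_pair sf sg).
Qed.

Lemma smooth_into_fst E F1 F2 {h1 : fin_dim F1} {h2 : fin_dim F2} (M : mfd F1) (N : mfd F2)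
    (f : E -> prod_mfd M N) x :
  smooth_into f x -> smooth_into (fun y => (f y).1) x.
Proof.
move=> [fc sf]; split.
  by apply: (@continuous_comp _ _ _ f fst); [exact: fc|exact: cvg_fst].
exact: (smooth_near_fst sf).
Qed.

Lemma smooth_into_snd E F1 F2 {h1 : fin_dim F1} {h2 : fin_dim F2} (M : mfd F1) (N : mfd F2)
    (f : E -> prod_mfd M N) x :
  smooth_into f x -> smooth_into (fun y => (f y).2) x.
Proof.
move=> [fc sf]; split.
  by apply: (@continuous_comp _ _ _ f snd); [exact: fc|exact: cvg_snd].
exact: (smooth_near_snd sf).
Qed.

End Charts.

(** * Vector spaces and products as manifolds *)

Section ProductManifolds.
Context {R : realType}.
Implicit Types E F : normedModType R.

Lemma smooth_on_near E F (U : set E) (f : E -> F) :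
  (forall x, U x -> smooth_near f x) -> smooth_on U f.
Proof.
move=> sf m; elim: m f sf => [|m IH] f sf.
  by move=> x /set_mem /sf; exact: smooth_near_continuous.
split=> [x /sf|v]; first exact: smooth_near_differentiable.
by apply: IH => x /sf; exact: smooth_near_derive.
Qed.

Lemma openX (T U : topologicalType) (A : set T) (B : set U) :
  open A -> open B -> open (A `*` B).
Proof.
rewrite !openE => oA oB [x y] [/= /oA Ax /oB By].
by exists (A, B).
Qed.

Lemma second_countable_prod (T U : topologicalType) :
  @second_countable T -> @second_countable U -> @second_countable (T * U)%type.
Proof.
move=> [B cB [oB bB]] [C cC [oC bC]].
exists [set A `*` D | A in B & D in C].
  rewrite (_ : [set _ | _ in _ & _ in _] = (fun p => p.1 `*` p.2) @` (B `*` C)).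
    by apply: card_le_trans (card_image_le _ _) (countableX cB cC).
  apply/seteqP; split=> [_ [A AB [D DC <-]]|_ [[A D] [AB DC] <-]].
    by exists (A, D).
  by exists A => //; exists D.
split=> [_ [A AB [D DC <-]]|[x y] V].
  by apply: openX; [exact: oB|exact: oC].
move=> [[P Q] [/= Px Qy] PQV].
have [A [AB Ax] AP] := bB x _ Px; have [D [DC Dy] DQ] := bC y _ Qy.
exists (A `*` D); first by split=> //; exists A => //; exists D.
by move=> [a d] [/= /AP Pa /DQ Qd]; exact: PQV.
Qed.

(** The countable base consists of the open boxes whose two corners are rational matrices. *)
Lemma second_countable_matrix m n : @second_countable 'M[R]_(m, n).
Proof.
pose box (q : 'M[rat]_(m, n) * 'M[rat]_(m, n)) : set 'M[R]_(m, n) :=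
  [set M | forall i j, M i j \in `]ratr (q.1 i j), ratr (q.2 i j)[%R].
exists (range box).
  by apply: card_le_trans (card_image_le _ _) _; exact: countableP.
split=> [_ [q _ <-]|M V].
  rewrite openE => M Mq.
  have H i j : \forall N \near M, (N : 'M[R]_(m, n))
      i j \in `]ratr (q.1 i j), ratr (q.2 i j)[%R.
    exact: near_continuous (@coord_continuous _ _ _ i j M) (near_in_itvoo (Mq i j)).
  near=> N => i j; move: i j; near: N.
  by apply: filter_forall => i; apply: filter_forall => j; exact: H.
move=> /nbhs_ballP [e /= e0 MV].
have H1 i j : {q : rat | ratr q \in `]M i j - e, M i j[%R}.
  by apply: cid; apply: rat_in_itvoo; rewrite ltrBlDr ltrDl.
have H2 i j : {q : rat | ratr q \in `]M i j, M i j + e[%R}.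
  by apply: cid; apply: rat_in_itvoo; rewrite ltrDl.
exists (box (\matrix_(i, j) sval (H1 i j), \matrix_(i, j) sval (H2 i j))).
  split; first by exists (\matrix_(i, j) sval (H1 i j), \matrix_(i, j) sval (H2 i j)).
  move=> i j /=; rewrite !mxE.
  case: (H1 i j) => q1 /=; case: (H2 i j) => q2 /=; rewrite !in_itv /=.
  by move=> /andP[-> _] /andP[_ ->].
move=> N Nb; apply: MV; split=> // i j; have := Nb i j; rewrite !mxE /=.
case: (H1 i j) => q1 /=; case: (H2 i j) => q2 /=; rewrite !in_itv /=.
move=> /andP[_ q2e] /andP[eq1 _] /andP[q1N Nq2].
rewrite /ball /= ltr_distlC; apply/andP; split;
    [exact: lt_trans eq1 q1N|exact: lt_trans Nq2 q2e].
Unshelve. all: by end_near. Qed.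

Lemma hausdorff_prod (T U : topologicalType) :
  hausdorff_space T -> hausdorff_space U -> hausdorff_space (T * U)%type.
Proof.
move=> hT hU [x y] [x' y'] c; congr (_, _).
  apply: hT => A B Ax Bx'.
  have [[a b] [/= [Aa _] [Ba _]]] : (A `*` [set: U]) `&` (B `*` [set: U]) !=set0.
    by apply: c; [exists (A, [set: U])|exists (B, [set: U])] => //; split=> //; exact: filterT.
  by exists a.
apply: hU => A B Ax Bx'.
have [[a b] [/= [_ Aa] [_ Ba]]] : ([set: T] `*` A) `&` ([set: T] `*` B) !=set0.
  by apply: c; [exists ([set: T], A)|exists ([set: T], B)] => //; split=> //; exact: filterT.
by exists b.
Qed.

Lemma is_manifold_vec E {hE : fin_dim E} : @second_countable E -> is_manifold (vec_mfd E).
Proof.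
move=> sE; split=> //.
- move=> p; split=> //; split=> //; first exact: openT.
  + by rewrite /chart_img /= image_id; exact: openT.
  + by move=> x _; exact: cvg_id.
  + by move=> x _; exact: cvg_id.
by move=> p q; apply: smooth_on_near => x _; exact: smooth_near_id.
Qed.

Lemma is_manifold_prod E F {hE : fin_dim E} {hF : fin_dim F} (M : mfd E) (N : mfd F) :
  is_manifold M -> is_manifold N -> is_manifold (prod_mfd M N).
Proof.
move=> hM hN; have [M1 M2 _ _] := hM; have [N1 N2 _ _] := hN.
have imgE (a : M * N) : chart_img (chart_at (prod_mfd M N) a) =
    chart_img (chart_at M a.1) `*` chart_img (chart_at N a.2).
  apply/seteqP; split=> [_ [[x y] [/= ax ay] <-]|[z w] [/= [x ax <-] [y ay <-]]].
    by split=> /=; exact: chart_img_map.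
  by exists (x, y).
split; first exact: hausdorff_prod.
- exact: second_countable_prod.
- move=> p; split; last by split=> /=; exact: is_chart_self.
  split.
  + by apply: openX; exact: chart_dom_open.
  + by rewrite imgE; apply: openX; exact: chart_img_open.
  + by move=> [x y] [/= ax ay]; rewrite !chart_mapK.
  + move=> [x y] /set_mem [/= ax ay]; apply: cvg_pair.
      by apply: (@continuous_comp _ _ _ fst); [exact: cvg_fst|exact: chart_map_continuous].
    by apply: (@continuous_comp _ _ _ snd); [exact: cvg_snd|exact: chart_map_continuous].
  + move=> [x y]; rewrite imgE => /set_mem [/= ax ay]; apply: cvg_pair.
      by apply: (@continuous_comp _ _ _ fst); [exact: cvg_fst|exact: chart_inv_continuous].
    by apply: (@continuous_comp _ _ _ snd); [exact: cvg_snd|exact: chart_inv_continuous].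
move=> p q; apply: smooth_on_near => _ [[x y] [[/= px py] [/= qx qy]] <-].
pose tM := chart_map (chart_at M q.1) \o chart_inv (chart_at M p.1).
pose tN := chart_map (chart_at N q.2) \o chart_inv (chart_at N p.2).
apply: smooth_near_pair.
  apply: (@smooth_near_comp _ _ _ _ _ (fst : E * F -> E) tM); first exact: smooth_near_linear.
  exact: smooth_near_transition.
apply: (@smooth_near_comp _ _ _ _ _ (snd : E * F -> F) tN); first exact: smooth_near_linear.
exact: smooth_near_transition.
Qed.

End ProductManifolds.

(** * Derivatives whose direction and base point both move *)

Section DeriveDir.
Context {R : realType}.
Implicit Types E F : normedModType R.

(** A product rule: one term for the change of the direction, one for the motion of the base point.
    In coordinates of [v] both sides become sums over fixed directions. *)
Lemma derive_dir E1 E F {hE : fin_dim E} (f : E -> F) (p v : E1 -> E) x w :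
  smooth_near f (p x) -> smooth_near p x -> smooth_near v x ->
  'D_w (fun y => 'D_(v y) f (p y)) x =
  'D_('D_w v x) f (p x) + 'D_('D_w p x) ('D_(v x) f) (p x).
Proof.
move=> sf sp sv; case: (hE) => I [e [l [hl he]]].
have dirE u z : smooth_near f z -> 'D_u f z = \sum_i l i u *: 'D_(e i) f z.
  move=> /smooth_near_differentiable df.
  rewrite [in LHS](he u) (linear_sumE _ _ _ (derive_is_linear df)).
  by apply: eq_bigr => i _; rewrite (linear_scale _ _ (derive_is_linear df)).
have E1' : \forall y \near x, 'D_(v y) f (p y) = \sum_i l i (v y) *: 'D_(e i) f (p y).
  have := near_continuous (smooth_near_continuous sp) (smooth_near_near sf).
  by apply: filterS => y; exact: dirE.
have E2' : \forall z \near p x, 'D_(v x) f z = \sum_i l i (v x) *: 'D_(e i) f z.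
  by apply: filterS (smooth_near_near sf) => z; exact: dirE.
have dv : differentiable v x by exact: smooth_near_differentiable.
have dp : differentiable p x by exact: smooth_near_differentiable.
have dl i : differentiable (fun y => l i (v y)) x.
  by apply: (@differentiable_comp _ _ _ _ v (l i)) => //;
      apply: differentiable_linear (hl i).1.
have df i : differentiable ('D_(e i) f) (p x).
  exact/smooth_near_differentiable/smooth_near_derive.
have dfp i : differentiable (fun y => 'D_(e i) f (p y)) x.
  exact: (@differentiable_comp _ _ _ _ p ('D_(e i) f)).
have dd i := derive_scale w (dl i) (dfp i).
rewrite (near_eq_derive _ E1') (derive_sumE (index_enum I) w (fun i => (dd i).1)).2.
have d2 i := derive_scale ('D_w p x) (differentiable_cst (l i (v x)) (p x)) (df i).
rewrite (near_eq_derive _ E2') (derive_sumE (index_enum I) _ (fun i => (d2 i).1)).2.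
rewrite (dirE _ _ sf) -big_split; apply: eq_bigr => i _ /=.
rewrite (dd i).2 (d2 i).2 (derive_linear_comp _ (hl i).1) //.
rewrite derive_cst scale0r add0r; congr (_ + _ *: _).
exact: (@derive_comp _ _ _ _ p ('D_(e i) f)).
Qed.

(** The base point is a variable subject to an equation, so that the derivative of [f] can be taken
    at a simplified point, such as the coordinates of the identity. *)
Lemma derive1_comp_at E F (f : E -> F) (p : R^o -> E) t x : p t = x ->
  differentiable p t -> differentiable f x ->
  derive1 (fun s => f (p s)) t = 'D_(derive1 p t) f x.
Proof. by move=> <-; exact: derive1_comp_dir. Qed.

Lemma derive_comp_at E1 E F (g : E1 -> E) (f : E -> F) x v y : g x = y ->
  differentiable g x -> differentiable f y ->
  'D_v (fun z => f (g z)) x = 'D_('D_v g x) f y.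
Proof. by move=> <-; exact: derive_comp. Qed.

Lemma derive_comp_fst E1 E E2 F (g : E1 -> E) (f : E * E2 -> F) a x v y : g x = y ->
  differentiable g x -> differentiable f (y, a) ->
  'D_v (fun z => f (g z, a)) x = 'D_('D_v g x, 0) f (y, a).
Proof.
move=> gx dg df; have dp : differentiable (fun z => (g z, a)) x.
  by apply: differentiable_pair; [exact: dg|exact: differentiable_cst].
have px : (g x, a) = (y, a) by rewrite gx.
rewrite (derive_comp_at v px dp df) (derive_pair v dg (differentiable_cst a x)).
by rewrite derive_cst.
Qed.

Lemma derive1_comp_fst E E2 F (f : E * E2 -> F) (p : R^o -> E) a t x : p t = x ->
  differentiable p t -> differentiable f (x, a) ->
  derive1 (fun s => f (p s, a)) t = 'D_(derive1 p t, 0) f (x, a).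
Proof. by move=> pt dp df; rewrite !derive1_derive (derive_comp_fst _ pt dp df). Qed.

End DeriveDir.

(** * Lie groups *)

Section LieGroup.
Context {R : realType} {E : normedModType R} {hE : fin_dim E}.
Variables (G : lie_data E) (hG : is_lie_group G).
Local Notation e := (lg_one G).
Local Notation phi := (chart_map (chart_at G (lg_one G))).
Local Notation psi := (chart_inv (chart_at G (lg_one G))).
Local Notation z0 := (chart_map (chart_at G (lg_one G)) (lg_one G)).

Lemma lie_manifold : is_manifold G. Proof. by case: hG. Qed.
Local Notation hM := lie_manifold.

Lemma lg_mulA : associative (@lg_mul R E G). Proof. by case: hG => _ [[]]. Qed.
Lemma lg_mul1g : left_id (lg_one G) lg_mul. Proof. by case: hG => _ [[]]. Qed.
Lemma lg_mulg1 : right_id (lg_one G) lg_mul. Proof. by case: hG => _ [[]]. Qed.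
Lemma lg_mulVg : left_inverse (lg_one G) lg_inv lg_mul. Proof. by case: hG => _ [[]]. Qed.
Lemma lg_mulgV : right_inverse (lg_one G) lg_inv lg_mul. Proof. by case: hG => _ [[]]. Qed.

Lemma lg_mulgK (g h : G) : lg_mul (lg_mul g h) (lg_inv h) = g.
Proof. by rewrite -lg_mulA lg_mulgV lg_mulg1. Qed.

Lemma lg_mulgKV (g h : G) : lg_mul (lg_mul g (lg_inv h)) h = g.
Proof. by rewrite -lg_mulA lg_mulVg lg_mulg1. Qed.

Lemma lg_invM (g h : G) : lg_inv (lg_mul g h) = lg_mul (lg_inv h) (lg_inv g).
Proof.
rewrite -[RHS]lg_mul1g -(lg_mulVg (lg_mul g h)) -lg_mulA.
by rewrite [lg_mul (lg_mul g h) _]lg_mulA lg_mulgK lg_mulgV lg_mulg1.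
Qed.

Lemma lg_inv1 : lg_inv e = e.
Proof. by rewrite -[LHS]lg_mul1g lg_mulgV. Qed.

Lemma lg_dom1 : chart_dom (chart_at G e) e.
Proof. exact: is_chart_self hM _. Qed.

Lemma lg_psi0 : psi z0 = e.
Proof. exact: chart_mapK hM _ _ lg_dom1. Qed.

Lemma smooth_into_mul (E1 : normedModType R) (f g : E1 -> G) x :
  smooth_into f x -> smooth_into g x -> smooth_into (fun y => lg_mul (f y) (g y)) x.
Proof.
move=> sf sg; case: hG => _ [_ [sm _]].
have hMM : is_manifold (prod_mfd G G) by exact: is_manifold_prod hM hM.
exact: (smooth_at_smooth_into hMM hM (sm (f x, g x)) (smooth_into_pair sf sg)).
Qed.

Lemma smooth_into_lg_inv (E1 : normedModType R) (f : E1 -> G) x :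
  smooth_into f x -> smooth_into (fun y => lg_inv (f y)) x.
Proof.
move=> sf; case: hG => _ [_ [_ si]].
exact: (smooth_at_smooth_into hM hM (si (f x)) sf).
Qed.

Lemma smooth_into_psi (E1 : normedModType R) (f : E1 -> E) x :
  smooth_near f x -> chart_img (chart_at G e) (f x) ->
  smooth_into (fun y => psi (f y)) x.
Proof. by move=> sf fx; exact: smooth_into_comp hM _ _ _ sf (smooth_into_inv hM fx). Qed.

Lemma smooth_into_psi0 (E1 : normedModType R) (f : E1 -> E) x :
  smooth_near f x -> f x = z0 -> smooth_into (fun y => psi (f y)) x.
Proof. by move=> sf fx; apply: smooth_into_psi => //; rewrite fx;
    exact: chart_img_map lg_dom1. Qed.

Lemma smooth_near_phi (E1 : normedModType R) (f : E1 -> G) x :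
  smooth_into f x -> f x = e -> smooth_near (fun y => phi (f y)) x.
Proof. by move=> sf fx; apply: smooth_into_chart hM _ _ _ sf _; rewrite fx;
    exact: lg_dom1. Qed.

Lemma near_psi_phi (E1 : normedModType R) (f : E1 -> G) x :
  smooth_into f x -> f x = e -> \forall y \near x, psi (phi (f y)) = f y.
Proof.
move=> sf fx; have := @smooth_into_near_dom _ _ _ _ hM e f x sf; rewrite {1}fx =>
    /(_ lg_dom1); apply: filterS => y; exact: (chart_mapK hM).
Qed.

Lemma near_phi_psi : \forall z \near z0, phi (psi z) = z.
Proof. by apply: filterS (near_chart_img hM lg_dom1) => z; exact: (chart_invK hM). Qed.

Definition lg_conj (g h : G) : G := lg_mul (lg_mul g h) (lg_inv g).

Lemma lg_conj1 g : lg_conj g e = e.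
Proof. by rewrite /lg_conj lg_mulg1 lg_mulgV. Qed.

Lemma lg_conjM g h k : lg_conj (lg_mul g h) k = lg_conj g (lg_conj h k).
Proof. by rewrite /lg_conj lg_invM !lg_mulA. Qed.

Lemma lg_conj_mul g h : lg_mul (lg_conj g h) g = lg_mul g h.
Proof. exact: lg_mulgKV. Qed.

Lemma smooth_into_conj (E1 : normedModType R) (f g : E1 -> G) x :
  smooth_into f x -> smooth_into g x -> smooth_into (fun y => lg_conj (f y) (g y)) x.
Proof.
move=> sf sg; apply: smooth_into_mul; first exact: smooth_into_mul.
exact: smooth_into_lg_inv.
Qed.

Lemma smooth_near_conj (E1 : normedModType R) {h1 : fin_dim E1} (f : E1 -> G) x :
  smooth_into f x ->
  smooth_near (fun p : E1 * E => phi (lg_conj (f p.1) (psi p.2))) (x, z0).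
Proof.
move=> sf; apply: smooth_near_phi; last by rewrite /= lg_psi0 lg_conj1.
apply: smooth_into_conj.
  by apply: (smooth_into_comp hM (g := fst) (f := f)) => //; exact: smooth_near_linear.
by apply: smooth_into_psi0 => //; exact: smooth_near_linear.
Qed.

Lemma smooth_near_conj_chart g : smooth_near (fun z => phi (lg_conj g (psi z))) z0.
Proof.
apply: smooth_near_phi; last by rewrite lg_psi0 lg_conj1.
apply: smooth_into_conj; first exact: smooth_into_cst.
by apply: smooth_into_psi0 => //; exact: smooth_near_id.
Qed.

Lemma AdE g y : Ad g y = 'D_y (fun z => phi (lg_conj g (psi z))) z0.
Proof. by []. Qed.

Local Opaque Ad derive derive1.

Lemma Ad_linear (g : G) : linear (Ad g).
Proof. exact: derive_is_linear (smooth_near_differentiable (smooth_near_conj_chart g)). Qed.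

(** Conjugation in charts is jointly smooth in the parameter and the conjugated element. Ad is its
    derivative in the direction [(0, w y)], so smoothness in [y] is that of a derivative in a moving
    direction. *)
Lemma smooth_near_Ad (E1 : normedModType R) {h1 : fin_dim E1} (f : E1 -> G) (w : E1 -> E) x :
  smooth_into f x -> smooth_near w x -> smooth_near (fun y => Ad (f y) (w y)) x.
Proof.
move=> sf sw.
rewrite (_ : (fun y => _) = fun y => 'D_((0, w y) : E1 * E)
  (fun p : E1 * E => phi (lg_conj (f p.1) (psi p.2))) (y, z0)); last first.
  by apply/funext => y; rewrite -derive_slice2.
apply: (smooth_near_dir (p := fun y => (y, z0)) (v := fun y => (0, w y))).
- exact: smooth_near_conj.
- by apply: smooth_near_pair; [exact: smooth_near_id|exact: smooth_near_cst].
- by apply: smooth_near_pair => //; exact: smooth_near_cst.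
Qed.

Lemma Ad_velocity g (w : R^o -> G) t : smooth_into w t -> w t = e ->
  derive1 (fun s => phi (lg_conj g (w s))) t = Ad g (derive1 (fun s => phi (w s)) t).
Proof.
move=> sw wt; rewrite AdE -(@derive1_comp_at _ _ _ (fun z => phi (lg_conj g (psi z)))
  (fun s => phi (w s)) t z0); last 3 first.
- by rewrite wt.
- exact/smooth_near_differentiable/smooth_near_phi.
- exact/smooth_near_differentiable/smooth_near_conj_chart.
by apply: derive1_near_eq; apply: filterS (near_psi_phi sw wt) => s ->.
Qed.

Lemma Ad_mul (g h : G) y : Ad (lg_mul g h) y = Ad g (Ad h y).
Proof.
rewrite [LHS]AdE (@near_eq_derive _ _ _ _
  ((fun z => phi (lg_conj g (psi z))) \o (fun z => phi (lg_conj h (psi z))))); last first.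
  have s : smooth_into (fun z => lg_conj h (psi z)) z0.
    apply: smooth_into_conj; first exact: smooth_into_cst.
    by apply: smooth_into_psi0 => //; exact: smooth_near_id.
  have := near_psi_phi s; rewrite lg_psi0 lg_conj1 => /(_ erefl).
  by apply: filterS => z /= ->; rewrite lg_conjM.
have e0 : phi (lg_conj h (psi z0)) = z0 by rewrite lg_psi0 lg_conj1.
rewrite derive_comp ?e0 //; first exact/smooth_near_differentiable/smooth_near_conj_chart.
exact/smooth_near_differentiable/smooth_near_conj_chart.
Qed.

Lemma Ad_one y : Ad e y = y.
Proof.
rewrite AdE (@near_eq_derive _ _ _ _ id) ?derive_id //.
by apply: filterS near_phi_psi => z; rewrite /lg_conj lg_mul1g lg_inv1 lg_mulg1.
Qed.

Lemma AdK (g : G) y : Ad (lg_inv g) (Ad g y) = y.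
Proof. by rewrite -Ad_mul lg_mulVg Ad_one. Qed.

(** The product read in the chart at the identity. Its first partial derivatives at [(z0, z0)] are
    identities, and its mixed second derivatives encode the bracket. *)
Definition lg_mul_chart (p : E * E) : E := phi (lg_mul (psi p.1) (psi p.2)).

Lemma smooth_near_mul_chart : smooth_near lg_mul_chart (z0, z0).
Proof.
apply: smooth_near_phi; last by rewrite /= lg_psi0 lg_mul1g.
by apply: smooth_into_mul; apply: smooth_into_psi0 => //; exact: smooth_near_linear.
Qed.

Lemma derive_mul_chart1 v : 'D_(v, 0) lg_mul_chart (z0, z0) = v.
Proof.
rewrite -derive_slice1 (@near_eq_derive _ _ _ _ id) ?derive_id //.
by apply: filterS near_phi_psi => z; rewrite /lg_mul_chart /= lg_psi0 lg_mulg1.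
Qed.

Lemma derive_mul_chart2 v : 'D_(0, v) lg_mul_chart (z0, z0) = v.
Proof.
rewrite -derive_slice2 (@near_eq_derive _ _ _ _ id) ?derive_id //.
by apply: filterS near_phi_psi => z; rewrite /lg_mul_chart /= lg_psi0 lg_mul1g.
Qed.

Lemma mul_velocity (w1 w2 : R^o -> G) t :
  smooth_into w1 t -> smooth_into w2 t -> w1 t = e -> w2 t = e ->
  derive1 (fun s => phi (lg_mul (w1 s) (w2 s))) t =
  derive1 (fun s => phi (w1 s)) t + derive1 (fun s => phi (w2 s)) t.
Proof.
move=> s1 s2 e1 e2.
have d1 := smooth_near_differentiable (smooth_near_phi s1 e1).
have d2 := smooth_near_differentiable (smooth_near_phi s2 e2).
have dm := smooth_near_differentiable smooth_near_mul_chart.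
rewrite (@derive1_near_eq _ _ _ (fun s => lg_mul_chart (phi (w1 s), phi (w2 s)))); last first.
  move: (near_psi_phi s1 e1) (near_psi_phi s2 e2); apply: filterS2 => s E1 E2.
  by rewrite /lg_mul_chart /= E1 E2.
rewrite (@derive1_comp_at _ _ _ lg_mul_chart (fun s => (phi (w1 s), phi (w2 s)))
    t (z0, z0)) //.
- rewrite derive1_pair //; set v1 := derive1 _ t; set v2 := derive1 _ t.
  rewrite -[in RHS](derive_mul_chart1 v1) -[in RHS](derive_mul_chart2 v2).
  rewrite -(linear_add _ _ (derive_is_linear dm)); congr ('D_ _ _ _).
  by rewrite [RHS]surjective_pairing /= addr0 add0r.
- by rewrite e1 e2.
- exact: differentiable_pair.
Qed.

Lemma lie_bracketE x y : lie_bracket G x y = 'D_x (fun z => Ad (psi z) y) z0.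
Proof. by []. Qed.

Local Opaque lie_bracket.

Lemma smooth_near_Ad_chart y : smooth_near (fun z => Ad (psi z) y) z0.
Proof.
apply: smooth_near_Ad; last exact: smooth_near_cst.
by apply: smooth_into_psi0 => //; exact: smooth_near_id.
Qed.

Lemma bracket_linear_l y : linear ((lie_bracket G)^~ y).
Proof. exact: derive_is_linear (smooth_near_differentiable (smooth_near_Ad_chart y)). Qed.

Lemma bracket_linear_r x : linear (lie_bracket G x).
Proof.
move=> a y1 y2; rewrite !lie_bracketE.
have d y := smooth_near_differentiable (smooth_near_Ad_chart y).
rewrite (_ : (fun z => Ad (psi z) (a *: y1 + y2)) =
    (a \*: (fun z => Ad (psi z) y1)) + (fun z => Ad (psi z) y2)); last first.
  by apply/funext => z; rewrite Ad_linear.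
have d1 : derivable (fun z => Ad (psi z) y1) z0 x by exact: diff_derivable.
have d2 : derivable (fun z => Ad (psi z) y2) z0 x by exact: diff_derivable.
by rewrite (deriveD (derivableZ (k := a) d1) d2) (deriveZ a d1).
Qed.

Lemma bracket_bilinear : bilinear_map (lie_bracket G).
Proof. by split; [exact: bracket_linear_l|exact: bracket_linear_r]. Qed.

Lemma Ad_curve1 (w : R^o -> G) t y : smooth_into w t -> w t = e ->
  derive1 (fun s => Ad (w s) y) t = lie_bracket G (derive1 (fun s => phi (w s)) t) y.
Proof.
move=> sw wt; rewrite lie_bracketE -(@derive1_comp_at _ _ _ (fun z => Ad (psi z) y)
  (fun s => phi (w s)) t z0); last 3 first.
- by rewrite wt.
- exact/smooth_near_differentiable/smooth_near_phi.
- exact/smooth_near_differentiable/smooth_near_Ad_chart.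
by apply: derive1_near_eq; apply: filterS (near_psi_phi sw wt) => s ->.
Qed.

(** The bracket differentiates Ad at the identity only. The right translate [c s c(t)^-1] passes
    through the identity at s = t, and Ad along [c] is Ad along this translate composed with the
    fixed map [Ad (c t)]. *)
Lemma Ad_curve (c : R^o -> G) t y : smooth_into c t ->
  derive1 (fun s => Ad (c s) y) t =
  lie_bracket G (derive1 (fun s => phi (lg_mul (c s) (lg_inv (c t)))) t) (Ad (c t) y).
Proof.
move=> sc; rewrite -Ad_curve1; last by rewrite lg_mulgV.
  by congr (derive1 _ t); apply/funext => s; rewrite -Ad_mul lg_mulgKV.
by apply: smooth_into_mul => //; exact: smooth_into_cst.
Qed.

(** A straight line in the chart takes the place of exp (s x): only its velocity at the identity
    matters. *)
Definition lg_line (x : E) (s : R^o) : G := psi (z0 + s *: x).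

Lemma lg_line0 x : lg_line x 0 = e.
Proof. by rewrite /lg_line scale0r addr0 lg_psi0. Qed.

Lemma smooth_into_line x : smooth_into (lg_line x) 0.
Proof.
apply: smooth_into_psi0; last by rewrite scale0r addr0.
apply: smooth_near_add; first exact: smooth_near_cst.
by apply: smooth_near_scale; [exact: smooth_near_id|exact: smooth_near_cst].
Qed.

Lemma line_velocity x : derive1 (fun s => phi (lg_line x s)) 0 = x.
Proof.
rewrite (@derive1_line _ _ _ (fun z => phi (psi z)) z0 x).
  by rewrite (@near_eq_derive _ _ _ _ id) ?derive_id //; exact: near_phi_psi.
apply: near_eq_differentiable (smooth_near_differentiable (smooth_near_id z0)).
by apply: filterS near_phi_psi => z ->.
Qed.

(** Derivative at s = 0 of Ad_g Ad_w = Ad_(g w g^-1) Ad_g along a curve w through the identity with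
    velocity [x]. *)
Lemma Ad_bracket (g : G) x y : Ad g (lie_bracket G x y) = lie_bracket G (Ad g x) (Ad g y).
Proof.
have sl := smooth_into_line x; have l0 := lg_line0 x.
rewrite -{1}(line_velocity x) -Ad_curve1 //.
rewrite -(derive1_lin (Ad_linear g)); last first.
  by apply/smooth_near_differentiable/smooth_near_Ad => //; exact: smooth_near_cst.
rewrite -{2}(line_velocity x) -(Ad_velocity g sl l0) -Ad_curve1; last 2 first.
- by apply: smooth_into_conj; [exact: smooth_into_cst|exact: sl].
- by rewrite l0 lg_conj1.
congr (derive1 _ 0); apply/funext => s.
by rewrite -!Ad_mul /lg_conj lg_mulgKV.
Qed.

(** Infinitesimal form of [Ad_bracket]: that identity is differentiated in the group element at the
    identity, in direction [z]. *)
Lemma jacobi_derivation z x y : lie_bracket G z (lie_bracket G x y) =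
  lie_bracket G (lie_bracket G z x) y + lie_bracket G x (lie_bracket G z y).
Proof.
have dA u := smooth_near_differentiable (smooth_near_Ad_chart u).
rewrite lie_bracketE (_ : (fun t => Ad (psi t) _) =
  fun t => lie_bracket G (Ad (psi t) x) (Ad (psi t) y)); last first.
  by apply/funext => t; rewrite Ad_bracket.
by rewrite (derive_bilinear z bracket_bilinear (dA x) (dA y)) lg_psi0 !Ad_one.
Qed.

(* Both mixed second derivatives of the product at the identity are compared
   by writing p q = (p q p^-1) p. *)
Lemma bracket_mul_chart x y : lie_bracket G x y =
  'D_(x, 0) ('D_(0, y) lg_mul_chart) (z0, z0) - 'D_(0, x) ('D_(y, 0) lg_mul_chart) (z0, z0).
Proof.
apply/eqP; rewrite eq_sym subr_eq; apply/eqP.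
have sm := smooth_near_mul_chart.
have H : \forall p \near z0, 'D_(0, y) lg_mul_chart (p, z0) =
    'D_(Ad (psi p) y, 0) lg_mul_chart (z0, p).
  have c : {for z0, continuous (fun p => (z0, p) : E * E)}.
    by apply: cvg_pair; [exact: cvg_cst|exact: cvg_id].
  have := near_continuous c (smooth_near_near sm).
  apply: filterS => p smp.
  have sK := smooth_near_conj_chart (psi p).
  rewrite -derive_slice2 AdE.
  have K0 : phi (lg_conj (psi p) (psi z0)) = z0 by rewrite lg_psi0 lg_conj1.
  rewrite (@near_eq_derive _ _ _ _
    ((fun z => lg_mul_chart (z, p)) \o (fun z => phi (lg_conj (psi p) (psi z))))); last first.
    have s : smooth_into (fun z => lg_conj (psi p) (psi z)) z0.
      apply: smooth_into_conj; first exact: smooth_into_cst.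
      by apply: smooth_into_psi0 => //; exact: smooth_near_id.
    have := near_psi_phi s; rewrite lg_psi0 lg_conj1 => /(_ erefl).
    by apply: filterS => z E1; rewrite /lg_mul_chart /= E1 lg_conj_mul.
  rewrite derive_comp ?K0 ?derive_slice1 //; first exact: smooth_near_differentiable.
  apply: (@differentiable_comp _ _ _ _ (fun z => (z, p)) lg_mul_chart).
    by apply: differentiable_pair; [exact: differentiable_linear|exact: differentiable_cst].
  exact: smooth_near_differentiable.
rewrite -derive_slice1 (near_eq_derive _ H).
have sA := smooth_near_Ad_chart y.
have s1 : smooth_near (fun p : E => (z0, p)) z0.
  by apply: smooth_near_pair; [exact: smooth_near_cst|exact: smooth_near_id].
have s2 : smooth_near (fun p => (Ad (psi p) y, 0) : E * E) z0.
  by apply: smooth_near_pair; [exact: sA|exact: smooth_near_cst].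
(* The moving direction [Ad (psi p) y] contributes the bracket, since the first partial derivative
   of the product at the identity is the identity map; the moving base point contributes the other
   mixed derivative. *)
rewrite (derive_dir (f := lg_mul_chart) x sm s1 s2).
rewrite lg_psi0 Ad_one.
rewrite (derive_pair x (differentiable_cst z0 z0)
    (smooth_near_differentiable (smooth_near_id z0))).
rewrite (derive_pair x (smooth_near_differentiable sA) (differentiable_cst 0 z0)).
by rewrite !derive_cst derive_id derive_mul_chart1.
Qed.

(** Schwarz's theorem exchanges the derivatives in the second term, and then antisymmetry of the
    bracket is visible. This is also the form in which the bracket of the jet group is computed. *)
Lemma bracket_mul_chartC x y : lie_bracket G x y =
  'D_(x, 0) ('D_(0, y) lg_mul_chart) (z0, z0) - 'D_(y, 0) ('D_(0, x) lg_mul_chart) (z0, z0).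
Proof. by rewrite bracket_mul_chart (schwarz (0, x)) //; exact: smooth_near_mul_chart. Qed.

Lemma bracket_xx x : lie_bracket G x x = 0.
Proof. by rewrite bracket_mul_chartC subrr. Qed.

Lemma bracketC x y : lie_bracket G x y = - lie_bracket G y x.
Proof. by rewrite !bracket_mul_chartC opprB. Qed.

Lemma lie_bracket_is_lie_algebra : is_lie_algebra (lie_bracket G).
Proof.
split; [exact: bracket_linear_l|exact: bracket_linear_r|exact: bracket_xx|].
move=> x y z; rewrite (jacobi_derivation x) (bracketC z x) (bracketC z (lie_bracket G x y)).
by rewrite (linear_opp _ (bracket_linear_r _)) addrK subrr.
Qed.

End LieGroup.

(** * Compositions and partitions *)

Section WeightedCompositions.
Context {V : nmodType}.
Implicit Types (f g : seq nat -> V) (m n k : nat).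

Fixpoint comp_sum_rec (n m : nat) (f : seq nat -> V) : V :=
  match m, n with
  | 0, _ => f [::]
  | m'.+1, n'.+1 =>
      \sum_(j < m'.+1) comp_sum_rec n' (m' - j) (fun s => f (rcons s j.+1)) *+ 'C(m', j)
  | _, 0 => 0
  end.

(* [comp_sum m f] is the sum of N_s f(s) over the compositions s of m: removing
   the last part of s splits off the last binomial factor of N_s. The first
   argument of [comp_sum_rec] is fuel. *)
Definition comp_sum m f : V := comp_sum_rec m m f.

Lemma comp_sum_recE n m f : (m <= n)%N -> comp_sum_rec n m f = comp_sum m f.
Proof.
suff H n1 n2 : (m <= n1)%N -> (m <= n2)%N -> comp_sum_rec n1 m f = comp_sum_rec n2 m f.
  by move=> mn; exact: H.
elim: n1 n2 m f => [|n1 IH] [|n2] [|m] f //= m1 m2.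
by apply: eq_bigr => j _; rewrite (IH n2) // (leq_trans (leq_subr _ _)).
Qed.

Lemma comp_sum0 f : comp_sum 0 f = f [::].
Proof. by []. Qed.

Lemma comp_sumS m f : comp_sum m.+1 f =
  \sum_(j < m.+1) comp_sum (m - j) (fun s => f (rcons s j.+1)) *+ 'C(m, j).
Proof.
rewrite [LHS]/comp_sum /=; apply: eq_bigr => j _.
by rewrite comp_sum_recE // leq_subr.
Qed.

Lemma eq_comp_sum m f g : (forall s, is_composition m s -> f s = g s) ->
  comp_sum m f = comp_sum m g.
Proof.
elim/ltn_ind: m f g => -[|m] IH f g fg; first by rewrite !comp_sum0 fg.
rewrite !comp_sumS; apply: eq_bigr => j _; congr (_ *+ _).
apply: IH => [|s /andP[s0 /eqP sm]]; first by rewrite ltnS leq_subr.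
apply: fg; rewrite /is_composition all_rcons s0 /= sumn_rcons sm addnS subnK //.
by rewrite -ltnS.
Qed.

Lemma comp_sum_additive (l : V -> V) m f : l 0 = 0 -> {morph l : x y / x + y} ->
  l (comp_sum m f) = comp_sum m (fun s => l (f s)).
Proof.
move=> l0 lD; elim/ltn_ind: m f => -[|m] IH f; first by rewrite !comp_sum0.
have lMn x j : l (x *+ j) = l x *+ j.
  by elim: j => [|j IHj]; rewrite ?mulr0n // !mulrS lD IHj.
rewrite !comp_sumS (big_morph l lD l0); apply: eq_bigr => j _.
by rewrite lMn IH // ltnS leq_subr.
Qed.

(** The bound [N] on the entries makes the tuples a finite type. It stays fixed while [k] decreases
    in the induction; the cocycle uses [N] equal to [k]. *)
Definition comp_sum_len (N l k : nat) f : V :=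
  \sum_(t : l.-tuple 'I_N.+1 | is_composition k [seq val i | i <- t])
     f [seq val i | i <- t] *+ Defs.coefN [seq val i | i <- t].

Lemma coefN_rcons (s : seq nat) (i : nat) : Defs.coefN (rcons s i)
    = (Defs.coefN s * 'C((sumn s + i).-1, i.-1))%N.
Proof.
rewrite /Defs.coefN size_rcons; case: s => [|a s].
  (* The product in [coefN] starts at the second part; the factor for a first part i is 'C(i - 1, i
     - 1) = 1. *)
  by rewrite !big_geq //= mul1n add0n binn.
rewrite [size (a :: s)]/= big_nat_recr //=; congr (_ * _)%N.
  apply: eq_big_nat => r /andP[r1 rs].
  rewrite -rcons_cons nth_rcons /= rs; congr 'C((sumn (_ :: _)).-1, _).
  by rewrite -cats1 takel_cat //= -ltnS.
rewrite nth_rcons ltnn eqxx take_oversize ?size_rcons // sumn_rcons.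
by rewrite addnA.
Qed.

Lemma comp_sum_len_recr N l k f : (k < N)%N ->
  comp_sum_len N l.+1 k.+1 f =
  \sum_(j < k.+1) comp_sum_len N l (k - j) (fun s => f (rcons s j.+1)) *+ 'C(k, j).
Proof.
move=> kN.
pose h (p : l.-tuple 'I_N.+1 * 'I_N.+1) : l.+1.-tuple 'I_N.+1 := [tuple of rcons p.1 p.2].
have hb : bijective h.
  apply: inj_card_bij => [[t i] [t' i'] /(congr1 val) /= /rcons_inj [tt' ->]|].
    by congr (_, _); exact: val_inj.
  by rewrite card_prod !card_tuple expnSr.
rewrite /comp_sum_len (reindex h) /=; last exact: onW_bij.
(* Tuples are grouped by their last entry [i]. The value 0 violates positivity and values above
   [k.+1] exceed the total, so only the entries j + 1 with j at most k remain. *)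
pose g (i : nat) := \sum_(t : l.-tuple 'I_N.+1 | is_composition k.+1 (rcons [seq val i | i
    <- t] i))
   f (rcons [seq val i | i <- t] i) *+ Defs.coefN (rcons [seq val i | i <- t] i).
transitivity (\sum_(i < N.+1) g i).
  rewrite /g (exchange_big_dep xpredT) //= pair_big_dep /=.
  by apply: eq_big => [[t i]|[t i] _]; rewrite /= map_rcons.
rewrite big_ord_recl /= [g 0%N]big1 ?add0r; last first.
  by move=> t; rewrite /is_composition all_rcons.
have gE j : (j < k.+1)%N -> g j.+1 = comp_sum_len N l (k - j) (fun s => f (rcons s j.+1))
    *+ 'C(k, j).
  move=> jk; rewrite /g /comp_sum_len -sumrMnl; apply: eq_big => t.
    by rewrite /is_composition all_rcons /= sumn_rcons addnS eqSS -(eqn_add2r j (sumn _))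
        subnK.
  rewrite /is_composition all_rcons /= sumn_rcons => /andP[_ /eqP E].
  by rewrite coefN_rcons E /= mulrnA.
transitivity (\sum_(j < N | (j < k.+1)%N) g j.+1).
  rewrite [RHS]big_mkcond; apply: eq_bigr => j _; rewrite /bump /= add1n; case: ifP =>
      // /negbT.
  rewrite -leqNgt => kj; rewrite /g big1 // => t.
  rewrite /is_composition sumn_rcons => /andP[_ /eqP E]; exfalso.
  by move: kj; rewrite -ltnS -E ltnNge leq_addl.
rewrite -(big_ord_widen _ (fun j => g j.+1)) //.
by apply: eq_bigr => j _; exact: gE.
Qed.

(** A composition of [k] has at most [k] parts, so the lengths below any [L > k] exhaust all
    compositions. The inequalities leave the slack that the recursion to smaller [k] requires. *)
Lemma comp_sum_lenE N L k f : (k <= N)%N -> (k < L)%N ->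
  \sum_(l < L) comp_sum_len N l k f = comp_sum k f.
Proof.
elim/ltn_ind: k L f => -[|k] IH [|L] f // kN kL.
  rewrite big_ord_recl big1 ?addr0 => [|l _].
    rewrite /comp_sum_len (big_pred1 [tuple]) => [|t]; last by rewrite !tuple0.
    by rewrite /= /Defs.coefN big_geq.
  rewrite /comp_sum_len big1 // => t /andP[t0 /eqP E].
  case/tupleP: t t0 E => i t /= /andP[i0 _] /eqP.
  by rewrite addn_eq0 => /andP[/eqP i0' _]; rewrite i0' in i0.
rewrite big_ord_recl {1}/comp_sum_len big1 ?add0r; last first.
  by move=> t; rewrite tuple0 /is_composition.
under eq_bigr => l _ do rewrite lift0 comp_sum_len_recr //.
rewrite exchange_big comp_sumS /=.
apply: eq_bigr => j _; rewrite sumrMnl IH //; first by rewrite ltnS leq_subr.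
  by rewrite (leq_trans (leq_subr _ _)) // ltnW.
by rewrite (leq_ltn_trans (leq_subr _ _)).
Qed.

End WeightedCompositions.

(** * Set partitions and their block sizes *)

Section Partitions.
Import mathcomp.boot.finset.
Context {V : nmodType} (k : nat).
Implicit Types (P : {set {set 'I_k}}) (A B D : {set 'I_k}).

Definition set_max A : nat := \max_(i in A) (i : nat).

Lemma set_max_mem A : A != finset.set0 -> exists2 i, i \in A & set_max A = i.
Proof.
rewrite -finset.card_gt0 => A0; have [i iA E] := eq_bigmax_cond (fun i : 'I_k => i : nat) A0.
by exists i.
Qed.

(** Both sides come from sorted lists of the same blocks, and a sorted list is determined by its
    entries once the order is antisymmetric on them. Comparing maxima is so on the blocks of a
    partition: they are nonempty and disjoint, hence have distinct maxima. *)
Lemma block_sizes_setU1 P B D : finset.partition P D -> finset.partition (B |: P)%SET (B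
    :|: D)%SET ->
  B \notin P -> (forall i, i \in (B :|: D)%SET -> (i <= set_max B)%N) ->
  block_sizes (B |: P)%SET = rcons (block_sizes P) #|B|.
Proof.
move=> pP pBP BP maxB; rewrite /block_sizes -map_rcons; congr map.
set leT := (fun A B : {set 'I_k} => _).
have leT_tr : transitive leT by move=> y x z; exact: leq_trans.
have leT_tot : total leT by move=> x y; exact: leq_total.
have /and3P[/eqP cU tr n0] := pBP.
have blk_mem A : A \in (B |: P)%SET -> exists2 i, i \in A & set_max A = i.
  by move=> AP; apply: set_max_mem; apply: contraNneq n0 => <-.
apply: (@sorted_eq_in _ leT).
- by move=> x y z _ _ _; exact: leT_tr.
- move=> A A'; rewrite !mem_sort !mem_enum => AP A'P /anti_leq E.
  have [i iA Ei] := blk_mem _ AP; have [i' iA' Ei'] := blk_mem _ A'P.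
  have ii' : i = i' by apply: ord_inj; rewrite -Ei -Ei'.
  apply/eqP; apply: contraTT isT => AA'.
  have /trivIsetP/(_ _ _ AP A'P AA') := tr; rewrite -finset.setI_eq0 => /eqP/setP/(_ i).
  by rewrite !inE iA ii' iA'.
- exact: sort_sorted.
- rewrite (sorted_pairwise leT_tr) pairwise_rcons -(sorted_pairwise leT_tr)
    sort_sorted // andbT.
  apply/allP => A; rewrite mem_sort mem_enum => AP.
  have AP' : A \in (B |: P)%SET by rewrite !inE AP orbT.
  have [i iA Ei] := blk_mem _ AP'.
  rewrite /leT -/(set_max A) -/(set_max B) Ei; apply: maxB.
  by rewrite -cU; apply/bigcupP; exists A.
apply: uniq_perm; first by rewrite sort_uniq enum_uniq.
  by rewrite rcons_uniq mem_sort mem_enum BP sort_uniq enum_uniq.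
by move=> A; rewrite mem_rcons !inE !mem_sort !mem_enum !inE.
Qed.

Lemma block_sizes0 : block_sizes (finset.set0 : {set {set 'I_k}}) = [::].
Proof. by rewrite /block_sizes enum_set0. Qed.

Lemma size_block_sizes P : size (block_sizes P) = #|P|.
Proof. by rewrite size_map size_sort -cardE. Qed.

Lemma sum_subsets_card D (h : nat -> V) (m : nat) : #|D| = m ->
  \sum_(A : {set 'I_k} | A \subset D) h #|A| = \sum_(j < m.+1) h j *+ 'C(m, j).
Proof.
move=> Dm.
rewrite (partition_big (fun A : {set 'I_k} => inord #|A| : 'I_m.+1) xpredT) //=.
apply: eq_bigr => j _; have -> : 'C(m, j) = 'C(#|D|, j) by rewrite Dm.
rewrite -cards_draws -sumr_const.
have cA A : A \subset D -> (inord #|A| == j :> 'I_m.+1) = (#|A| == j :> nat).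
  move=> AD; have Am : (#|A| < m.+1)%N by rewrite ltnS -Dm subset_leq_card.
  by rewrite -val_eqE /= inordK.
apply: eq_big => [A|A /andP[AD]]; last by rewrite cA // => /eqP ->.
by rewrite !inE; case AD : (A \subset D) => //=; exact: cA.
Qed.

(* Induction on D: the last block is the one that contains the maximum of D. *)
Lemma sum_partitions D (f : seq nat -> V) :
  \sum_(P : {set {set 'I_k}} | finset.partition P D) f (block_sizes P) = comp_sum #|D| f.
Proof.
move En : #|D| => n; elim/ltn_ind: n D f En => -[|n] IH D f Dn.
  have -> : D = finset.set0 by exact: cards0_eq.
  rewrite (big_pred1 finset.set0) ?block_sizes0 // => P.
  by rewrite partition_set0.
have [x0 x0D] : exists x, x \in D by apply/finset.set0Pn; rewrite -finset.card_gt0 Dn.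
pose mx := [arg max_(i > x0 | i \in D) (i : nat)].
have [mxD mxP] : mx \in D /\ forall i, i \in D -> (i <= mx)%N.
  by rewrite /mx; case: arg_maxnP.
rewrite (partition_big (fun P => pblock P mx) (fun B => (mx \in B) && (B \subset D))) /=;
    last first.
  move=> P pP; have cP := cover_partition pP; rewrite mem_pblock cP mxD /=.
  by apply: (partitionS pP); apply: pblock_mem; rewrite cP.
have inner B : (mx \in B) && (B \subset D) ->
    \sum_(P : {set {set 'I_k}} | finset.partition P D && (pblock P mx == B))
        f (block_sizes P) =
    comp_sum (n.+1 - #|B|) (fun s => f (rcons s #|B|)).
  move=> /andP[mxB BD].
  have B0 : B != finset.set0 by apply/finset.set0Pn; exists mx.
  have DB : #|(D :\: B)%SET| = (n.+1 - #|B|)%N by rewrite cardsD (finset.setIidPr BD) Dn.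
  have DBlt : (n.+1 - #|B| < n.+1)%N by rewrite ltn_subrL /= finset.card_gt0 B0.
  rewrite -(IH _ DBlt (D :\: B)%SET) //.
  have BDB : (B :|: D :\: B)%SET = D by rewrite setDE finset.setUIr finset.setUCr
      finset.setIT; apply/finset.setUidPr.
  have dB : fintype.disjoint (mem B) (mem (D :\: B)%SET).
    by rewrite -setI_eq0; apply/eqP/setP => x; rewrite !inE; case: (x \in B).
  have BDP P : finset.partition P (D :\: B)%SET -> B \notin P.
    move=> pP; apply/negP => BP; have := partitionS pP BP.
    by move=> /fintype.subsetP/(_ _ mxB); rewrite inE mxB.
  have UP P : finset.partition (B |: P)%SET D -> (B |: P)%SET :\ B = P -> finset.partition
      P (D :\: B)%SET.
    by move=> pP <-; apply: partitionD1 => //; rewrite setU11.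
  rewrite (reindex_onto (fun P => (B |: P)%SET) (fun P => (P :\ B)%SET)) /=; last first.
    move=> P /andP[/and3P[/eqP cP tP nP] /eqP pB]; apply: setD1K.
    by rewrite -pB; apply: pblock_mem; rewrite cP.
  apply: eq_big => [P|P].
    apply/idP/idP; first by move=> /andP[/andP[pP _] /eqP]; exact: UP.
    move=> pP; have pBP := partitionU1 pP B0 dB; rewrite BDB in pBP; rewrite pBP /=.
    rewrite (def_pblock (partition_trivIset pBP) (setU11 B P) mxB) eqxx /=.
    by rewrite setU1K ?eqxx // BDP.
  move=> /andP[/andP[pP _] /eqP E]; have pP' := UP _ pP E.
  rewrite (block_sizes_setU1 pP') ?BDB ?BDP // => i iD.
  apply: leq_trans (mxP _ iD) _; rewrite /set_max.
  exact: (@leq_bigmax_cond _ (mem B) (fun i : 'I_k => i : nat) mx mxB).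
rewrite (eq_bigr _ inner) comp_sumS.
(* The possible last blocks are [mx |: A] with [A] among the remaining n elements. Size j + 1 thus
   occurs 'C(n, j) times, which is the coefficient in [comp_sumS]. *)
have Dmx : #|(D :\ mx)%SET| = n.
  by apply/eqP; rewrite -eqSS -Dn (cardsD1 mx D) mxD.
pose h c := comp_sum (n.+1 - c) (fun s => f (rcons s c)).
transitivity (\sum_(A : {set 'I_k} | A \subset (D :\ mx)%SET) h #|A|.+1); last first.
  by rewrite (sum_subsets_card (fun j => h j.+1) Dmx); apply: eq_bigr => j _; rewrite /h subSS.
rewrite (reindex_onto (fun A => (mx |: A)%SET) (fun B => (B :\ mx)%SET)) /=; last first.
  by move=> B /andP[mxB _]; exact: setD1K.
apply: eq_big => [A|A].
  rewrite setU11 /= subUset sub1set mxD /= subsetD1.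
  case mxA : (mx \in A); last by rewrite setU1K ?mxA // eqxx.
  rewrite !andbF; apply/negP => /andP[_ /eqP E].
  by move: mxA; rewrite -E !inE eqxx.
move=> /andP[_ /eqP E]; rewrite -/(h _); congr h.
by rewrite cardsU1 -{1}E !inE eqxx.
Qed.

Lemma sum_partitions_neq_setT (f : seq nat -> V) : (0 < k)%N ->
  comp_sum k f = f [:: k] +
  \sum_(P : {set {set 'I_k}} | partition P [set: 'I_k]%SET && (P != [set [set: 'I_k]]%SET))
     f (block_sizes P).
Proof.
move=> k0; have cT : #|[set: 'I_k]%SET| = k by rewrite cardsT card_ord.
have pT : partition [set [set: 'I_k]]%SET [set: 'I_k]%SET.
  apply/and3P; split; first by rewrite cover1.
    exact: trivIset1.
  by rewrite inE eq_sym -card_gt0 cT.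
rewrite -{1}cT -sum_partitions (bigD1 [set [set: 'I_k]]%SET pT) /=; congr (f _ + _).
by rewrite /block_sizes enum_set1 /= cT.
Qed.

Lemma sum_compositions_neq1 (f : seq nat -> V) : (0 < k)%N ->
  comp_sum k f = f [:: k] +
  \sum_(2 <= l < k.+1) comp_sum_len k l k f.
Proof.
move=> k0; rewrite -(@comp_sum_lenE _ k k.+1) // -(big_mkord xpredT (fun l =>
    comp_sum_len k l k f)).
rewrite big_ltn // big_ltn // addrA; congr (_ + _).
rewrite {1}/comp_sum_len big1 ?add0r; last first.
  move=> t; rewrite tuple0 /is_composition /= => /eqP E.
  by rewrite -E in k0.
rewrite /comp_sum_len (big_pred1 [tuple ord_max]).
  by rewrite /= /Defs.coefN big_geq.
move=> t; case/tupleP: t => i t; rewrite (tuple0 t) /is_composition /= addn0 andbT.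
rewrite -val_eqE /= eqseq_cons andbT -val_eqE /=.
by case: eqP => [->|_]; rewrite ?k0 ?andbF.
Qed.

End Partitions.

(** * Jets of curves *)

Section AdWords.
Context {V : nmodType}.
Variables (br : V -> V -> V) (A : V -> V).
Implicit Types (x y : nat -> V) (s : seq nat).

Definition br_word x v s : V := foldl (fun z i => br (x i) z) v s.

(** This is [ad_term] with the bracket and Ad_g as parameters. The last index of [s] selects the
    innermost vector; the others are applied from left to right, the first one innermost. *)
Definition ad_word x y s : V := br_word x (A (y (last 0%N s))) (take (size s).-1 s).

(** The component of index [i] of a product of jets. Unlike in the cocycle, the one-letter word
    [A (y i)] is included in the sum. *)
Definition ad_row x y i : V := x i + comp_sum i (ad_word x y).

Lemma br_word_rcons x v s i : br_word x v (rcons s i) = br (x i) (br_word x v s).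
Proof. by rewrite /br_word foldl_rcons. Qed.

Lemma ad_word_rcons x y s i : ad_word x y (rcons s i) = br_word x (A (y i)) s.
Proof. by rewrite /ad_word last_rcons size_rcons /= -cats1 take_size_cat. Qed.

Lemma eq_ad_word x x' y y' s : s != [::] ->
  (forall i, i \in s -> x i = x' i /\ y i = y' i) -> ad_word x y s = ad_word x' y' s.
Proof.
case/lastP: s => // s i _ h; rewrite !ad_word_rcons.
have [_ ->] : x i = x' i /\ y i = y' i by apply: h; rewrite mem_rcons mem_head.
move: (A _) => v; have {}h j : j \in s -> x j = x' j.
  by move=> js; case: (h j) => //; rewrite mem_rcons inE js orbT.
elim: s v h => //= j s IH v h; rewrite /br_word /= -!/(br_word _ _ _)
    h ?mem_head // IH // => j' js.
by apply: h; rewrite inE js orbT.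
Qed.

Lemma composition_mem m s i : is_composition m s -> i \in s -> (0 < i <= m)%N.
Proof.
move=> /andP[/allP s0 /eqP <-] si; rewrite s0 //=.
elim: s si {s0} => //= j s IH; rewrite inE => /orP[/eqP ->|/IH]; first exact: leq_addr.
by move=> /leq_trans; apply; exact: leq_addl.
Qed.

Lemma eq_ad_row x x' y y' m : (0 < m)%N ->
  (forall i, (0 < i <= m)%N -> x i = x' i /\ y i = y' i) -> ad_row x y m = ad_row x' y' m.
Proof.
move=> m0 h; rewrite /ad_row (h m _).1 ?m0 ?leqnn //; congr (_ + _).
apply: eq_comp_sum => s sm; apply: eq_ad_word => [|i si].
  by apply: contraTneq sm => ->; rewrite /is_composition /= eq_sym -lt0n m0.
by apply: h; exact: composition_mem si.
Qed.

End AdWords.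

(** * Higher derivatives of curves of operators *)

Section OperatorCurves.
Context {R : realType} {E F : normedModType R} {hE : fin_dim E} {hF : fin_dim F}.

(** The Leibniz rule for the equation a' = [x, a] gives the derivative of order m + 1 as a sum over
    j of 'C(m, j) times the derivative of [x] of order j bracketed with that of [a] of order m - j.
    The new outermost letter j + 1 is the last part of a composition of m + 1, as in [comp_sumS].
    The shift [i.-1] is there because x_i is a derivative of order i - 1. *)
Lemma derive1n_linear_ode (br : E -> E -> E) (x a : R^o -> E) m : bilinear_map br ->
  smooth_near x 0 -> smooth_near a 0 ->
  (\forall t \near (0 : R^o), derive1 a t = br (x t) (a t)) ->
  derive1n m a 0 = comp_sum m (br_word br (fun i => derive1n i.-1 x 0) (a 0)).
Proof.
move=> bb sx sa da; elim/ltn_ind: m => -[//|m] IH.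
rewrite derive1Sn (derive1n_near_eq _ da) (derive1n_bilinear _ bb sx sa) comp_sumS.
apply: eq_bigr => j _; congr (_ *+ _); rewrite IH; last by rewrite ltnS leq_subr.
have lx := bb.2 (derive1n j x 0).
rewrite (comp_sum_additive (l := br _)); last 2 first.
- exact: linear_zero lx.
- by move=> u v; exact: linear_add lx.
by apply: eq_comp_sum => s _; rewrite br_word_rcons.
Qed.

Lemma scale_bilinear : bilinear_map ( *:%R : R^o -> F -> F).
Proof.
split=> [y a u v|x a u v]; first by rewrite scalerDl -scalerA.
by rewrite scalerDr !scalerA mulrC.
Qed.

(** In coordinates of [w] this is the Leibniz rule for scalar functions times the curves
    [A t (ei i)]; reassembling the coordinates leaves operators differentiated on fixed vectors
    only. *)
Lemma derive1n_operator (A : R^o -> E -> F) (w : R^o -> E) m :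
  (forall t, linear (A t)) -> (forall v, smooth_near (fun t => A t v) 0) ->
  smooth_near w 0 ->
  derive1n m (fun t => A t (w t)) 0 =
  \sum_(j < m.+1) derive1n (m - j) (fun t => A t (derive1n j w 0)) 0 *+ 'C(m, j).
Proof.
move=> lA sA sw; have [I [ei [l [hl he]]]] := hE.
have sl i : smooth_near (fun t : R^o => l i (w t)) 0 by exact: smooth_near_lin (hl i).1 sw.
have AE p : (fun t : R^o => A t (p t)) = fun t => \sum_i l i (p t) *: A t (ei i).
  apply/funext => t; rewrite [in LHS](he (p t)) (linear_sumE _ _ _ (lA t)).
  by apply: eq_bigr => i _; rewrite (linear_scale _ _ (lA t)).
rewrite AE derive1n_sum => [|i _]; last exact: smooth_near_scale (sl i) (sA (ei i)).
under eq_bigr => i _ do rewrite (derive1n_bilinear _ scale_bilinear (sl i) (sA (ei i))).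
rewrite exchange_big; apply: eq_bigr => j _ /=.
rewrite (AE (fun=> _)) derive1n_sum => [|i _]; last first.
  exact: smooth_near_scale (smooth_near_cst _ _) (sA (ei i)).
rewrite -sumrMnl; apply: eq_bigr => i _; congr (_ *+ _).
rewrite (derive1n_lin _ (hl i).1 sw).
have ls : linear (fun v : F => l i (derive1n j w 0) *: v).
  by move=> a u v; rewrite scalerDr !scalerA mulrC.
exact: esym (derive1n_lin (m - j) ls (sA (ei i))).
Qed.

End OperatorCurves.

(* Leibniz for t |-> x t + A t (y t), where the derivatives of A are words in ad because
   A' = ad_x A. *)
Lemma derive1n_ad_row (R : realType) (E : normedModType R)
    {hE : fin_dim E} (br : E -> E -> E) (A : R^o -> E -> E) (x y : R^o -> E) i :
  bilinear_map br -> (forall t, linear (A t)) ->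
  (forall v, smooth_near (fun t => A t v) 0) ->
  (forall v, \forall t \near (0 : R^o), derive1 (fun s => A s v) t = br (x t) (A t v)) ->
  smooth_near x 0 -> smooth_near y 0 -> smooth_near (fun t => A t (y t)) 0 ->
  derive1n i (fun t => x t + A t (y t)) 0 =
  ad_row br (A 0) (fun i => derive1n i.-1 x 0) (fun i => derive1n i.-1 y 0) i.+1.
Proof.
move=> bb lA sA dA sx sy sAy; rewrite (derive1n_add i sx sAy).
congr (_ + _); rewrite (derive1n_operator i lA sA sy) comp_sumS.
apply: eq_bigr => j _; congr (_ *+ _).
rewrite (derive1n_linear_ode _ bb sx (sA _) (dA _)).
by apply: eq_comp_sum => s _; rewrite ad_word_rcons.
Qed.

(* Used with C the curves under the pointwise product, S the smooth ones and r
   the right trivialization. *)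
Lemma transported_group (C J : Type) (S : C -> Prop) (r : C -> J)
    (mC : C -> C -> C) (eC : C) (mJ : J -> J -> J) (eJ : J) (iJ : J -> J) :
  (forall p, exists2 c, S c & p = r c) ->
  (forall c b, S c -> S b -> S (mC c b)) ->
  (forall c b, S c -> S b -> mJ (r c) (r b) = r (mC c b)) ->
  associative mC -> left_id eC mC -> right_id eC mC -> S eC -> eJ = r eC ->
  (forall p, exists c c', [/\ S c, S c', p = r c, iJ p = r c' & mC c c' = eC /\ mC c' c =
      eC]) ->
  [/\ associative mJ, left_id eJ mJ, right_id eJ mJ, left_inverse eJ iJ mJ &
      right_inverse eJ iJ mJ].
Proof.
move=> rP Sm rm mA m1 mr1 Se -> iP; split.
- move=> p q s; have [c Sc ->] := rP p; have [b Sb ->] := rP q; have [d Sd ->] := rP s.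
  by rewrite !rm ?mA //; exact: Sm.
- by move=> p; have [c Sc ->] := rP p; rewrite rm ?m1.
- by move=> p; have [c Sc ->] := rP p; rewrite rm ?mr1.
- by move=> p; have [c [c' [Sc Sc' -> -> [_ E]]]] := iP p; rewrite rm ?E.
by move=> p; have [c [c' [Sc Sc' -> -> [E _]]]] := iP p; rewrite rm ?E.
Qed.

(** * Jets, right logarithmic derivatives and the product of jets *)

Section Jets.
Context {R : realType} {n : nat}.
Variables (G : lie_data 'rV[R]_n) (hG : is_lie_group G).
Local Notation E := 'rV[R]_n.
Local Notation e := (lg_one G).
Local Notation phi := (chart_map (chart_at G (lg_one G))).
Local Notation psi := (chart_inv (chart_at G (lg_one G))).
Local Notation z0 := (chart_map (chart_at G (lg_one G)) (lg_one G)).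
Local Notation hM := (lie_manifold hG).

Local Opaque Ad derive derive1 lie_bracket derive1n smooth_at smooth_near comp_sum.

(* [rdiv_chart] and [rmul_chart] are (h, h') |-> h h'^-1 and (w, h) |-> w h read in
   the charts around the identity and around [g]; their derivatives convert between
   the velocity of a curve in the chart around [g] and its right logarithmic
   derivative. *)
Definition rdiv_chart (g : G) (p : E * E) : E :=
  phi (lg_mul (chart_inv (chart_at G g) p.1) (lg_inv (chart_inv (chart_at G g) p.2))).

Definition rmul_chart (g : G) (p : E * E) : E :=
  chart_map (chart_at G g) (lg_mul (psi p.1) (chart_inv (chart_at G g) p.2)).

Definition rdiv_dir g (p : E * E) : E := 'D_((p.2, 0) : E * E) (rdiv_chart g) (p.1, p.1).

Definition rmul_dir g (p : E * E) : E := 'D_((p.2, 0) : E * E) (rmul_chart g) (z0, p.1).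

Lemma chart_img_self (g : G) : chart_img (chart_at G g) (chart_map (chart_at G g) g).
Proof. exact: chart_img_map (is_chart_self hM g). Qed.

Lemma smooth_near_rdiv_chart g p : chart_img (chart_at G g) p ->
  smooth_near (rdiv_chart g) (p, p).
Proof.
move=> gp; have sp : smooth_into (chart_inv (chart_at G g))
    p by exact: (smooth_into_inv hM gp).
apply: (smooth_near_phi hG); last by rewrite /= (lg_mulgV hG).
apply: (smooth_into_mul hG).
  by apply: (smooth_into_comp hM (g := fst)) => //; exact: smooth_near_linear.
apply: (smooth_into_lg_inv hG).
by apply: (smooth_into_comp hM (g := snd)) => //; exact: smooth_near_linear.
Qed.

Lemma smooth_near_rmul_chart g p : chart_img (chart_at G g) p ->
  smooth_near (rmul_chart g) (z0, p).
Proof.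
move=> gp; have sp : smooth_into (chart_inv (chart_at G g))
    p by exact: (smooth_into_inv hM gp).
have s : smooth_into (fun p : E * E => lg_mul (psi p.1) (chart_inv (chart_at G g) p.2))
    (z0, p).
  apply: (smooth_into_mul hG).
    by apply: (smooth_into_psi0 hG) => //; exact: smooth_near_linear.
  by apply: (smooth_into_comp hM (g := snd)) => //; exact: smooth_near_linear.
apply: (smooth_into_chart hM s).
by rewrite /= (lg_psi0 hG) (lg_mul1g hG); exact: chart_dom_inv hM _ _ gp.
Qed.

Lemma smooth_near_rdiv_dir g v :
  smooth_near (rdiv_dir g) (chart_map (chart_at G g) g, v).
Proof.
have s1 : smooth_near (fst : E * E -> E) (chart_map (chart_at G g) g, v)
    by exact: smooth_near_linear.
have s2 : smooth_near (snd : E * E -> E) (chart_map (chart_at G g) g, v)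
    by exact: smooth_near_linear.
apply: (smooth_near_dir (p := fun q : E * E => (q.1, q.1)) (v := fun q : E * E => (q.2, 0))).
- exact: smooth_near_rdiv_chart (chart_img_self g).
- exact: smooth_near_pair.
- by apply: smooth_near_pair => //; exact: smooth_near_cst.
Qed.

Lemma smooth_near_rmul_dir g v :
  smooth_near (rmul_dir g) (chart_map (chart_at G g) g, v).
Proof.
have s1 : smooth_near (fst : E * E -> E) (chart_map (chart_at G g) g, v)
    by exact: smooth_near_linear.
have s2 : smooth_near (snd : E * E -> E) (chart_map (chart_at G g) g, v)
    by exact: smooth_near_linear.
apply: (smooth_near_dir (p := fun q : E * E => (z0, q.1)) (v := fun q : E * E => (q.2, 0))).
- exact: smooth_near_rmul_chart (chart_img_self g).
- by apply: smooth_near_pair => //; exact: smooth_near_cst.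
- by apply: smooth_near_pair => //; exact: smooth_near_cst.
Qed.

(** Derivative of (w h) h^-1 = w in w at the identity, with h fixed and read in the chart around
    [g]. *)
Lemma rdiv_dirK g : \forall p \near chart_map (chart_at G g) g,
  forall X, rdiv_dir g (p, rmul_dir g (p, X)) = X.
Proof.
apply: filterS (near_chart_img hM (is_chart_self hM g)) => p gp X.
have sm := smooth_near_rmul_chart gp; have sd := smooth_near_rdiv_chart gp.
have sl : smooth_near (fun z : E => (z, p)) z0.
  by apply: smooth_near_pair; [exact: smooth_near_id|exact: smooth_near_cst].
have sf : smooth_near (fun z => rmul_chart g (z, p)) z0.
  exact: (@smooth_near_comp _ _ _ _ _ (fun z : E => (z, p)) (rmul_chart g)).
have f0 : rmul_chart g (z0, p) = p.
  by rewrite /rmul_chart /= (lg_psi0 hG) (lg_mul1g hG) (chart_invK hM).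
have H : \forall z \near z0, rdiv_chart g (rmul_chart g (z, p), p) = z.
  have s : smooth_into (fun z => lg_mul (psi z) (chart_inv (chart_at G g) p)) z0.
    apply: (smooth_into_mul hG); last exact: smooth_into_cst.
    by apply: (smooth_into_psi0 hG) => //; exact: smooth_near_id.
  have d0 : chart_dom (chart_at G g) (lg_mul (psi z0) (chart_inv (chart_at G g) p)).
    by rewrite (lg_psi0 hG) (lg_mul1g hG); exact: chart_dom_inv hM _ _ gp.
  move: (smooth_into_near_dom hM s d0) (near_phi_psi hG); apply: filterS2 => z dz Ez.
  by rewrite /rdiv_chart /rmul_chart /= (chart_mapK hM) // (lg_mulgK hG).
rewrite -[RHS](derive_id z0 X) -(near_eq_derive _ H).
rewrite (derive_comp_fst X f0 (smooth_near_differentiable sf) (smooth_near_differentiable sd)).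
by rewrite derive_slice1.
Qed.

Section Curve.
Variables (c : R^o -> G) (sc : smooth_into c 0).
Local Notation u := (fun t : R^o => chart_map (chart_at G (c 0)) (c t)).

Lemma smooth_near_curve_chart : smooth_near u 0.
Proof. exact: smooth_into_self sc. Qed.

Lemma near_curve : \forall t \near (0 : R^o),
  smooth_into c t /\ chart_dom (chart_at G (c 0)) (c t).
Proof.
apply: filterI; first exact: (smooth_into_near hM sc).
exact: (smooth_into_near_dom hM sc (is_chart_self hM (c 0))).
Qed.

Lemma near_curve_inv (t : R^o) : smooth_into c t -> chart_dom (chart_at G (c 0)) (c t) ->
  \forall s \near t, chart_inv (chart_at G (c 0)) (u s) = c s.
Proof.
move=> st dt; apply: filterS (smooth_into_near_dom hM st dt) => s.
exact: (chart_mapK hM).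
Qed.

Lemma rlogder_chart : \forall t \near (0 : R^o),
  rlogder c t = rdiv_dir (c 0) (u t, derive1 u t).
Proof.
apply: filterS near_curve => t [st dt].
have su : smooth_near u t by exact: (smooth_into_chart hM st dt).
have sd := smooth_near_rdiv_chart (chart_img_map dt).
rewrite /rlogder (@derive1_near_eq _ _ _ (fun s => rdiv_chart (c 0) (u s, u t))); last first.
  apply: filterS (near_curve_inv st dt) => s cs.
  by rewrite /rdiv_chart /= cs (chart_mapK hM).
exact: (derive1_comp_fst erefl (smooth_near_differentiable su)
    (smooth_near_differentiable sd)).
Qed.

Lemma smooth_near_rlogder : smooth_near (rlogder c : R^o -> E) 0.
Proof.
have su := smooth_near_curve_chart.
apply: (@smooth_near_ext _ _ _ (fun t : R^o => rdiv_dir (c 0) (u t, derive1 u t))).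
  by apply: filterS rlogder_chart => t ->.
apply: (smooth_near_comp (g := fun t : R^o => (u t, derive1 u t))).
  by apply: smooth_near_pair => //; exact: smooth_near_derive1.
exact: smooth_near_rdiv_dir.
Qed.

(** Derivative at s = t of c(s) = (c(s) c(t)^-1) c(t), read in charts: the equation c' = x c in
    coordinates. *)
Lemma velocity_chart : \forall t \near (0 : R^o),
  derive1 u t = rmul_dir (c 0) (u t, rlogder c t).
Proof.
apply: filterS near_curve => t [st dt].
have sm := smooth_near_rmul_chart (chart_img_map dt).
have sw : smooth_into (fun s => lg_mul (c s) (lg_inv (c t))) t.
  by apply: (smooth_into_mul hG) => //; exact: smooth_into_cst.
have w0 : lg_mul (c t) (lg_inv (c t)) = e by rewrite (lg_mulgV hG).
rewrite (@derive1_near_eq _ _ _ (fun s => rmul_chart (c 0)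
    (phi (lg_mul (c s) (lg_inv (c t))), u t))); last first.
  apply: filterS (near_psi_phi hG sw w0) => s Es.
  by rewrite /rmul_chart /= Es (chart_mapK hM) // (lg_mulgKV hG).
have sz : smooth_near (fun s => phi (lg_mul (c s) (lg_inv (c t)))) t by exact: smooth_near_phi.
have zt : phi (lg_mul (c t) (lg_inv (c t))) = z0 by rewrite w0.
exact: (derive1_comp_fst zt (smooth_near_differentiable sz) (smooth_near_differentiable sm)).
Qed.

End Curve.

Lemma jet_agree_near (F : normedModType R) m (p q p' q' : R^o -> F) :
  (\forall t \near (0 : R^o), p t = p' t) -> (\forall t \near (0 : R^o), q t = q' t) ->
  jet_agree m p' q' -> jet_agree m p q.
Proof.
by move=> pp qq h i im; rewrite (derive1n_near_eq _ pp) (derive1n_near_eq _ qq) h.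
Qed.

Lemma jet_agree_pair (F F' : normedModType R) m (p q : R^o -> F) (p' q' : R^o -> F') :
  smooth_near p 0 -> smooth_near q 0 -> smooth_near p' 0 -> smooth_near q' 0 ->
  jet_agree m p q -> jet_agree m p' q' ->
  jet_agree m (fun t => (p t, p' t)) (fun t => (q t, q' t)).
Proof. by move=> sp sq sp' sq' a b i im; rewrite !derive1n_pair // a // b. Qed.

Lemma jet_agree0 (F : normedModType R) (p q : R^o -> F) : jet_agree 0 p q.
Proof. by []. Qed.

Lemma jet_agreeS (F : normedModType R) m (p q : R^o -> F) : p 0 = q 0 ->
  jet_agree m (derive1 p) (derive1 q) -> jet_agree m.+1 p q.
Proof. by move=> pq h [_|i im]; [exact: pq|rewrite !derive1Sn h]. Qed.

Lemma jet_agree_le (F : normedModType R) m m' (p q : R^o -> F) : (m <= m')%N ->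
  jet_agree m' p q -> jet_agree m p q.
Proof. by move=> mm h i im; apply: h; exact: leq_trans mm. Qed.

Lemma jet_agree_derive1 (F : normedModType R) m (p q : R^o -> F) :
  jet_agree m.+1 p q -> jet_agree m (derive1 p) (derive1 q).
Proof. by move=> h i im; rewrite -!derive1Sn h. Qed.

Lemma same_jet_agree k (c b : R^o -> G) : same_jet k c b <-> c 0 = b 0 /\
  jet_agree k.+1 (fun t => chart_map (chart_at G (c 0)) (c t))
    (fun t => chart_map (chart_at G (c 0)) (b t)).
Proof.
split=> [[cb h]|[cb h]]; split; first exact: cb.
- move=> [_|i ik]; last exact: (h i.+1).
  exact: (congr1 (chart_map (chart_at G (c 0))) cb).
- exact: cb.
by move=> i /andP[_ ik]; apply: h; rewrite ltnS.
Qed.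

(** By [rlogder_chart] the logarithmic derivative is a smooth function of u and u', so it loses one
    order. Conversely [velocity_chart] is a differential equation for u, which recovers its
    derivatives order by order from u(0) and those of the logarithmic derivative. *)
Lemma same_jet_rlogder k (c b : R^o -> G) : smooth_into c 0 -> smooth_into b 0 ->
  same_jet k c b <-> c 0 = b 0 /\ jet_agree k (rlogder c) (rlogder b).
Proof.
move=> sc sb; apply: (iff_trans (same_jet_agree k c b)).
suff H : c 0 = b 0 -> jet_agree k.+1 (fun t => chart_map (chart_at G (c 0)) (c t))
    (fun t => chart_map (chart_at G (c 0)) (b t)) <->
    jet_agree k (rlogder c) (rlogder b).
  by split=> -[cb h]; (split; first exact: cb); apply/(H cb).
move=> cb.
have su := smooth_near_curve_chart sc; have sv := smooth_near_curve_chart sb.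
have ru := rlogder_chart sc; have rv := rlogder_chart sb.
have vu := velocity_chart sc; have vv := velocity_chart sb.
rewrite -cb in sv rv vv.
have sx := smooth_near_rlogder sc; have sy := smooth_near_rlogder sb.
have sd := smooth_near_rdiv_dir (c 0); have sm := smooth_near_rmul_dir (c 0).
have uv0 := congr1 (chart_map (chart_at G (c 0))) cb.
move: su sv ru rv vu vv sx sy sd sm uv0.
set u := (X in smooth_near X 0 -> _); set v := (X in _ -> smooth_near X 0 -> _).
move: (rlogder c) (rlogder b) (rdiv_dir (c 0)) (rmul_dir (c 0)) => x y f g.
rewrite -/(u 0) -/(v 0) => su sv ru rv vu vv sx sy sf sg uv0; split=> h.
  have su' := smooth_near_derive1 su; have sv' := smooth_near_derive1 sv.
  apply: (jet_agree_near ru rv).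
  apply: (jet_agree_comp (smooth_near_pair su su') (smooth_near_pair sv sv') (sf _)).
  apply: (jet_agree_pair su sv su' sv'); last exact: jet_agree_derive1.
  exact: jet_agree_le (leqnSn k) h.
(* Agreement of [u] and [v] up to order [m] passes to the right-hand sides of the equation, hence to
   the velocities, and this is one order more. *)
suff K m : (m <= k)%N -> jet_agree m.+1 u v by exact: K.
elim: m => [|m IH] mk.
  exact: (jet_agreeS uv0 (jet_agree0 _ _)).
apply: (jet_agreeS uv0); apply: (jet_agree_near vu vv).
apply: (jet_agree_comp (smooth_near_pair su sx) (smooth_near_pair sv sy) (sg _)).
apply: (jet_agree_pair su sv sx sy); first exact: IH (ltnW mk).
exact: jet_agree_le mk h.
Qed.

Lemma pair_rows_eq (T : Type) k (g g' : T) (f f' : nat -> E) :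
  (g, \matrix_(i < k) f i) = (g', \matrix_(i < k) f' i) <->
  g = g' /\ forall i, (i < k)%N -> f i = f' i.
Proof.
split=> [[-> /row_matrixP h]|[-> h]].
  by split=> // i ik; have := h (Ordinal ik); rewrite !rowK.
by congr (_, _); apply/row_matrixP => i; rewrite !rowK h.
Qed.

Lemma rtriv_curve_eq k (c b : R^o -> G) :
  rtriv_curve k c = rtriv_curve k b <-> c 0 = b 0 /\ jet_agree k (rlogder c) (rlogder b).
Proof.
exact: (pair_rows_eq k (c 0) (b 0) (fun i => derive1n i (rlogder c) 0)
  (fun i => derive1n i (rlogder b) 0)).
Qed.

Lemma same_jet_rtriv k (c b : R^o -> G) : smooth_into c 0 -> smooth_into b 0 ->
  same_jet k c b <-> rtriv_curve k c = rtriv_curve k b.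
Proof.
move=> sc sb; apply: (iff_trans (same_jet_rlogder k sc sb)).
exact: iff_sym (rtriv_curve_eq k c b).
Qed.

(** [y] is a polynomial curve with the prescribed derivatives, and [u] solves u' = [rmul_dir g] (u,
    y) up to order [k]. The logarithmic derivative [rdiv_dir g] (u, u') then agrees to this order
    with [rdiv_dir g] (u, [rmul_dir g] (u, y)), which is y by [rdiv_dirK]. *)
Lemma rtriv_curve_surj k (g : G) (M : 'M[R]_(k, n)) :
  exists2 c : R^o -> G, smooth_into c 0 & rtriv_curve k c = (g, M).
Proof.
pose y (t : R^o) : E := \sum_(i < k) monomial_curve i (row i M) t.
have sy : smooth_near y 0 by apply: smooth_near_sum => i _; exact: smooth_near_monomial_curve.
have [u [su u0 ua]] := jet_ode_solution k (smooth_near_rmul_dir g (y 0)) sy.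
pose c t := chart_inv (chart_at G g) (u t).
have sc : smooth_into c 0.
  by apply: (smooth_into_comp hM su); rewrite u0;
      exact: smooth_into_inv hM _ _ (chart_img_self g).
have c0 : c 0 = g by rewrite /c u0 (chart_mapK hM) //; exact: is_chart_self hM g.
have uE : \forall t \near (0 : R^o), chart_map (chart_at G (c 0)) (c t) = u t.
  have := near_continuous (smooth_near_continuous su); rewrite u0.
  move=> /(_ _ (near_chart_img hM (is_chart_self hM g))).
  by apply: filterS => t gt; rewrite c0 /c (chart_invK hM).
exists c => //.
suff H : jet_agree k (rlogder c) y.
  congr (_, _) => //; apply/row_matrixP => i; rewrite rowK H //.
  rewrite derive1n_sum => [|j _]; last exact: smooth_near_monomial_curve.
  rewrite (bigD1 i) //= derive1n_monomial_curve eqxx big1 ?addr0 // => j ji.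
  rewrite derive1n_monomial_curve ifF //; apply/negbTE.
  by rewrite eq_sym.
have rE : \forall t \near (0 : R^o), rlogder c t = rdiv_dir g (u t, derive1 u t).
  move: (rlogder_chart sc) uE (near_derive1 uE); apply: filterS3 => t -> -> ->.
  by rewrite c0.
have yE : \forall t \near (0 : R^o), y t = rdiv_dir g (u t, rmul_dir g (u t, y t)).
  have := near_continuous (smooth_near_continuous su); rewrite u0.
  by move=> /(_ _ (rdiv_dirK g)); apply: filterS => t ->.
have sr : smooth_near (fun t : R^o => rmul_dir g (u t, y t)) 0.
  apply: (smooth_near_comp (g := fun t : R^o => (u t, y t))); first exact: smooth_near_pair.
  by rewrite u0; exact: smooth_near_rmul_dir.
have su' := smooth_near_derive1 su.
apply: (jet_agree_near rE yE).
apply: (@jet_agree_comp _ _ _ _ (rdiv_dir g) k (fun t : R^o => (u t, derive1 u t))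
   (fun t : R^o => (u t, rmul_dir g (u t, y t)))).
- exact: smooth_near_pair.
- exact: smooth_near_pair.
- by rewrite u0; exact: smooth_near_rdiv_dir.
- exact: jet_agree_pair.
Qed.

(** The translate c(s) b(s) (c(t) b(t))^-1 factors as c(s) c(t)^-1 times the conjugate of b(s)
    b(t)^-1 by c(t). Both factors are the identity at s = t, so their velocities add. *)
Lemma rlogder_mul (c b : R^o -> G) : smooth_into c 0 -> smooth_into b 0 ->
  \forall t \near (0 : R^o),
    rlogder (curve_mul c b) t = rlogder c t + Ad (c t) (rlogder b t).
Proof.
move=> sc sb.
have nc : \forall t \near (0 : R^o), smooth_into c t by exact: (smooth_into_near hM sc).
have nb : \forall t \near (0 : R^o), smooth_into b t by exact: (smooth_into_near hM sb).
move: nc nb; apply: filterS2 => t st sbt.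
have s1 : smooth_into (fun s => lg_mul (c s) (lg_inv (c t))) t.
  by apply: (smooth_into_mul hG) => //; exact: smooth_into_cst.
have s2 : smooth_into (fun s => lg_mul (b s) (lg_inv (b t))) t.
  by apply: (smooth_into_mul hG) => //; exact: smooth_into_cst.
have b1 : lg_mul (b t) (lg_inv (b t)) = e by rewrite (lg_mulgV hG).
rewrite /rlogder -(Ad_velocity hG (c t) s2 b1) -(mul_velocity hG).
- congr (derive1 _ t); apply/funext => s; congr phi.
  rewrite /lg_conj /curve_mul (lg_invM hG) !(lg_mulA hG).
  by rewrite (lg_mulgKV hG).
- exact: s1.
- by apply: (smooth_into_conj hG) => //; exact: smooth_into_cst.
- by rewrite (lg_mulgV hG).
- by rewrite b1 (lg_conj1 hG).
Qed.

Lemma near_derive1_Ad_curve (c : R^o -> G) v : smooth_into c 0 ->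
  \forall t \near (0 : R^o),
    derive1 (fun s => Ad (c s) v) t = lie_bracket G (rlogder c t) (Ad (c t) v).
Proof.
move=> sc; have nc : \forall t \near (0 : R^o), smooth_into c t by exact: (smooth_into_near
    hM sc).
by apply: filterS nc => t st; exact: (Ad_curve hG v st).
Qed.

Lemma derive1n_rlogder_mul (c b : R^o -> G) i : smooth_into c 0 -> smooth_into b 0 ->
  derive1n i (rlogder (curve_mul c b)) 0 =
  ad_row (lie_bracket G) (Ad (c 0)) (fun i => derive1n i.-1 (rlogder c) 0)
    (fun i => derive1n i.-1 (rlogder b) 0) i.+1.
Proof.
move=> sc sb; rewrite (derive1n_near_eq _ (rlogder_mul sc sb)).
have sx := smooth_near_rlogder sc; have sy := smooth_near_rlogder sb.
have sAy : smooth_near (fun t : R^o => Ad (c t) (rlogder b t))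
    0 by exact: (smooth_near_Ad hG sc sy).
have sA v : smooth_near (fun t : R^o => Ad (c t) v) 0.
  exact: (smooth_near_Ad hG sc (smooth_near_cst v _)).
have lA t : linear (Ad (c t)) by exact: (Ad_linear hG).
have bb : bilinear_map (lie_bracket G) by exact: (bracket_bilinear hG).
exact: (derive1n_ad_row i bb lA sA (fun v => near_derive1_Ad_curve v sc) sx sy sAy).
Qed.

Lemma jcompE (k : nat) (M : 'M[R]_(k, n)) (i : 'I_k) : jcomp M i.+1 = row i M.
Proof. by rewrite /jcomp /= valK. Qed.

Lemma jcomp_rows (k : nat) (f : nat -> E) i : (0 < i <= k)%N ->
  jcomp (\matrix_(j < k) f j) i = f i.-1.
Proof.
case: i => // i ik; rewrite -[i.+1]/((Ordinal ik : nat).+1) jcompE.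
by rewrite rowK.
Qed.

Definition jet_mul_formula k (p q : G * 'M[R]_(k, n)) : G * 'M[R]_(k, n) :=
  (lg_mul p.1 q.1,
   \matrix_(i < k) ad_row (lie_bracket G) (Ad p.1) (jcomp p.2) (jcomp q.2) i.+1).

(** The right-hand side depends on the factors through their trivializations alone; this is what
    makes the product of jets independent of representatives. *)
Lemma rtriv_curve_mul k (c b : R^o -> G) : smooth_into c 0 -> smooth_into b 0 ->
  rtriv_curve k (curve_mul c b) = jet_mul_formula (rtriv_curve k c) (rtriv_curve k b).
Proof.
move=> sc sb; congr (_, _); apply/row_matrixP => i; rewrite !rowK.
rewrite (derive1n_rlogder_mul i sc sb); apply: eq_ad_row => [//|j /andP[j0 ji]].
have jk : (0 < j <= k)%N by rewrite j0 (leq_trans ji).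
split; apply: esym; exact: (jcomp_rows (fun i => derive1n i _ 0) jk).
Qed.

Lemma smooth_curve_mul (c b : R^o -> G) : smooth_into c 0 -> smooth_into b 0 ->
  smooth_into (curve_mul c b) 0.
Proof. exact: (smooth_into_mul hG). Qed.

Lemma jet_self k (c : R^o -> G) : smooth_into c 0 -> jet k c c.
Proof. by move=> sc; split; [exact: sc|split]. Qed.

Lemma eq_jet k (c b : R^o -> G) : smooth_into c 0 -> smooth_into b 0 ->
  rtriv_curve k c = rtriv_curve k b -> jet k c = jet k b.
Proof.
move=> sc sb cb; apply/seteqP; split=> d [sd cd]; (split; first exact: sd).
  by apply/(same_jet_rtriv k sb sd); rewrite -cb; apply/(same_jet_rtriv k sc sd).
by apply/(same_jet_rtriv k sc sd); rewrite cb; apply/(same_jet_rtriv k sb sd).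
Qed.

Lemma jet_repP k (c : R^o -> G) : smooth_into c 0 ->
  smooth_into (jet_rep (jet k c)) 0 /\ rtriv_curve k (jet_rep (jet k c)) = rtriv_curve k c.
Proof.
move=> sc; have [sr rr] : jet k c (jet_rep (jet k c))
    by exact: (xgetPex _ (ex_intro _ c (jet_self k sc))).
by split; [exact: sr|exact/esym/(same_jet_rtriv k sc sr)].
Qed.

Lemma rtriv_jet k (c : R^o -> G) : smooth_into c 0 -> rtriv k (jet k c) = rtriv_curve k c.
Proof. by move=> sc; case: (jet_repP k sc). Qed.

Lemma jet_mul_jet k (c b : R^o -> G) : smooth_into c 0 -> smooth_into b 0 ->
  jet_mul k (jet k c) (jet k b) = jet k (curve_mul c b).
Proof.
move=> sc sb; have [s1 e1] := jet_repP k sc; have [s2 e2] := jet_repP k sb.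
apply: eq_jet; [exact: smooth_curve_mul|exact: smooth_curve_mul|].
by rewrite (rtriv_curve_mul k s1 s2) (rtriv_curve_mul k sc sb) e1 e2.
Qed.

Lemma right_trivialization k : is_right_trivialization G k.
Proof.
split.
- by move=> c b sc sb; split; [exact: smooth_curve_mul|exact: jet_mul_jet].
- by move=> c sc; exact: rtriv_jet.
split; first by [].
- move=> j j' /set_mem [c sc <-] /set_mem [b sb <-].
  by rewrite (rtriv_jet k sc) (rtriv_jet k sb); exact: eq_jet.
- move=> [g M] _; have [c sc cE] := rtriv_curve_surj g M.
  by exists (jet k c); [exists c|rewrite rtriv_jet].
Qed.

Lemma rtriv_invE k (c : R^o -> G) : smooth_into c 0 ->
  rtriv_inv (rtriv_curve k c) = jet k c.
Proof.
move=> sc.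
have [[b sb <-] E] : [set j | jets k j /\ rtriv k j = rtriv_curve k c] (rtriv_inv
    (rtriv_curve k c)).
  apply: (xgetPex _ (ex_intro _ (jet k c) _)); split; last exact: rtriv_jet.
  by exists c.
by apply: (eq_jet sb sc); rewrite -(rtriv_jet k sb).
Qed.

Lemma jet_lie_mulE k (p q : jet_lie G k) : lg_mul p q = jet_mul_formula p q.
Proof.
case: p q => [g M] [h N]; have [c sc <-] := rtriv_curve_surj g M.
have [b sb <-] := rtriv_curve_surj h N.
rewrite -(rtriv_curve_mul k sc sb) -(rtriv_jet k (smooth_curve_mul sc sb)).
by rewrite -(jet_mul_jet k sc sb) -(rtriv_invE k sc) -(rtriv_invE k sb).
Qed.

Lemma jet_lie_oneE k : lg_one (jet_lie G k) = rtriv_curve k (fun=> e).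
Proof. exact: (rtriv_jet k (smooth_into_cst e 0)). Qed.

Lemma jet_lie_mul_curve k (c b : R^o -> G) : smooth_into c 0 -> smooth_into b 0 ->
  @lg_mul _ _ (jet_lie G k) (rtriv_curve k c) (rtriv_curve k b)
      = rtriv_curve k (curve_mul c b).
Proof. by move=> sc sb; rewrite jet_lie_mulE (rtriv_curve_mul k sc sb). Qed.

(** [jet_inv] inverts the chosen representative. Taking [c] to be that very curve gives a pair of
    mutually inverse curves over [p] and its inverse, as [transported_group] asks. *)
Lemma jet_lie_inv_curve k (p : jet_lie G k) : exists c : R^o -> G,
  [/\ smooth_into c 0, p = rtriv_curve k c & lg_inv p = rtriv_curve k (fun t => lg_inv (c t))].
Proof.
case: p => [g M]; have [c sc cE] := rtriv_curve_surj g M.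
have [sr rE] := jet_repP k sc.
have si : smooth_into (fun t : R^o => lg_inv (jet_rep (jet k c) t))
    0 by exact: (smooth_into_lg_inv hG sr).
exists (jet_rep (jet k c)); split; [exact: sr|by rewrite rE cE|].
rewrite -cE -(rtriv_jet k si) -(rtriv_invE k sc).
by [].
Qed.

Lemma jet_lie_axioms k : [/\ associative (@lg_mul _ _ (jet_lie G k)),
  left_id (lg_one (jet_lie G k)) lg_mul, right_id (lg_one (jet_lie G k)) lg_mul,
  left_inverse (lg_one (jet_lie G k)) lg_inv lg_mul &
  right_inverse (lg_one (jet_lie G k)) lg_inv lg_mul].
Proof.
apply: (@transported_group _ _ (fun c : R^o -> G => smooth_into c 0) (rtriv_curve k)
  (@curve_mul _ _ G) (fun=> e)).
- by move=> [g M]; have [c sc cE] := rtriv_curve_surj g M; exists c.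
- exact: smooth_curve_mul.
- exact: jet_lie_mul_curve.
- by move=> c b d; apply/funext => t; exact: (lg_mulA hG).
- by move=> c; apply/funext => t; exact: (lg_mul1g hG).
- by move=> c; apply/funext => t; exact: (lg_mulg1 hG).
- exact: smooth_into_cst.
- exact: jet_lie_oneE.
move=> p; have [c [sc pc ic]] := jet_lie_inv_curve p.
exists c, (fun t => lg_inv (c t)); split;
    [exact: sc|exact: (smooth_into_lg_inv hG sc)|exact: pc|exact: ic|].
by split; apply/funext => t; [exact: (lg_mulgV hG)|exact: (lg_mulVg hG)].
Qed.

End Jets.

(** * Smoothness and first derivatives of sums of words *)

Section SmoothWords.
Context {R : realType} {E1 E : normedModType R} {h1 : fin_dim E1} {hE : fin_dim E}.
Variables (br : E -> E -> E) (bb : bilinear_map br).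

Lemma smooth_near_mulrn (f : E1 -> E) m z :
  smooth_near f z -> smooth_near (fun y => f y *+ m) z.
Proof.
move=> sf; elim: m => [|m IH]; first exact: smooth_near_cst.
by apply: smooth_near_ext (smooth_near_add sf IH); apply: nearW => y; rewrite mulrS.
Qed.

Lemma smooth_near_comp_sum (f : E1 -> seq nat -> E) m z :
  (forall s, smooth_near (fun y => f y s) z) ->
  smooth_near (fun y => comp_sum m (f y)) z.
Proof.
elim/ltn_ind: m f => -[|m] IH f sf; first exact: sf.
apply: (@smooth_near_ext _ _ _ (fun y =>
  \sum_(j < m.+1) comp_sum (m - j) (fun s => f y (rcons s j.+1)) *+ 'C(m, j))).
  by apply: nearW => y; rewrite comp_sumS.
apply: smooth_near_sum => j _; apply: smooth_near_mulrn.
by apply: (IH (m - j)%N) => [|s]; [rewrite ltnS leq_subr|exact: sf].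
Qed.

Lemma smooth_near_br_word (x : nat -> E1 -> E) (v : E1 -> E) s z :
  (forall i, smooth_near (x i) z) -> smooth_near v z ->
  smooth_near (fun y => br_word br (fun i => x i y) (v y) s) z.
Proof.
move=> sx sv; elim/last_ind: s => [|s i IH]; first exact: sv.
apply: (@smooth_near_ext _ _ _ (fun y => br (x i y) (br_word br (fun i => x i y) (v y) s))).
  by apply: nearW => y; rewrite br_word_rcons.
exact: smooth_near_bilinear.
Qed.

Lemma br_word0 (x : nat -> E) v s : (forall i, x i = 0) -> s != [::] -> br_word br x v s = 0.
Proof.
move=> x0; case/lastP: s => // s i _.
by rewrite br_word_rcons x0 (linear_zero (bb.1 _)).
Qed.

Lemma comp_sum_br_word0 (x : nat -> E) v m : (forall i, x i = 0) ->
  comp_sum m.+1 (br_word br x v) = 0.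
Proof.
move=> x0; rewrite (@eq_comp_sum _ _ _ (fun=> 0)).
  elim/ltn_ind: m => m IH; rewrite comp_sumS big1 // => j _.
  case E0 : (m - j)%N => [|l]; first by rewrite comp_sum0 mul0rn.
  by rewrite IH ?mul0rn // -E0 leq_subr.
move=> s /andP[_ /eqP sm]; apply: br_word0 => //.
by apply: contra_eq_neq sm => ->.
Qed.

(** Where all letters vanish, a first derivative annihilates every word with two or more letters.
    The only composition of a positive [m] with one part is [m] itself, of weight 1; for [m = 0] the
    word is empty. *)
Lemma derive_comp_sum_br_word (x : nat -> E1 -> E) (a : E1 -> E) m (X z : E1) :
  (forall i, smooth_near (x i) z) -> smooth_near a z -> (forall i, x i z = 0) ->
  'D_X (fun y => comp_sum m (br_word br (fun i => x i y) (a y))) z =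
  if m is 0 then 'D_X a z else br ('D_X (x m) z) (a z).
Proof.
move=> sx sa x0; case: m => [//|m].
pose W l y := comp_sum l (br_word br (fun i => x i y) (a y)).
have sW l : smooth_near (W l) z.
  by apply: smooth_near_comp_sum => s; exact: smooth_near_br_word.
have WS y : W m.+1 y = \sum_(j < m.+1) br (x j.+1 y) (W (m - j)%N y) *+ 'C(m, j).
  rewrite /W comp_sumS; apply: eq_bigr => j _; congr (_ *+ _).
  rewrite (comp_sum_additive (l := br _)); last 2 first.
  - exact: linear_zero (bb.2 _).
  - by move=> u v; exact: linear_add (bb.2 _).
  by apply: eq_comp_sum => s _; rewrite br_word_rcons.
rewrite (_ : (fun y => _) = fun y => \sum_(j < m.+1) br (x j.+1 y) (W (m - j)%N y)
    *+ 'C(m, j)); last first.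
  by apply/funext => y; exact: WS.
have sb (j : 'I_m.+1) : smooth_near (fun y => br (x j.+1 y) (W (m - j)%N y)) z.
  exact: smooth_near_bilinear.
have db (j : 'I_m.+1) := smooth_near_differentiable (smooth_near_mulrn 'C(m, j) (sb j)).
rewrite (derive_sumE (index_enum 'I_m.+1) X db).2.
have D (j : 'I_m.+1) : 'D_X (fun y => br (x j.+1 y) (W (m - j)%N y) *+ 'C(m, j)) z =
    br ('D_X (x j.+1) z) (W (m - j)%N z) *+ 'C(m, j).
  have lm : linear (fun u : E => u *+ 'C(m, j)) by move=> c u v; rewrite mulrnDl scalerMnr.
  rewrite (derive_linear_comp X lm (smooth_near_differentiable (sb j))); congr (_ *+ _).
  rewrite (derive_bilinear X bb (smooth_near_differentiable (sx _))
      (smooth_near_differentiable (sW _))).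
  by rewrite x0 (linear_zero (bb.1 _)) addr0.
(* Only j = m survives, where the rest of the word is empty; for smaller j the rest contains a
   letter, which is zero at [z]. *)
rewrite (eq_bigr _ (fun j _ => D j)) big_ord_recr /= subnn binn mulr1n.
rewrite big1 ?add0r // => j _; rewrite /W.
case E0 : (m - j)%N => [|l]; first by move/eqP: E0; rewrite subn_eq0 leqNgt ltn_ord.
by rewrite comp_sum_br_word0 // (linear_zero (bb.2 _)) mul0rn.
Qed.

End SmoothWords.

Lemma ad_rowS (V : nmodType) (br : V -> V -> V) (A : V -> V) (x y : nat -> V) i :
  ad_row br A x y i.+1 = x i.+1 +
  \sum_(j < i.+1) comp_sum (i - j) (br_word br x (A (y j.+1))) *+ 'C(i, j).
Proof.
rewrite /ad_row comp_sumS; congr (_ + _); apply: eq_bigr => j _; congr (_ *+ _).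
by apply: eq_comp_sum => s _; rewrite ad_word_rcons.
Qed.

(** The summand of top index carries no bracket and isolates [A (y i.+1)] in terms of components of
    [y] of lower index. The equations for an inverse jet are thus triangular. *)
Lemma ad_row_eq0 (V : zmodType) (br : V -> V -> V) (A : V -> V) (x y : nat -> V) i :
  ad_row br A x y i.+1 = 0 -> A (y i.+1) = - (x i.+1 +
  \sum_(j < i) comp_sum (i - j) (br_word br x (A (y j.+1))) *+ 'C(i, j)).
Proof.
rewrite ad_rowS big_ord_recr /= subnn binn mulr1n comp_sum0 addrA => /eqP.
by rewrite addrC addr_eq0 => /eqP.
Qed.

(** * The jet group *)

Section JetLieGroup.
Context {R : realType} {n : nat}.
Variables (G : lie_data 'rV[R]_n) (hG : is_lie_group G).
Local Notation E := 'rV[R]_n.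
Local Notation e := (lg_one G).
Local Notation br := (lie_bracket G).
Local Notation hM := (lie_manifold hG).

Local Opaque Ad derive derive1 lie_bracket derive1n smooth_at smooth_near comp_sum.

Lemma jcomp_linear m i : linear (fun M : 'M[R]_(m, n) => jcomp M i).
Proof.
move=> a M N; rewrite /jcomp; case: insubP => [j _ _|_]; last by rewrite scaler0 addr0.
by apply/rowP => l; rewrite !mxE.
Qed.

Lemma jcomp0 m i : jcomp (0 : 'M[R]_(m, n)) i = 0.
Proof. exact: (linear_zero (@jcomp_linear m i)). Qed.

Lemma jet_manifold k : is_manifold (jet_lie G k).
Proof.
apply: (is_manifold_prod hM); apply: is_manifold_vec.
exact: second_countable_matrix.
Qed.

Section Into.
Context {E1 : normedModType R} {h1 : fin_dim E1} {k : nat}.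

Lemma smooth_into_jet (f : E1 -> G) (M : E1 -> 'M[R]_(k, n)) z :
  smooth_into f z -> smooth_near M z ->
  smooth_into (M := jet_lie G k) (fun y => (f y, M y)) z.
Proof. by move=> sf sM; apply: smooth_into_pair => //; exact/smooth_into_vec. Qed.

Lemma smooth_into_jet1 (p : E1 -> jet_lie G k) z :
  smooth_into p z -> smooth_into (fun y => (p y).1 : G) z.
Proof. exact: (@smooth_into_fst R E1 E 'M[R]_(k, n) _ _ G (vec_mfd 'M[R]_(k, n)) p z). Qed.

Lemma smooth_into_jet2 (p : E1 -> jet_lie G k) z :
  smooth_into p z -> smooth_near (fun y => (p y).2 : 'M[R]_(k, n)) z.
Proof.
move=> sp; apply/smooth_into_vec.
exact: (@smooth_into_snd R E1 E 'M[R]_(k, n) _ _ G (vec_mfd 'M[R]_(k, n)) p z).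
Qed.

Lemma smooth_near_jcomp i (p : E1 -> jet_lie G k) z :
  smooth_into p z -> smooth_near (fun y => jcomp ((p y).2 : 'M[R]_(k, n)) i) z.
Proof. by move=> /smooth_into_jet2 sp; exact: (smooth_near_lin (@jcomp_linear k i) sp). Qed.

Lemma smooth_near_ad_words (f : E1 -> G) (x : nat -> E1 -> E) (v : E1 -> E) m z :
  smooth_into f z -> (forall i, smooth_near (x i) z) -> smooth_near v z ->
  smooth_near (fun y => comp_sum m (br_word br (fun i => x i y) (Ad (f y) (v y)))) z.
Proof.
move=> sf sx sv; have bb : bilinear_map br by exact: (bracket_bilinear hG).
have sA : smooth_near (fun y => Ad (f y) (v y)) z by exact: (smooth_near_Ad hG sf sv).
by apply: smooth_near_comp_sum => s; exact: (smooth_near_br_word bb s sx sA).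
Qed.

Lemma smooth_into_jet_mul (p q : E1 -> jet_lie G k) z :
  smooth_into p z -> smooth_into q z -> smooth_into (fun y => lg_mul (p y) (q y)) z.
Proof.
move=> sp sq; have p1 := smooth_into_jet1 sp; have q1 := smooth_into_jet1 sq.
rewrite (_ : (fun y => _) = fun y => jet_mul_formula (p y) (q y)); last first.
  by apply/funext => y; exact: (jet_lie_mulE hG).
apply: smooth_into_jet; first exact: (smooth_into_mul hG p1 q1).
apply: smooth_near_rows => i.
apply: (@smooth_near_ext _ _ _ (fun y => jcomp ((p y).2 : 'M[R]_(k, n)) i.+1 +
  \sum_(j < i.+1) comp_sum (i - j) (br_word br (fun l => jcomp ((p y).2 : 'M[R]_(k, n)) l)
     (Ad ((p y).1 : G) (jcomp ((q y).2 : 'M[R]_(k, n)) j.+1))) *+ 'C(i, j))).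
  by apply: nearW => y; exact: (esym (ad_rowS br _ _ _ _)).
apply: (smooth_near_add (smooth_near_jcomp i.+1 sp)).
apply: smooth_near_sum => j _; apply: smooth_near_mulrn.
exact: (smooth_near_ad_words _ p1 (fun l => smooth_near_jcomp l sp)
    (smooth_near_jcomp j.+1 sq)).
Qed.

End Into.

Lemma jet_lie_one k : lg_one (jet_lie G k) = (e, 0).
Proof.
rewrite (jet_lie_oneE hG); apply: (congr1 (pair e)).
apply/row_matrixP => i; rewrite rowK row0.
rewrite (_ : rlogder (fun=> e) = fun=> 0); last first.
  apply/funext => t; rewrite /rlogder (derive1_derive (fun=> _ : E)).
  exact: derive_cst.
by case: (i : nat) => [//|j]; exact: derive1n_cst.
Qed.

Lemma jet_lie_inv1 k (p : jet_lie G k) : (lg_inv p).1 = lg_inv (p.1 : G).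
Proof. by have [c [_ -> ->]] := jet_lie_inv_curve hG p. Qed.

Lemma row_jet_mul k (p q : jet_lie G k) i : (i < k)%N ->
  jcomp ((lg_mul p q).2 : 'M[R]_(k, n)) i.+1 =
  ad_row br (Ad (p.1 : G)) (jcomp (p.2 : 'M[R]_(k, n))) (jcomp (q.2 : 'M[R]_(k, n))) i.+1.
Proof.
move=> ik; rewrite (jet_lie_mulE hG).
exact: (@jcomp_rows R n k (fun i => ad_row br _ _ _ i.+1) i.+1).
Qed.

Lemma row_jet_inv k (p : jet_lie G k) i : (i < k)%N ->
  jcomp ((lg_inv p).2 : 'M[R]_(k, n)) i.+1 =
  Ad (lg_inv (p.1 : G)) (- (jcomp (p.2 : 'M[R]_(k, n)) i.+1 +
    \sum_(j < i) comp_sum (i - j) (br_word br (jcomp (p.2 : 'M[R]_(k, n)))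
       (Ad (p.1 : G) (jcomp ((lg_inv p).2 : 'M[R]_(k, n)) j.+1))) *+ 'C(i, j))).
Proof.
move=> ik; have [_ _ _ _ pV] := jet_lie_axioms hG k.
have E0 : ad_row br (Ad (p.1 : G)) (jcomp (p.2 : 'M[R]_(k, n)))
    (jcomp ((lg_inv p).2 : 'M[R]_(k, n))) i.+1 = 0.
  by rewrite -(row_jet_mul p (lg_inv p) ik) (pV p) jet_lie_one; exact: jcomp0.
by rewrite -(ad_row_eq0 E0) (AdK hG).
Qed.

(** Strong induction on the row: [row_jet_inv] expresses each row of the inverse smoothly by the
    given jet, the inverse in G and the earlier rows of the inverse. *)
Lemma smooth_into_jet_inv (E1 : normedModType R)
    {h1 : fin_dim E1} k (p : E1 -> jet_lie G k) z :
  smooth_into p z -> smooth_into (fun y => lg_inv (p y)) z.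
Proof.
move=> sp; have p1 := smooth_into_jet1 sp.
have pV : smooth_into (fun y => lg_inv ((p y).1 : G)) z by exact: (smooth_into_lg_inv hG p1).
rewrite (_ : (fun y => _) = fun y => (lg_inv ((p y).1 : G),
    \matrix_(i < k) jcomp ((lg_inv (p y)).2 : 'M[R]_(k, n)) i.+1)); last first.
  apply/funext => y; rewrite [LHS]surjective_pairing jet_lie_inv1; apply: (congr1 (pair _)).
  by apply/row_matrixP => i; rewrite rowK jcompE.
apply: smooth_into_jet; first exact: pV.
apply: smooth_near_rows => i; move: (i : nat) (ltn_ord i) => {}i.
elim/ltn_ind: i => i IH ik.
apply: (@smooth_near_ext _ _ _ (fun y => Ad (lg_inv ((p y).1 : G))
    (- (jcomp ((p y).2 : 'M[R]_(k, n)) i.+1 +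
    \sum_(j < i) comp_sum (i - j) (br_word br (fun l => jcomp ((p y).2 : 'M[R]_(k, n)) l)
       (Ad ((p y).1 : G) (jcomp ((lg_inv (p y)).2 : 'M[R]_(k, n)) j.+1))) *+ 'C(i, j))))).
  by apply: nearW => y; exact: esym (row_jet_inv (p y) ik).
apply: (smooth_near_Ad hG pV); apply: smooth_near_opp.
apply: (smooth_near_add (smooth_near_jcomp i.+1 sp)).
apply: smooth_near_sum => j _; apply: smooth_near_mulrn.
apply: (smooth_near_ad_words _ p1 (fun l => smooth_near_jcomp l sp)).
by apply: IH => //; exact: ltn_trans ik.
Qed.

(** The inverse charts are among the test maps, and smoothness along them is smoothness. *)
Lemma smooth_map_into (E1 E2 : normedModType R) {h1 : fin_dim E1} {h2 : fin_dim E2}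
    (M : mfd E1) (N : mfd E2) (h : M -> N) : is_manifold M ->
  (forall (f : E1 -> M) z, smooth_into f z -> smooth_into (fun y => h (f y)) z) ->
  smooth_map h.
Proof.
move=> hM1 sh p; apply: (smooth_into_smooth_at hM1); apply: sh.
apply: (smooth_into_inv hM1); apply: chart_img_map; exact: is_chart_self hM1 p.
Qed.

Lemma jet_lie_group k : is_lie_group (jet_lie G k).
Proof.
have hJ := jet_manifold k.
have hJJ : is_manifold (prod_mfd (jet_lie G k) (jet_lie G k))
    by exact: (is_manifold_prod hJ hJ).
split; first exact: hJ.
split; first exact: jet_lie_axioms.
split.
  apply: (smooth_map_into hJJ) => f z sf.
  exact: (smooth_into_jet_mul (smooth_into_fst sf) (smooth_into_snd sf)).
by apply: (smooth_map_into hJ) => f z sf; exact: smooth_into_jet_inv.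
Qed.

Lemma vec_lie_group : is_lie_group (vec_lie E).
Proof.
have hV : is_manifold (vec_mfd E) by apply: is_manifold_vec; exact: second_countable_matrix.
have hVV : is_manifold (prod_mfd (vec_mfd E) (vec_mfd E)) by exact: (is_manifold_prod hV hV).
split; first exact: hV.
split.
  split; [exact: addrA|exact: add0r|exact: addr0|exact: addNr|exact: addrN].
split.
  apply: (smooth_map_into hVV) => f z sf; apply/smooth_into_vec.
  have s1 : smooth_near (fun y => (f y).1 : E) z.
    by apply/smooth_into_vec; exact: (smooth_into_fst sf).
  have s2 : smooth_near (fun y => (f y).2 : E) z.
    by apply/smooth_into_vec; exact: (smooth_into_snd sf).
  exact: (smooth_near_add s1 s2).
apply: (smooth_map_into hV) => f z /smooth_into_vec sf; apply/smooth_into_vec.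
exact: (smooth_near_opp sf).
Qed.

End JetLieGroup.

(** * The group extension *)

Section Blocks.
Import mathcomp.boot.finset.
Context {k : nat}.
Implicit Type P : {set {set 'I_k}}.

(** A block of full size is the whole set, and disjointness then makes it the only block. Hence the
    cocycle involves only components of index below [k], which exist in the jets of order k - 1. *)
Lemma block_sizes_lt P i : partition P [set: 'I_k]%SET -> P != [set [set: 'I_k]]%SET ->
  i \in block_sizes P -> (0 < i < k)%N.
Proof.
move=> /and3P[_ /trivIsetP tP P0] PT /mapP[B]; rewrite mem_sort mem_enum => BP ->.
rewrite card_gt0 (contraNneq _ P0) => [|<- //];
    rewrite ltn_neqAle -[X in (_ <= X)%N]card_ord max_card andbT.
apply: contra PT => /eqP BT.
have {}BT : B = [set: 'I_k]%SET.
  by apply/eqP; rewrite eqEcard finset.subsetT cardsT card_ord BT leqnn.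
rewrite BT in BP; apply/eqP/setP => C; rewrite inE; apply/idP/eqP => [CP|-> //].
apply/eqP; apply: contraNT P0 => CT.
by have := tP _ _ CP BP CT; rewrite -setI_eq0 finset.setIT => /eqP <-.
Qed.

Lemma block_sizes_neq0 P : (0 < k)%N -> partition P [set: 'I_k]%SET -> block_sizes P != [::].
Proof.
move=> k0 /and3P[/eqP cP _ _]; rewrite -size_eq0 size_block_sizes cards_eq0.
apply: contraTneq k0 => P0; move: cP; rewrite P0 /cover big_set0 => /setP E.
by rewrite -leqNgt leqn0; case: {P P0} k E => // m /(_ ord0); rewrite !inE.
Qed.

(** The term of the one-block partition is the action on the top component. All other words see only
    indices below [k], so there the components of a k-jet may be replaced by those of its
    projection. *)
Lemma comp_sum_ad_word (V : nmodType) (br : V -> V -> V) (A : V -> V) (x y x' y' : nat -> V) :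
  (0 < k)%N -> (forall i, (0 < i < k)%N -> x i = x' i /\ y i = y' i) ->
  comp_sum k (ad_word br A x y) = A (y k) +
  \sum_(P : {set {set 'I_k}} | partition P [set: 'I_k]%SET && (P != [set [set: 'I_k]]%SET))
     ad_word br A x' y' (block_sizes P).
Proof.
move=> k0 h; rewrite (sum_partitions_neq_setT _ k0); congr (_ + _).
apply: eq_bigr => P /andP[pP PT].
apply: eq_ad_word => [|i si]; first exact: block_sizes_neq0.
exact: h (block_sizes_lt pP PT si).
Qed.

End Blocks.

(** Associativity is evaluated on lifts with zero last component; the action maps these zeros to
    zero, and the last components form the cocycle identity. *)
Lemma extension_cocycle (X Q : Type) (V : zmodType) (mX : X -> X -> X) (mQ : Q -> Q -> Q)
    (pr : Q -> V -> X) (last : X -> V) (act : Q -> V -> V) (d : Q -> Q -> V) :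
  associative mX -> (forall a x, last (pr a x) = x) ->
  (forall a b x y, mX (pr a x) (pr b y) = pr (mQ a b) (x + act a y + d a b)) ->
  (forall a, act a 0 = 0) ->
  forall a b c, act a (d b c) - d (mQ a b) c + d a (mQ b c) - d a b = 0.
Proof.
move=> mA prK prM act0 a b c; have := mA (pr a 0) (pr b 0) (pr c 0).
rewrite !prM => /(congr1 last); rewrite !prK !act0 !add0r addr0 => H.
by rewrite (addrAC (act a (d b c))) H addrK subrr.
Qed.

Section JetPairs.
Context {R : realType} {n k : nat}.
Hypothesis k0 : (0 < k)%N.
Local Notation E := 'rV[R]_n.

Lemma jcomp_ext (M N : 'M[R]_(k, n)) :
  (forall i, (0 < i <= k)%N -> jcomp M i = jcomp N i) -> M = N.
Proof.
by move=> MN; apply/row_matrixP => i; rewrite -!jcompE; apply: MN; exact: ltn_ord.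
Qed.

Lemma jcomp_jpair (T : Type) (a : T * 'M[R]_(k.-1, n)) (x : E) i :
  (0 < i < k)%N -> jcomp (jpair a x).2 i = jcomp a.2 i.
Proof.
move=> /andP[i0 ik].
rewrite (jcomp_rows (fun i => if (i < k.-1)%N then jcomp a.2 i.+1 else x)) ?i0 ?(ltnW ik) //.
by rewrite -ltnS !prednK // ik.
Qed.

Lemma jcomp_jpair_last (T : Type) (a : T * 'M[R]_(k.-1, n)) (x : E) :
  jcomp (jpair a x).2 k = x.
Proof.
rewrite (jcomp_rows (fun i => if (i < k.-1)%N then jcomp a.2 i.+1 else x)) ?k0 ?leqnn //.
by rewrite ltnn.
Qed.

Lemma jprojK (T : Type) (p : T * 'M[R]_(k, n)) : jpair (jproj p) (jcomp p.2 k) = p.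
Proof.
case: p => g M; congr (_, _); apply: jcomp_ext => i /andP[i0 ik].
move: ik; rewrite leq_eqVlt => /orP[/eqP ->|ik].
  exact: (jcomp_jpair_last (jproj (g, M))).
rewrite (jcomp_jpair (jproj (g, M))) ?i0 //=.
rewrite (jcomp_rows (fun i => jcomp M i.+1)) ?prednK //.
by rewrite i0 -ltnS prednK.
Qed.

Lemma jpairK (T : Type) (a : T * 'M[R]_(k.-1, n)) (x : E) : jproj (jpair a x) = a.
Proof.
case: a => g M; congr (_, _); apply/row_matrixP => i; rewrite rowK.
rewrite (jcomp_jpair (g, M)) ?jcompE //=.
by rewrite -ltn_predRL ltn_ord.
Qed.

Lemma eq_jpair (T : Type) (p : T * 'M[R]_(k, n)) (a : T * 'M[R]_(k.-1, n)) (x : E) :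
  p.1 = a.1 -> (forall i, (0 < i < k)%N -> jcomp p.2 i = jcomp a.2 i) ->
  jcomp p.2 k = x -> p = jpair a x.
Proof.
case: p => g M /= -> Ma Mx; congr (_, _); apply: jcomp_ext => i /andP[i0 ik].
move: ik; rewrite leq_eqVlt => /orP[/eqP ->|ik].
  by rewrite Mx (jcomp_jpair_last a).
by rewrite (jcomp_jpair a) ?i0 ?ik //; apply: Ma; rewrite i0.
Qed.

Lemma jpair0 (T : Type) (g : T) : jpair (g, 0) 0 = (g, 0 : 'M[R]_(k, n)).
Proof.
by apply/esym/eq_jpair => // [i ik|]; rewrite /= !jcomp0.
Qed.

End JetPairs.

Section JetExtension.
Context {R : realType} {n k : nat}.
Hypothesis k0 : (0 < k)%N.
Variables (G : lie_data 'rV[R]_n) (hG : is_lie_group G).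
Local Notation E := 'rV[R]_n.
Local Notation J := (jet_lie G k).
Local Notation Q := (jet_lie G k.-1).

Local Opaque Ad derive derive1 lie_bracket derive1n smooth_at smooth_near comp_sum.

Lemma cocycle_part_comp (a b : Q) : cocycle_part a b = cocycle_comp a b.
Proof.
pose W := ad_word (lie_bracket G) (Ad (a.1 : G)) (jcomp (a.2 : 'M[R]_(k.-1, n)))
    (jcomp (b.2 : 'M[R]_(k.-1, n))).
(* With the one-block term added, both sums become [comp_sum k W]. That term asks for the component
   of index [k] of a jet of order k - 1, where [jcomp] takes its default value 0. *)
apply: (@addrI _ (W [:: k])).
have H1 : comp_sum k W = W [:: k] + cocycle_part a b by exact: sum_partitions_neq_setT.
have H2 : comp_sum k W = W [:: k] + cocycle_comp a b by exact: sum_compositions_neq1.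
by rewrite -H1 H2.
Qed.

Lemma jcomp_jet_mul (p q : J) i : (0 < i <= k)%N ->
  jcomp ((lg_mul p q).2 : 'M[R]_(k, n)) i = ad_row (lie_bracket G) (Ad (p.1 : G))
    (jcomp (p.2 : 'M[R]_(k, n))) (jcomp (q.2 : 'M[R]_(k, n))) i.
Proof. by case: i => [//|i] /andP[_ ik]; exact: row_jet_mul. Qed.

(** A row of the product involves only rows of the factors up to the same index, so the rows below
    [k] multiply as in the jets of order k - 1. In row [k] the top components enter only as x and as
    the one-block word Ad_g y. *)
Lemma jpair_mul (a b : Q) (x y : E) :
  @lg_mul R _ J (jpair a x) (jpair b y) =
  jpair (lg_mul a b) (x + jact a y + cocycle_part a b).
Proof.
apply: (eq_jpair k0) => [|i ik|].
- by rewrite !(jet_lie_mulE hG).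
- have /andP[i0 i1] := ik.
  rewrite -(prednK i0) in ik i1 *.
  rewrite (row_jet_mul hG (jpair a x) (jpair b y) (ltnW i1)).
  have i2 : (i.-1 < k.-1)%N by rewrite -ltnS (prednK k0).
  rewrite (row_jet_mul hG a b i2).
  apply: eq_ad_row => // j /andP[j0 ji].
  have jk : (0 < j < k)%N by rewrite j0 (leq_ltn_trans ji).
  by split; exact: jcomp_jpair.
- have kk : (0 < k <= k)%N by rewrite k0 leqnn.
  rewrite (jcomp_jet_mul (jpair a x) (jpair b y) kk) /ad_row.
  rewrite (jcomp_jpair_last k0 a x) -addrA; apply: (congr1 (+%R x)).
  rewrite (comp_sum_ad_word (x' := jcomp a.2) (y' := jcomp b.2) _ _ k0); last first.
    by move=> i ik; split; exact: jcomp_jpair.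
  by rewrite (jcomp_jpair_last k0 b y).
Qed.

Lemma jet_lie_one_pair : lg_one J = jpair (lg_one Q) 0.
Proof. by rewrite !(jet_lie_one hG) (jpair0 k0). Qed.

(** Read off from the product of the identity with itself, instead of evaluating the words. It makes
    [jincl] a homomorphism. *)
Lemma cocycle_part1 : cocycle_part (lg_one Q) (lg_one Q) = 0.
Proof.
have [_ one1 _ _ _] := jet_lie_axioms hG k; have [_ q1 _ _ _] := jet_lie_axioms hG k.-1.
have := one1 (lg_one J); rewrite jet_lie_one_pair jpair_mul q1 => /(congr1 (fun p =>
    jcomp p.2 k)).
rewrite !(jcomp_jpair_last k0) add0r /jact => <-.
by rewrite (linear_zero (Ad_linear hG _)) add0r.
Qed.

Lemma jet_cocycle : group_2cocycle (G := Q) (@jact R n G k.-1) (@cocycle_part R n G k).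
Proof.
have [mA _ _ _ _] := jet_lie_axioms hG k.
split.
- by move=> y; rewrite /jact (jet_lie_one hG); exact: (Ad_one hG).
- by move=> a b y; rewrite /jact (jet_lie_mulE hG); exact: (Ad_mul hG).
- by move=> a; exact: (Ad_linear hG).
apply: (extension_cocycle (last := fun p : J => jcomp (p.2 : 'M[R]_(k, n)) k)
  mA (fun a x => jcomp_jpair_last k0 a x) jpair_mul) => a.
 exact: (linear_zero (Ad_linear hG _)).
Qed.

Lemma lie_morphism_jincl : lie_morphism (G := vec_lie E) (H := J) (jincl G k).
Proof.
have hV : is_manifold (vec_mfd E) by case: (vec_lie_group (R := R) (n := n)).
split; last first.
  move=> x y; rewrite /jincl -(jet_lie_one hG) jpair_mul.
  have [_ q1 _ _ _] := jet_lie_axioms hG k.-1.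
  rewrite q1 cocycle_part1 addr0; apply: (congr1 (fun v => jpair _ (x + v))).
  by rewrite /jact (jet_lie_one hG); exact: (esym (Ad_one hG y)).
apply: (smooth_map_into hV) => f z /smooth_into_vec sf.
apply: (smooth_into_jet (smooth_into_cst _ _)); apply: smooth_near_rows => i.
case: (i < k.-1)%N; [exact: smooth_near_cst|exact: sf].
Qed.

Lemma lie_morphism_jproj : lie_morphism (G := J) (H := Q) (@jproj R n G k).
Proof.
split; last first.
  move=> p q; rewrite -{1}(jprojK k0 p) -{1}(jprojK k0 q) jpair_mul.
  exact: (jpairK k0).
apply: (smooth_map_into (jet_manifold hG k)) => f z sf.
apply: (smooth_into_jet (smooth_into_jet1 sf)); apply: smooth_near_rows => i.
exact: (smooth_near_jcomp _ sf).
Qed.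

Lemma smooth_jet_section : smooth_map (M := Q) (N := J) (fun a => jpair a 0).
Proof.
apply: (smooth_map_into (jet_manifold hG k.-1)) => f z sf.
apply: (smooth_into_jet (smooth_into_jet1 sf)); apply: smooth_near_rows => i.
case: (i < k.-1)%N; [exact: (smooth_near_jcomp _ sf)|exact: smooth_near_cst].
Qed.

Lemma jet_extension : abelian_lie_group_extension
  (A := vec_lie E) (X := J) (Q := Q) (jincl G k) (@jproj R n G k).
Proof.
split; first by split; [exact: vec_lie_group|exact: jet_lie_group|exact: jet_lie_group].
split; first exact: addrC.
split.
  split; [exact: lie_morphism_jincl| |exact: lie_morphism_jproj|].
    move=> x y /(congr1 (fun p => jcomp p.2 k)).
    by rewrite !(jcomp_jpair_last k0).
  by move=> a; exists (jpair a 0); exact: (jpairK k0).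
split.
  move=> p; rewrite (jet_lie_one hG); split=> [p1|[x ->]]; last exact: (jpairK k0).
  by exists (jcomp p.2 k); rewrite -[LHS](jprojK k0) p1.
(* Completing a jet by zero is a global smooth section. *)
move=> a; exists setT, (fun b => jpair b 0); split; [exact: openT|by []|move=> b _].
by split; [exact: smooth_jet_section|exact: (jpairK k0)].
Qed.

End JetExtension.

(** * The Lie algebra extension *)

Lemma sum_pascal (V : nmodType) (F : nat -> V) i :
  \sum_(j < i.+1) F j *+ 'C(i, j) + \sum_(j < i.+1) F j.+1 *+ 'C(i, j) =
  \sum_(j < i.+2) F j *+ 'C(i.+1, j).
Proof.
rewrite [RHS]big_ord_recl bin0; under [in RHS]eq_bigr => j _ do rewrite lift0 binS mulrnDr.
rewrite big_split addrA /=; congr (_ + _).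
rewrite big_ord_recl bin0 [in RHS]big_ord_recr /= bin_small // mulr0n addr0.
by congr (_ + _); apply: eq_bigr => j _; rewrite lift0.
Qed.

(* With [x_0] and [y_0] the components in g, the left-hand side is the antisymmetrized
   mixed second derivative of the jet product. *)
Lemma sum_antisym (V : zmodType) (br : V -> V -> V) (x y : nat -> V) i :
  (forall u v, br u v = - br v u) ->
  \sum_(j < i.+1) br (x (i - j)%N) (y j.+1) *+ 'C(i, j) -
  \sum_(j < i.+1) br (y (i - j)%N) (x j.+1) *+ 'C(i, j) =
  \sum_(j < i.+2) br (x j) (y (i.+1 - j)%N) *+ 'C(i.+1, j).
Proof.
move=> bC; rewrite -(sum_pascal (fun j => br (x j) (y (i.+1 - j)%N))) -sumrN; congr (_ + _).
  rewrite (reindex_inj rev_ord_inj) /=; apply: eq_bigr => j _.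
  have ji : (j <= i)%N by rewrite -ltnS.
  by rewrite subSS (subKn ji) (bin_sub ji) (subSn ji).
by apply: eq_bigr => j _; rewrite -mulNrn -bC subSS.
Qed.

(** * Iterated derivatives, linear maps and slices *)

Section SecondDerivatives.
Context {R : realType} {E E1 F : normedModType R}.
Context {hE : fin_dim E} {h1 : fin_dim E1} {hF : fin_dim F}.

Lemma derive2_linear_comp (l : E -> F) (f : E1 -> E) v w p :
  linear l -> smooth_near f p ->
  'D_v ('D_w (fun y => l (f y))) p = l ('D_v ('D_w f) p).
Proof.
move=> ll sf; have H : \forall q \near p, 'D_w (fun y => l (f y)) q = l ('D_w f q).
  apply: filterS (smooth_near_near sf) => q sq.
  exact: (derive_linear_comp w ll (smooth_near_differentiable sq)).
rewrite (near_eq_derive _ H).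
exact: (derive_linear_comp v ll (smooth_near_differentiable (smooth_near_derive w sf))).
Qed.

Lemma derive_comp_linear (l : E1 -> E) (f : E -> F) v p :
  linear l -> smooth_near f (l p) -> 'D_v (fun y => f (l y)) p = 'D_(l v) f (l p).
Proof.
move=> ll sf; have dl : differentiable l p by exact: differentiable_linear.
rewrite -(derive_linear p v ll).
exact: (derive_comp v dl (smooth_near_differentiable sf)).
Qed.

Lemma derive2_comp_linear (l : E1 -> E) (f : E -> F) v w p :
  linear l -> smooth_near f (l p) ->
  'D_v ('D_w (fun y => f (l y))) p = 'D_(l v) ('D_(l w) f) (l p).
Proof.
move=> ll sf.
have cl : {for p, continuous l}.
  exact: (smooth_near_continuous (smooth_near_linear p ll)).
have H : \forall q \near p, 'D_w (fun y => f (l y)) q = 'D_(l w) f (l q).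
  have := near_continuous cl (smooth_near_near sf).
  by apply: filterS => q sq; exact: (derive_comp_linear w ll sq).
rewrite (near_eq_derive _ H).
exact: (derive_comp_linear v ll (smooth_near_derive (l w) sf)).
Qed.

Lemma derive2_slices (f : E * E1 -> F) v w a b :
  'D_(v, 0) ('D_(0, w) f) (a, b) = 'D_v (fun y => 'D_w (fun z => f (y, z)) b) a.
Proof.
rewrite -derive_slice1; congr (derive _ a v); apply/funext => y.
by rewrite derive_slice2.
Qed.

End SecondDerivatives.

Lemma derive_affine (R : realType) (E F : normedModType R) {hE : fin_dim E}
    (c : F) (l : E -> F) x v : linear l -> 'D_v (fun y => c + l y) x = l v.
Proof.
move=> ll; have dl : differentiable l x by exact: differentiable_linear.
rewrite deriveE; last by apply: differentiableD; [exact: differentiable_cst|exact: dl].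
rewrite diffD; [|exact: differentiable_cst|exact: dl].
by rewrite diff_cst /= add0r -deriveE // derive_linear.
Qed.

Lemma linear_sum_mulrn (R : realType) (E F : normedModType R) (I : Type) (r : seq I)
    (c : I -> nat) (g : I -> E -> F) :
  (forall i, linear (g i)) -> linear (fun v => \sum_(i <- r) g i v *+ c i).
Proof.
move=> lg a u v; rewrite scaler_sumr -big_split; apply: eq_bigr => i _.
by rewrite /= (lg i) mulrnDl scalerMnr.
Qed.

Section LinearWords.
Context {R : realType} {E1 E : normedModType R}.
Variables (br : E -> E -> E) (bb : bilinear_map br).

Lemma linear_br_word (x : nat -> E) s (A : E1 -> E) :
  linear A -> linear (fun v => br_word br x (A v) s).
Proof.
move=> lA; elim/last_ind: s => [|s i IH]; first exact: lA.
by move=> a u v; rewrite !br_word_rcons IH (bb.2 _).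
Qed.

Lemma linear_comp_sum m (f : E1 -> seq nat -> E) :
  (forall s, linear (f ^~ s)) -> linear (fun v => comp_sum m (f v)).
Proof.
elim/ltn_ind: m f => -[|m] IH f lf; first by move=> a u v; rewrite !comp_sum0 lf.
rewrite (_ : (fun v => _) = fun v => \sum_(j < m.+1)
    comp_sum (m - j) (fun s => f v (rcons s j.+1)) *+ 'C(m, j)); last first.
  by apply/funext => v; rewrite comp_sumS.
apply: linear_sum_mulrn => j.
by apply: (IH (m - j)%N _ (fun v s => f v (rcons s j.+1))) => [|s]; rewrite ?ltnS ?leq_subr.
Qed.

End LinearWords.

(** * The bracket of the jet group *)

Section JetBracket.
Context {R : realType} {n k : nat}.
Variables (G : lie_data 'rV[R]_n) (hG : is_lie_group G).
Local Notation E := 'rV[R]_n.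
Local Notation M := 'M[R]_(k, n).
Local Notation e := (lg_one G).
Local Notation psi := (chart_inv (chart_at G (lg_one G))).
Local Notation z0 := (chart_map (chart_at G (lg_one G)) (lg_one G)).
Local Notation J := (jet_lie G k).
Local Notation br := (lie_bracket G).
Local Notation zJ := (chart_map (chart_at J (lg_one J)) (lg_one J)).

Local Opaque Ad derive derive1 lie_bracket derive1n smooth_at smooth_near comp_sum.

(* [jet_alg_comp u i] is x_i for u = (xi, x_1, ..., x_k), with x_0 = xi. *)
Definition jet_alg_comp (m : nat) (u : E * 'M[R]_(m, n)) (i : nat) : E :=
  if i is j.+1 then jcomp u.2 j.+1 else u.1.

Lemma jet_chart0 : zJ = (z0, 0).
Proof. by rewrite (jet_lie_one hG). Qed.

Lemma jet_mul_chartE (p : (E * M) * (E * M)) : lg_mul_chart J p =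
  (lg_mul_chart G (p.1.1, p.2.1),
   \matrix_(i < k) ad_row br (Ad (psi p.1.1)) (jcomp p.1.2) (jcomp p.2.2) i.+1).
Proof. by rewrite /lg_mul_chart (jet_lie_mulE hG) (jet_lie_one hG). Qed.

Lemma smooth_near_jet_mul_chart : smooth_near (lg_mul_chart J) ((z0, 0), (z0, 0)).
Proof.
have hJ := jet_lie_group hG k.
by rewrite -jet_chart0; exact: (smooth_near_mul_chart hJ).
Qed.

Lemma jet_bracketE (X Y : E * M) : lie_bracket J X Y =
  'D_(X, 0) ('D_(0, Y) (lg_mul_chart J)) ((z0, 0), (z0, 0)) -
  'D_(Y, 0) ('D_(0, X) (lg_mul_chart J)) ((z0, 0), (z0, 0)).
Proof.
have hJ := jet_lie_group hG k.
by rewrite (bracket_mul_chartC hJ) jet_chart0.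
Qed.

Lemma jet_bracket1 (X Y : E * M) : (lie_bracket J X Y).1 = br X.1 Y.1.
Proof.
have sm := smooth_near_jet_mul_chart.
have D (v w : (E * M) * (E * M)) : ('D_v ('D_w (lg_mul_chart J)) ((z0, 0), (z0, 0))).1 =
    'D_(v.1.1, v.2.1) ('D_(w.1.1, w.2.1) (lg_mul_chart G)) (z0, z0).
  have lf : linear (fst : E * M -> E) by exact: linear_fst.
  have ll : linear (fun p : (E * M) * (E * M) => (p.1.1, p.2.1) : E * E) by [].
  rewrite -(derive2_linear_comp v w lf sm).
  rewrite (_ : (fun p => (lg_mul_chart J p).1) = fun p => lg_mul_chart G (p.1.1, p.2.1));
      last first.
    by apply/funext => p; rewrite jet_mul_chartE.
  by apply: (derive2_comp_linear v w ll); exact: (smooth_near_mul_chart hG).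
rewrite jet_bracketE (bracket_mul_chartC hG).
exact: (congr2 (fun a b : E => a - b) (D _ _) (D _ _)).
Qed.

(** A row of the product is affine in the second jet, which settles the inner derivative. The outer
    one is taken at the identity, where all letters vanish, so only words with at most one bracket
    contribute. *)
Lemma derive2_jet_mul_chart (X Y : E * M) i : (i < k)%N ->
  jcomp ('D_(X, 0) ('D_(0, Y) (lg_mul_chart J)) ((z0, 0), (z0, 0))).2 i.+1 =
  \sum_(j < i.+1) br (jet_alg_comp X (i - j)) (jet_alg_comp Y j.+1) *+ 'C(i, j).
Proof.
move=> ik; have sm := smooth_near_jet_mul_chart.
have bb : bilinear_map br by exact: (bracket_bilinear hG).
have ls : linear (fun p : E * M => jcomp p.2 i.+1).
  by move=> a u v; exact: (@jcomp_linear R n k i.+1).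
pose L (P : E * M) (v : E * M) := \sum_(j < i.+1)
  comp_sum (i - j) (br_word br (jcomp P.2) (Ad (psi P.1) (jcomp v.2 j.+1))) *+ 'C(i, j).
have lL P : linear (L P).
  apply: linear_sum_mulrn => j.
  apply: (@linear_comp_sum R (E * M)%type E (i - j) (fun v : E * M =>
    br_word br (jcomp P.2) (Ad (psi P.1) (jcomp v.2 j.+1)))) => s.
  apply: (@linear_br_word R (E * M)%type E br bb (jcomp P.2) s (fun v : E * M =>
      Ad (psi P.1) (jcomp v.2 j.+1))) => b u' v'.
  rewrite (@jcomp_linear R n k j.+1); exact: (Ad_linear hG).
rewrite -(derive2_linear_comp _ _ ls sm) derive2_slices.
(* For every fixed [P] the row is a constant plus the linear map [L P] of the second jet, so its
   derivative in direction [Y] is [L P Y]. *)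
rewrite (_ : (fun P => 'D_Y _ _) = fun P => L P Y); last first.
  apply/funext => P; rewrite -(derive_affine (jcomp P.2 i.+1) (z0, 0) Y (lL P)).
  apply: (congr1 (fun f => 'D_Y f _)); apply/funext => Q.
  rewrite jet_mul_chartE (@jcomp_rows R n k (fun i => ad_row br _ _ _ i.+1) i.+1) //.
  exact: ad_rowS.
have sx l : smooth_near (fun P : E * M => jcomp P.2 l) (z0, 0).
  by apply: smooth_near_linear => a u v; exact: (@jcomp_linear R n k l).
have sA v : smooth_near (fun P : E * M => Ad (psi P.1) v) (z0, 0).
  have sfst : smooth_near (fst : E * M -> E) (z0, 0) by exact: smooth_near_linear.
  exact: (smooth_near_comp sfst (smooth_near_Ad_chart hG v)).
have s (j : 'I_i.+1) : smooth_near (fun P : E * M =>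
    comp_sum (i - j) (br_word br (jcomp P.2) (Ad (psi P.1) (jcomp Y.2 j.+1)))) (z0, 0).
  by apply: smooth_near_comp_sum => w; exact: (smooth_near_br_word bb w sx (sA _)).
have db (j : 'I_i.+1) := smooth_near_differentiable (smooth_near_mulrn 'C(i, j) (s j)).
rewrite (derive_sumE (index_enum 'I_i.+1) X db).2; apply: eq_bigr => j _.
have lm : linear (fun u : E => u *+ 'C(i, j)) by move=> c u v; rewrite mulrnDl scalerMnr.
rewrite (derive_linear_comp X lm (smooth_near_differentiable (s j))).
apply: (congr1 (fun z => z *+ _)).
rewrite (derive_comp_sum_br_word bb (i - j) X sx (sA _)); last by move=> l; exact: jcomp0.
(* For j = i the word is empty and Ad itself is differentiated, giving the bracket with [X.1].
   Otherwise the single letter of index i - j is differentiated, and Ad is the identity there. *)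
case: (i - j)%N => [|m].
  have lf : linear (fst : E * M -> E) by exact: linear_fst.
  have sa : smooth_near (fun z => Ad (psi z) (jcomp Y.2 j.+1)) ((z0, 0) : E * M).1.
    exact: smooth_near_Ad_chart.
  by apply: (etrans (derive_comp_linear X lf sa)); exact: (esym (lie_bracketE _ _ _)).
rewrite (derive_linear (z0, 0) X (f := fun P : E * M => jcomp P.2 m.+1)); last first.
  by move=> a u v; exact: (@jcomp_linear R n k m.+1).
by rewrite /= (lg_psi0 hG) (Ad_one hG).
Qed.

(** This is the Leibniz formula for the pointwise bracket of two curves in the Lie algebra whose
    derivatives at 0 are the components of [X] and [Y]. *)
Lemma jet_bracket_comp (X Y : E * M) i : (i <= k)%N ->
  jet_alg_comp (lie_bracket J X Y) i =
  \sum_(j < i.+1) br (jet_alg_comp X j) (jet_alg_comp Y (i - j)) *+ 'C(i, j).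
Proof.
case: i => [_|i ik]; first by rewrite big_ord1 bin0 mulr1n; exact: jet_bracket1.
rewrite -(sum_antisym _ _ _ (bracketC hG)).
have jsub (Z A B : E * M) s t : Z = A - B -> jcomp A.2 i.+1 = s -> jcomp B.2 i.+1 = t ->
    jcomp Z.2 i.+1 = s - t.
  move=> -> <- <-; have lj := @jcomp_linear R n k i.+1.
  by rewrite -(linear_opp _ lj); exact: (linear_add _ _ lj).
exact: (jsub _ _ _ _ _ (jet_bracketE X Y) (derive2_jet_mul_chart X Y ik)
    (derive2_jet_mul_chart Y X ik)).
Qed.

End JetBracket.

(** The Jacobi identity is evaluated on lifts with zero last component. Each double bracket has last
    component [act a (s b c) + s a (brL b c)], and antisymmetry of [s] turns the second terms into
    the subtracted ones. *)
Lemma extension_lie_cocycle (X L V : zmodType) (brX : X -> X -> X) (brL : L -> L -> L)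
    (pr : L -> V -> X) (last : X -> V) (act : L -> V -> V) (s : L -> L -> V) :
  (forall x y z, brX x (brX y z) + brX y (brX z x) + brX z (brX x y) = 0) ->
  (forall x y, brX x y = - brX y x) ->
  (forall u x, last (pr u x) = x) -> {morph last : x y / x + y} -> {morph last : x / - x} ->
  last 0 = 0 ->
  (forall u v x y, brX (pr u x) (pr v y) = pr (brL u v) (act u y - act v x + s u v)) ->
  (forall u, act u 0 = 0) ->
  forall u v w, act u (s v w) + act v (s w u) + act w (s u v)
    - s (brL u v) w - s (brL v w) u - s (brL w u) v = 0.
Proof.
move=> jac brC prK lD lN l0 prB act0 u v w.
have sE a b : s a b = last (brX (pr a 0) (pr b 0)) by rewrite prB prK !act0 subr0 add0r.
have sC a b : s a b = - s b a by rewrite !sE brC lN.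
have K a b c : last (brX (pr a 0) (brX (pr b 0) (pr c 0))) = act a (s b c) + s a (brL b c).
  by rewrite !prB prK !act0 !subr0 add0r.
have := jac (pr u 0) (pr v 0) (pr w 0) => /(congr1 last).
rewrite !lD !K l0 (addrACA (act u (s v w)))
  (addrACA (act u (s v w) + act v (s w u))) => H.
rewrite -(sC w) -(sC u) -(sC v) -addrA -addrA (addrC (s w _)).
exact: H.
Qed.

(** The end terms pair a top component with one of index 0, which yields the two actions; what
    remains is the Lie algebra cocycle. *)
Lemma leibniz_sum_ends (V : zmodType) (br : V -> V -> V) (x y : nat -> V) k : (0 < k)%N ->
  \sum_(j < k.+1) br (x j) (y (k - j)%N) *+ 'C(k, j) =
  br (x 0%N) (y k) + br (x k) (y 0%N) + \sum_(1 <= i < k) br (x i) (y (k - i)%N) *+ 'C(k, i).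
Proof.
move=> k0; rewrite -(big_mkord xpredT (fun j => br (x j) (y (k - j)%N) *+ 'C(k, j))).
rewrite big_ltn // big_nat_recr //= subn0 subnn bin0 binn !mulr1n.
by rewrite (addrC (\sum_(1 <= i < k) _)) addrA.
Qed.

(** * The jet algebra as an abelian extension *)

Section JetAlgebra.
Context {R : realType} {n k : nat}.
Hypothesis k0 : (0 < k)%N.
Variables (G : lie_data 'rV[R]_n) (hG : is_lie_group G).
Local Notation E := 'rV[R]_n.
Local Notation J := (jet_lie G k).
Local Notation Q := (jet_lie G k.-1).
Local Notation br := (lie_bracket G).
Local Notation L := (E * 'M[R]_(k.-1, n))%type.
Local Notation X := (E * 'M[R]_(k, n))%type.

Local Opaque Ad derive derive1 lie_bracket derive1n smooth_at smooth_near comp_sum.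

Lemma jet_alg_compE m (u : E * 'M[R]_(m, n)) i : (0 < i)%N -> jet_alg_comp u i = jcomp u.2 i.
Proof. by case: i. Qed.

Lemma jet_alg_comp_jpair (u : L) (x : E) i : (i < k)%N ->
  jet_alg_comp (jpair u x) i = jet_alg_comp u i.
Proof. by case: i => [//|i] ik; apply: jcomp_jpair. Qed.

Lemma jet_alg_comp_last (u : L) (x : E) : jet_alg_comp (jpair u x) k = x.
Proof. by rewrite (jet_alg_compE (jpair u x) k0); exact: jcomp_jpair_last. Qed.

Lemma jpair_bracket (u v : L) (x y : E) : lie_bracket J (jpair u x) (jpair v y) =
  jpair (lie_bracket Q u v) (jact_alg G u y - jact_alg G v x + cocycle_alg G u v).
Proof.
apply: (eq_jpair k0).
- rewrite (jet_bracket1 hG (jpair u x) (jpair v y)); exact: (esym (jet_bracket1 hG u v)).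
- move=> i /andP[i0 ik]; rewrite -(jet_alg_compE (lie_bracket J _ _) i0) -(jet_alg_compE _ i0).
  rewrite (jet_bracket_comp hG (jpair u x) (jpair v y) (ltnW ik)).
  have ik1 : (i <= k.-1)%N by rewrite -ltnS (prednK k0).
  rewrite (jet_bracket_comp hG u v ik1); apply: eq_bigr => j _.
  rewrite jet_alg_comp_jpair; last by apply: leq_ltn_trans ik; rewrite -ltnS.
  by rewrite jet_alg_comp_jpair // (leq_ltn_trans (leq_subr _ _)).
rewrite -(jet_alg_compE (lie_bracket J _ _) k0).
rewrite (jet_bracket_comp hG (jpair u x) (jpair v y) (leqnn k)).
rewrite (leibniz_sum_ends br _ _ k0) (jet_alg_comp_last u x) (jet_alg_comp_last v y).
rewrite /jact_alg -(bracketC hG x); apply: (congr1 (+%R _)).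
apply: eq_big_nat => i /andP[i0 ik].
have ki : (k - i < k)%N by rewrite ltn_subrL i0.
have ki0 : (0 < k - i)%N by rewrite subn_gt0.
rewrite (jet_alg_comp_jpair u x ik) (jet_alg_comp_jpair v y ki).
by rewrite (jet_alg_compE u i0) (jet_alg_compE v ki0).
Qed.

Lemma jpair_linear (a : R) (u v : L) (x y : E) :
  jpair (a *: u + v) (a *: x + y) = (a *: (jpair u x : X) + (jpair v y : X) : X).
Proof.
apply: (congr1 (pair _)); apply/matrixP => i j; rewrite !mxE.
by case: (i < k.-1)%N; rewrite ?(@jcomp_linear R n k.-1 i.+1) !mxE.
Qed.

Lemma jproj_linear : linear (@jproj R n E k : X -> L).
Proof.
move=> a p q; apply: (congr1 (pair _)); apply/matrixP => i j; rewrite !mxE.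
by rewrite (@jcomp_linear R n k i.+1) !mxE.
Qed.

(** As the last component of a bracket of linear lifts, the cocycle inherits bilinearity and
    [s u u = 0] from the bracket of the jet group. *)
Lemma cocycle_algE (u v : L) :
  cocycle_alg G u v = jcomp (lie_bracket J (jpair u 0) (jpair v 0)).2 k.
Proof.
have A0 (w : L) : jact_alg G w 0 = 0 by exact: (linear_zero (bracket_linear_r hG _)).
by rewrite jpair_bracket (jcomp_jpair_last k0) !A0 subr0 add0r.
Qed.

Lemma jet_alg_cocycle : lie_algebra_2cocycle (lie_bracket Q) (@jact_alg R n G k.-1)
  (@cocycle_alg R n G k).
Proof.
have hJ := jet_lie_group hG k.
have lj := @jcomp_linear R n k k.
have pl (a : R) (u v : L) : jpair (a *: u + v) 0 = (a *: (jpair u 0 : X) + (jpair v 0 : X)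
    : X).
  by rewrite -jpair_linear scaler0 addr0.
split; split.
- by move=> y a u v; exact: (bracket_linear_l hG).
- by move=> u; exact: (bracket_linear_r hG).
- move=> u v y; rewrite /jact_alg (jet_bracket1 hG u v) (jacobi_derivation hG u.1).
  by rewrite addrK.
- move=> v a u w; rewrite !cocycle_algE pl (bracket_linear_l hJ); exact: lj.
- move=> u a v w; rewrite !cocycle_algE pl (bracket_linear_r hJ); exact: lj.
- by move=> u; rewrite cocycle_algE (bracket_xx hJ); exact: (linear_zero lj).
have [_ _ _ jac] := lie_bracket_is_lie_algebra hJ.
apply: (extension_lie_cocycle (last := fun p : X => jcomp p.2 k) jac (bracketC hJ)
  (fun a x => jcomp_jpair_last k0 a x) _ _ _ jpair_bracket).
- by move=> x y; exact: (linear_add _ _ lj).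
- by move=> x; exact: (linear_opp _ lj).
- exact: (linear_zero lj).
by move=> u; exact: (linear_zero (bracket_linear_r hG _)).
Qed.

Lemma jet_alg_extension : abelian_lie_algebra_extension
  (fun _ _ => 0) (lie_bracket J) (lie_bracket Q) (jincl_alg k) (@jproj R n E k).
Proof.
have hJ := jet_lie_group hG k; have hQ := jet_lie_group hG k.-1.
have B0 : lie_bracket Q 0 0 = 0 by exact: (bracket_xx hQ).
split.
  split; [|exact: (lie_bracket_is_lie_algebra hJ)|exact: (lie_bracket_is_lie_algebra hQ)].
  split=> //.
  - by move=> y a u v; rewrite scaler0 addr0.
  - by move=> y a u v; rewrite scaler0 addr0.
  - by move=> x y z; rewrite !addr0.
split; first by [].
split.
  split.
  - split.
      move=> a x y; rewrite /jincl_alg -jpair_linear.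
      by apply: (congr1 (fun u : L => jpair u _)); rewrite scaler0 addr0.
    move=> x y; rewrite /jincl_alg jpair_bracket.
    have cc : cocycle_alg G ((0, 0) : L) ((0, 0) : L) = 0.
      by have [_ [_ _ ss _]] := jet_alg_cocycle; exact: ss.
    have aa z : jact_alg G ((0, 0) : L) z = 0 by exact: (linear_zero (bracket_linear_l hG z)).
    by rewrite cc !aa subrr addr0; apply: (congr1 (fun u : L => jpair u _)); exact: (esym B0).
  - move=> x y /(congr1 (fun p => jcomp p.2 k)).
    by rewrite !(jcomp_jpair_last k0).
  - split; first exact: jproj_linear.
    move=> p q; rewrite -{1}(jprojK k0 p) -{1}(jprojK k0 q) jpair_bracket.
    exact: (jpairK k0).
  - by move=> u; exists (jpair u 0); exact: (jpairK k0).
move=> p; split=> [p0|[x ->]]; last exact: (jpairK k0).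
by exists (jcomp p.2 k); rewrite -[LHS](jprojK k0) p0.
Qed.

End JetAlgebra.

Theorem proposition4p1 (R : realType) (n : nat) (G : lie_data 'rV[R]_n)
    (hG : is_lie_group G) (k : nat) (hk : (0 < k)%N) :
  (is_right_trivialization G k /\ is_right_trivialization G k.-1) /\
  (abelian_lie_group_extension
     (A := vec_lie 'rV[R]_n) (X := jet_lie G k) (Q := jet_lie G k.-1)
     (jincl G k) (@jproj R n G k) /\
   group_2cocycle (G := jet_lie G k.-1) (@jact R n G k.-1)
     (@cocycle_part R n G k) /\
   (forall (a b : jet_lie G k.-1) (x y : 'rV[R]_n),
      @lg_mul R _ (jet_lie G k) (jpair a x) (jpair b y) =
      jpair (lg_mul a b) (x + jact a y + cocycle_part a b)) /\
   (forall a b : jet_lie G k.-1, cocycle_part a b = cocycle_comp a b)) /\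
  (abelian_lie_algebra_extension
     (fun _ _ => 0) (lie_bracket (jet_lie G k)) (lie_bracket (jet_lie G k.-1))
     (jincl_alg k) (@jproj R n 'rV[R]_n k) /\
   lie_algebra_2cocycle (lie_bracket (jet_lie G k.-1)) (@jact_alg R n G k.-1)
     (@cocycle_alg R n G k) /\
   (forall (u v : ('rV[R]_n * 'M[R]_(k.-1, n))%type) (x y : 'rV[R]_n),
      lie_bracket (jet_lie G k) (jpair u x) (jpair v y) =
      jpair (lie_bracket (jet_lie G k.-1) u v)
        (jact_alg G u y - jact_alg G v x + cocycle_alg G u v))).

Proof.
split; first by split; exact: (right_trivialization hG).
split; split; [exact: jet_extension|split;
    [exact: jet_cocycle|split]|exact: jet_alg_extension|split].
- exact: jpair_mul.
- exact: cocycle_part_comp.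
- exact: jet_alg_cocycle.
- exact: jpair_bracket.
Qed.
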